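(* Let $\Sigma=S^2$ with initial metric $g_1=\sigma$ the standard round metric, and prescribe the scalar curvature $\bar R\equiv0$ on $N=[1,\infty)\times\Sigma$. Then the metric $\bar g=u^2dt^2+t^2g(t)$ with totally geodesic boundary $\{1\}\times\Sigma$ obtained by the construction described in the context is exactly a Schwarzschild metric, namely $$\bar g=\frac{1}{1-\frac1t}\,dt^2+t^2\sigma,$$ with ADM mass $m_{ADM}=\frac12$.
   Context: The construction. Let $g(t)$, $t\ge1$, be the solution on the 2-sphere $\Sigma$ (of area $4\pi$) of the modified Ricci flow $$\frac{\partial}{\partial t}g_{ij}=(r-R)g_{ij}+2D_iD_j\mathcal F=2M_{ij},\qquad g(1,\cdot)=g_1,$$ where $R$ is the scalar curvature of $g(t)$, $r=\int R\,d\mu/\int1\,d\mu=2$, the Ricci potential $\mathcal F$ solves $\Delta\mathcal F=R-r$ with mean value zero, and $M_{ij}=\frac12(r-R)g_{ij}+D_iD_j\mathcal F$. Let $\bar R$ be a function on $N=[1,\infty)\times\Sigma$ with $t^2\bar R<R$. The metric $\bar g=u^2dt^2+t^2g(t)$ has scalar curvature $\bar R$ iff $$t\frac{\partial u}{\partial t}=\frac12u^2\Delta u+\left(\frac{t^2}{4}|M|^2+\frac12\right)u-\frac14\left(R-t^2\bar R\right)u^3,\qquad(\mathrm E)$$ with $\Delta$ and $|M|^2=M_{ij}M_{kl}g^{ik}g^{jl}$ taken with respect to $g(t)$. Put $\tilde u(t,x)=\sqrt{\tfrac{t}{t+1}}\,u(t+1,x)$ for $t>0$, and set $|\tilde M(t)|^2=\frac{t+1}{t}|M(t+1)|^2$,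 $\tilde R(t)=R(t+1)$, $t^2\tilde R_N(t)=(t+1)^2\bar R(t+1)$, $$\tilde\delta_*(t)=\frac1t\int_0^t\left(\frac{\tilde R}{2}-\frac{\tau^2}{2}\tilde R_N\right)_{*}(\tau)\,e^{-\int_\tau^t\frac{s(|\tilde M|^* )^2}{2}ds}d\tau,\qquad \tilde\delta^*(t)=\frac1t\int_0^t\left(\frac{\tilde R}{2}-\frac{\tau^2}{2}\tilde R_N\right)^{*}(\tau)\,e^{-\int_\tau^t\frac{s(|\tilde M|_* )^2}{2}ds}d\tau,$$ where $\xi_*(t)=\inf_{x}\xi(t,x)$ and $\xi^*(t)=\sup_x\xi(t,x)$. For $0<\epsilon<1$ choose any $\varphi_\epsilon\in C^{2,\alpha}(\Sigma)$, $\varphi_\epsilon>0$, with $\tilde\delta_*(\epsilon)\le\varphi_\epsilon^{-2}\le\tilde\delta^*(\epsilon)$, and let $\tilde u_\epsilon$ on $[\epsilon,\infty)\times\Sigma$ correspond to the positive solution of (E) on $[1+\epsilon,\infty)\times\Sigma$ with $\tilde u_\epsilon(\epsilon,\cdot)=\varphi_\epsilon$; these satisfy $\tilde\delta_*\le\tilde u_\epsilon^{-2}\le\tilde\delta^*$. A limit $\tilde u$ of a sequence $\tilde u_{\epsilon_j}$, $\epsilon_j\to0$, locally in (parabolic) $C^{2+\alpha}$ on $(0,\infty)\times\Sigma$, gives via $u(t,x)=\sqrt{\tfrac{t}{t-1}}\,\tilde u(t-1,x)$ the solution $u$ on $(1,\infty)\times\Sigma$ and the metric $\bar g$ obtained by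 the construction. *)

(* Defs.v *)
From Stdlib Require Import Reals.
From Coquelicot Require Import Coquelicot.
Open Scope R_scope.

Definition dir {V : NormedModule R_AbsRing} (f : V -> R) (v x : V) : R :=
  Derive (fun h : R => f (plus x (scal h v))) 0.

Definition ex_dir {V : NormedModule R_AbsRing} (f : V -> R) (v x : V) : Prop :=
  ex_derive (fun h : R => f (plus x (scal h v))) 0.

(* [Ck k D f]: f is of class C^k on the open set D of the finite-dimensional
   space V, i.e. all iterated directional derivatives up to order k exist and
   are continuous on D. *)
Fixpoint Ck {V : NormedModule R_AbsRing} (k : nat) (D : V -> Prop) (f : V -> R)
  : Prop :=
  (forall x, D x -> continuous f x) /\
  match k with
  | O => True
  | S k' => forall v : V, (forall x, D x -> ex_dir f v x) /\ Ck k' D (dir f v)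
  end.

Definition everywhere {V : Type} : V -> Prop := fun _ => True.

Definition plane := (R * R)%type.
Definition space := (R * R * R)%type.

Inductive idx := i1 | i2.
Definition sum2 (a : idx -> R) : R := a i1 + a i2.
Definition basis (i : idx) : plane :=
  match i with i1 => (1, 0) | i2 => (0, 1) end.

Definition dot (v w : space) : R :=
  let '(v1, v2, v3) := v in let '(w1, w2, w3) := w in
  v1 * w1 + v2 * w2 + v3 * w3.

(* Functions and tensors on the unit sphere are represented by functions on
   [space] of which only the values at points satisfying [on_sphere] (and on
   vectors satisfying [tangent]) are ever used. *)
Definition on_sphere (x : space) : Prop := dot x x = 1.
Definition tangent (x v : space) : Prop := dot x v = 0.

Inductive chart := from_north | from_south.
Definition pole (c : chart) : R :=
  match c with from_north => 1 | from_south => -1 end.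

Definition param (c : chart) (y : plane) : space :=
  let '(a, b) := y in
  let n := 1 + a ^ 2 + b ^ 2 in
  (2 * a / n, 2 * b / n, pole c * (a ^ 2 + b ^ 2 - 1) / n).

Definition coord (c : chart) (x : space) : plane :=
  let '(x1, x2, x3) := x in
  (x1 / (1 - pole c * x3), x2 / (1 - pole c * x3)).

Definition dparam (c : chart) (i : idx) (y : plane) : space :=
  (dir (fun z : plane => fst (fst (param c z))) (basis i) y,
   dir (fun z : plane => snd (fst (param c z))) (basis i) y,
   dir (fun z : plane => snd (param c z)) (basis i) y).

(* A chart whose domain contains x: both are defined off the poles, and the
   scalars computed below do not depend on the choice. *)
Definition chart_at (x : space) : chart :=
  if Rle_dec (snd x) 0 then from_north else from_south.

Definition smooth_on_sphere (f : space -> R) : Prop :=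
  forall (c : chart) (k : nat), Ck k everywhere (fun y : plane => f (param c y)).

Definition metric := space -> space -> space -> R.

Definition round : metric := fun _ v w => dot v w.

Definition inner_product_at (h : metric) (x : space) : Prop :=
  (forall v w, tangent x v -> tangent x w -> h x v w = h x w v) /\
  (forall (a : R) v v' w, tangent x v -> tangent x v' -> tangent x w ->
     h x (plus (scal a v) v') w = a * h x v w + h x v' w) /\
  (forall v, tangent x v -> v <> (0, 0, 0) -> 0 < h x v v).

Definition comp (h : metric) (c : chart) (i j : idx) (y : plane) : R :=
  h (param c y) (dparam c i y) (dparam c j y).

Definition riemannian (h : metric) : Prop :=
  (forall x, on_sphere x -> inner_product_at h x) /\
  (forall c i j k, Ck k everywhere (comp h c i j)).

Definition local_metric := idx -> idx -> plane -> R.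

Definition pd (i : idx) (f : plane -> R) : plane -> R := dir f (basis i).

Definition det (G : local_metric) (y : plane) : R :=
  G i1 i1 y * G i2 i2 y - G i1 i2 y * G i2 i1 y.

Definition inv (G : local_metric) (i j : idx) (y : plane) : R :=
  match i, j with
  | i1, i1 => G i2 i2 y
  | i1, i2 => - G i1 i2 y
  | i2, i1 => - G i2 i1 y
  | i2, i2 => G i1 i1 y
  end / det G y.

(* [Gamma G k i j] is the Christoffel symbol with upper index k. *)
Definition Gamma (G : local_metric) (k i j : idx) (y : plane) : R :=
  / 2 * sum2 (fun l => inv G k l y *
    (pd i (G j l) y + pd j (G i l) y - pd l (G i j) y)).

Definition Ricci (G : local_metric) (i j : idx) (y : plane) : R :=
  sum2 (fun k => pd k (Gamma G k i j) y - pd j (Gamma G k i k) y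
    + sum2 (fun l => Gamma G k k l y * Gamma G l i j y
                     - Gamma G k j l y * Gamma G l i k y)).

Definition local_scal (G : local_metric) (y : plane) : R :=
  sum2 (fun i => sum2 (fun j => inv G i j y * Ricci G i j y)).

Definition local_hess (G : local_metric) (f : plane -> R) (i j : idx)
  (y : plane) : R :=
  pd i (pd j f) y - sum2 (fun k => Gamma G k i j y * pd k f y).

Definition local_laplace (G : local_metric) (f : plane -> R) (y : plane) : R :=
  sum2 (fun i => sum2 (fun j => inv G i j y * local_hess G f i j y)).

Definition local_normsq (G T : local_metric) (y : plane) : R :=
  sum2 (fun i => sum2 (fun j => sum2 (fun k => sum2 (fun l =>
    T i j y * T k l y * inv G i k y * inv G j l y)))).

Definition scalar_curvature (h : metric) (x : space) : R :=
  let c := chart_at x in local_scal (comp h c) (coord c x).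

Definition laplacian (h : metric) (f : space -> R) (x : space) : R :=
  let c := chart_at x in
  local_laplace (comp h c) (fun y => f (param c y)) (coord c x).

(* Integral against the area element of h, in spherical coordinates. *)
Definition sphere_integral (h : metric) (f : space -> R) : R :=
  RInt (fun th : R => RInt (fun ph : R =>
    let x := (sin th * cos ph, sin th * sin ph, cos th) in
    let dth := (cos th * cos ph, cos th * sin ph, - sin th) in
    let dph := (- (sin th * sin ph), sin th * cos ph, 0) in
    f x * sqrt (h x dth dth * h x dph dph - h x dth dph * h x dph dth))
    0 (2 * PI)) 0 PI.

Definition mean_scalar_curvature (h : metric) : R :=
  sphere_integral h (scalar_curvature h) / sphere_integral h (fun _ => 1).

Definition sup_sphere (f : space -> R) : R :=
  real (Lub_Rbar (fun r => exists x, on_sphere x /\ r = f x)).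
Definition inf_sphere (f : space -> R) : R :=
  real (Glb_Rbar (fun r => exists x, on_sphere x /\ r = f x)).

Definition Mten (h : metric) (F : space -> R) (c : chart) : local_metric :=
  fun i j y =>
    / 2 * (mean_scalar_curvature h - scalar_curvature h (param c y))
      * comp h c i j y
    + local_hess (comp h c) (fun z => F (param c z)) i j y.

Definition M_normsq (h : metric) (F : space -> R) (x : space) : R :=
  let c := chart_at x in local_normsq (comp h c) (Mten h F c) (coord c x).

(* Smoothness on the half-space t >= 1 is expressed by a smooth extension. The
   constant r = 2 of the flow appears as the mean scalar curvature. *)
Record modified_ricci_flow (g1 : metric) (g : R -> metric)
  (F : R -> space -> R) : Prop := {
  flow_riemannian : forall t, 1 <= t -> riemannian (g t);
  flow_smooth : forall c i j, exists E : R * plane -> R,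
    (forall k, Ck k everywhere E) /\
    (forall t y, 1 <= t -> E (t, y) = comp (g t) c i j y);
  flow_initial : forall x v w, on_sphere x -> tangent x v -> tangent x w ->
    g 1 x v w = g1 x v w;
  flow_area : sphere_integral (g 1) (fun _ => 1) = 4 * PI;
  potential_smooth : forall t, 1 <= t -> smooth_on_sphere (F t);
  potential_poisson : forall t x, 1 <= t -> on_sphere x ->
    laplacian (g t) (F t) x
    = scalar_curvature (g t) x - mean_scalar_curvature (g t);
  potential_mean : forall t, 1 <= t -> sphere_integral (g t) (F t) = 0;
  flow_equation : forall t c i j y, 1 < t ->
    is_derive (fun s => comp (g s) c i j y) t (2 * Mten (g t) (F t) c i j y)
}.

Definition in_chart (u : R -> space -> R) (c : chart) : R * plane -> R :=
  fun p => u (fst p) (param c (snd p)).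

Definition dt (f : R * plane -> R) : R * plane -> R := dir f (1, (0, 0)).
Definition dx (i : idx) (f : R * plane -> R) : R * plane -> R :=
  dir f (0, basis i).

Definition C21 (D : R * plane -> Prop) (f : R * plane -> R) : Prop :=
  forall p, D p ->
    continuous f p /\
    ex_dir f (1, (0, 0)) p /\ continuous (dt f) p /\
    (forall i, ex_dir f (0, basis i) p /\ continuous (dx i f) p) /\
    (forall i j, ex_dir (dx i f) (0, basis j) p /\
                 continuous (dx j (dx i f)) p).

Definition eucl (y z : plane) : R :=
  sqrt ((fst y - fst z) ^ 2 + (snd y - snd z) ^ 2).

Definition par_dist (p q : R * plane) : R :=
  eucl (snd p) (snd q) + sqrt (Rabs (fst p - fst q)).

(* The parabolic C^{2+alpha} norm of f on [a, b] x {|y| <= rho} is controlled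
   by C: each of its sup-norm and Holder-seminorm terms is at most C. *)
Definition par_C2a_le (alpha a b rho : R) (f : R * plane -> R) (C : R) : Prop :=
  let K := fun p : R * plane => a <= fst p <= b /\ eucl (snd p) (0, 0) <= rho in
  (forall p, K p ->
     Rabs (f p) <= C /\ Rabs (dt f p) <= C /\
     (forall i, Rabs (dx i f p) <= C) /\
     (forall i j, Rabs (dx j (dx i f) p) <= C)) /\
  (forall p q, K p -> K q -> p <> q ->
     Rabs (dt f p - dt f q) <= C * Rpower (par_dist p q) alpha /\
     (forall i j, Rabs (dx j (dx i f) p - dx j (dx i f) q)
                  <= C * Rpower (par_dist p q) alpha)).

Definition par_C2a_loc (alpha : R) (u : R -> space -> R) : Prop :=
  forall c, C21 (fun p => 0 < fst p) (in_chart u c) /\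
    forall a b rho, 0 < a < b -> 0 < rho ->
      exists C, par_C2a_le alpha a b rho (in_chart u c) C.

Definition par_C2a_cvg (alpha : R) (w : nat -> R -> space -> R)
  (u : R -> space -> R) : Prop :=
  forall c a b rho, 0 < a < b -> 0 < rho -> forall eta, 0 < eta ->
    exists J, forall j, (J <= j)%nat ->
      par_C2a_le alpha a b rho
        (in_chart (fun t x => w j t x - u t x) c) eta.

Definition C2a_on_sphere (alpha : R) (f : space -> R) : Prop :=
  forall c, let fc := fun y : plane => f (param c y) in
    Ck 2 everywhere fc /\
    forall rho, 0 < rho -> exists C, forall y z,
      eucl y (0, 0) <= rho -> eucl z (0, 0) <= rho -> y <> z ->
      forall i j, Rabs (pd i (pd j fc) y - pd i (pd j fc) z)
                  <= C * Rpower (eucl y z) alpha.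

(* Positive classical solution, on [a, +oo) x sphere, of the equation expressing
   that u^2 dt^2 + t^2 g(t) has scalar curvature Rbar. Only continuity is
   required at the initial time t = a. *)
Record solves_E (g : R -> metric) (F Rbar : R -> space -> R) (a : R)
  (u : R -> space -> R) : Prop := {
  solves_E_pos : forall t x, a <= t -> on_sphere x -> 0 < u t x;
  solves_E_continuous : forall c (p : R * plane), a <= fst p ->
    filterlim (in_chart u c) (within (fun q => a <= fst q) (locally p))
      (locally (in_chart u c p));
  solves_E_C21 : forall c, C21 (fun p => a < fst p) (in_chart u c);
  solves_E_eq : forall t x, a < t -> on_sphere x ->
    t * Derive (fun s => u s x) t
    = / 2 * u t x ^ 2 * laplacian (g t) (u t) x
      + (t ^ 2 / 4 * M_normsq (g t) (F t) x + / 2) * u t x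
      - / 4 * (scalar_curvature (g t) x - t ^ 2 * Rbar t x) * u t x ^ 3
}.

Definition Mtilde (g : R -> metric) (F : R -> space -> R) (t : R) (x : space)
  : R := sqrt ((t + 1) / t * M_normsq (g (t + 1)) (F (t + 1)) x).

Definition Rtilde (g : R -> metric) (t : R) (x : space) : R :=
  scalar_curvature (g (t + 1)) x.

Definition Rtilde_N (Rbar : R -> space -> R) (t : R) (x : space) : R :=
  (t + 1) ^ 2 * Rbar (t + 1) x / t ^ 2.

Definition delta_low (g : R -> metric) (F Rbar : R -> space -> R) (t : R) : R :=
  / t * RInt (fun tau =>
    inf_sphere (fun x => Rtilde g tau x / 2 - tau ^ 2 / 2 * Rtilde_N Rbar tau x)
    * exp (- RInt (fun s => s * sup_sphere (Mtilde g F s) ^ 2 / 2) tau t)) 0 t.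

Definition delta_up (g : R -> metric) (F Rbar : R -> space -> R) (t : R) : R :=
  / t * RInt (fun tau =>
    sup_sphere (fun x => Rtilde g tau x / 2 - tau ^ 2 / 2 * Rtilde_N Rbar tau x)
    * exp (- RInt (fun s => s * inf_sphere (Mtilde g F s) ^ 2 / 2) tau t)) 0 t.

Definition tilde (u : R -> space -> R) (t : R) (x : space) : R :=
  sqrt (t / (t + 1)) * u (t + 1) x.

(* [phi eps] and [w eps] are the initial datum and the solution of this
   equation on [1 + eps, +oo) x sphere; [ut] is the limit of the rescaled solutions
   along the sequence [e]. *)
Record construction_data (alpha : R) (g : R -> metric)
  (F Rbar : R -> space -> R)
  (phi : R -> space -> R) (w : R -> R -> space -> R) (e : nat -> R)
  (ut u : R -> space -> R) : Prop := {
  data_regular : forall eps, 0 < eps < 1 -> C2a_on_sphere alpha (phi eps);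
  data_pos : forall eps x, 0 < eps < 1 -> on_sphere x -> 0 < phi eps x;
  data_bounds : forall eps x, 0 < eps < 1 -> on_sphere x ->
    delta_low g F Rbar eps <= / phi eps x ^ 2 <= delta_up g F Rbar eps;
  approx_solution : forall eps, 0 < eps < 1 ->
    solves_E g F Rbar (1 + eps) (w eps);
  approx_initial : forall eps x, 0 < eps < 1 -> on_sphere x ->
    tilde (w eps) eps x = phi eps x;
  sequence_range : forall j, 0 < e j < 1;
  sequence_cvg : is_lim_seq e 0;
  limit_regular : par_C2a_loc alpha ut;
  limit_cvg : par_C2a_cvg alpha (fun j => tilde (w (e j))) ut;
  solution_eq : forall t x, 1 < t -> on_sphere x ->
    u t x = sqrt (t / (t - 1)) * ut (t - 1) x
}.

Definition obtained_by_construction (alpha : R) (g1 : metric)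
  (Rbar : R -> space -> R) (g : R -> metric) (u : R -> space -> R) : Prop :=
  exists F : R -> space -> R,
    modified_ricci_flow g1 g F /\
    (forall t x, 1 <= t -> on_sphere x ->
       t ^ 2 * Rbar t x < scalar_curvature (g t) x) /\
    exists phi w e ut, construction_data alpha g F Rbar phi w e ut u.

(* A tangent vector at (t, x) is a pair (a, v) with v tangent to the sphere. *)
Definition bar_metric (u : R -> space -> R) (g : R -> metric) (t : R)
  (x : space) (X Y : R * space) : R :=
  u t x ^ 2 * (fst X * fst Y) + t ^ 2 * g t x (snd X) (snd Y).

(* The coefficient u blows up at t = 1. With t = 1 + s^2 the metric reads
   A^2 ds^2 + H(s), where A = 2 s u and H = t^2 g(t); it must extend as a C^1
   metric up to s = 0, and the second fundamental form (2A)^-1 dH/ds of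
   {s = 0} must vanish. As above, C^1 up to s = 0 is expressed by an extension
   to negative s. *)
Definition totally_geodesic_boundary (u : R -> space -> R) (g : R -> metric)
  : Prop :=
  exists (A : R -> space -> R) (H : R -> metric),
    (forall s x, 0 < s -> on_sphere x -> A s x = 2 * s * u (1 + s ^ 2) x) /\
    (forall s x v w, 0 < s -> on_sphere x -> tangent x v -> tangent x w ->
       H s x v w = (1 + s ^ 2) ^ 2 * g (1 + s ^ 2) x v w) /\
    (forall c, Ck 1 everywhere (in_chart A c)) /\
    (forall c i j, Ck 1 everywhere
       (fun p : R * plane => comp (H (fst p)) c i j (snd p))) /\
    (forall s x, 0 <= s -> on_sphere x -> 0 < A s x) /\
    (forall s x, 0 <= s -> on_sphere x -> inner_product_at (H s) x) /\
    (forall c i j y,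
       / (2 * A 0 (param c y)) * Derive (fun s => comp (H s) c i j y) 0 = 0).

Inductive idx3 := j1 | j2 | j3.
Definition sum3 (a : idx3 -> R) : R := a j1 + a j2 + a j3.
Definition basis3 (i : idx3) : space :=
  match i with j1 => (1, 0, 0) | j2 => (0, 1, 0) | j3 => (0, 0, 1) end.
Definition pd3 (i : idx3) (f : space -> R) : space -> R := dir f (basis3 i).

Definition norm3 (x : space) : R := sqrt (dot x x).

Definition kron (i j : idx3) : R :=
  match i, j with j1, j1 | j2, j2 | j3, j3 => 1 | _, _ => 0 end.

(* Components of the metric in the coordinates x = t omega: the vector v at x
   has dt(v) = omega . v and d(omega)(v) = (v - (omega . v) omega) / t. *)
Definition cartesian (u : R -> space -> R) (g : R -> metric) (i j : idx3)
  (x : space) : R :=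
  let t := norm3 x in
  let om : space := scal (/ t) x in
  let push := fun v : space =>
    (dot om v, scal (/ t) (minus v (scal (dot om v) om)) : space) in
  bar_metric u g t om (push (basis3 i)) (push (basis3 j)).

Definition asymptotically_flat (gb : idx3 -> idx3 -> space -> R) : Prop :=
  exists rho0 C q, 0 < rho0 /\ / 2 < q /\
  forall i j,
    Ck 2 (fun x => rho0 < norm3 x) (gb i j) /\
    forall x, rho0 < norm3 x ->
      Rabs (gb i j x - kron i j) <= C * Rpower (norm3 x) (- q) /\
      (forall k, Rabs (pd3 k (gb i j) x) <= C * Rpower (norm3 x) (- q - 1)) /\
      (forall k l, Rabs (pd3 l (pd3 k (gb i j)) x)
                   <= C * Rpower (norm3 x) (- q - 2)).

(* m = lim 1/(16 pi) int_{|x| = rho} (d_j g_ij - d_i g_jj) nu^i dA, with the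
   integral pulled back to the unit sphere: nu = omega, dA = rho^2 d(omega). *)
Definition ADM_mass_is (gb : idx3 -> idx3 -> space -> R) (m : R) : Prop :=
  asymptotically_flat gb /\
  is_lim (fun rho => / (16 * PI) *
    sphere_integral round (fun om =>
      sum3 (fun i => sum3 (fun j =>
        (pd3 j (gb i j) (scal rho om) - pd3 i (gb j j) (scal rho om))
        * dot om (basis3 i))) * rho ^ 2)) p_infty m.

(* Main.v *)
Require Import Defs.
From Stdlib Require Import Reals.
From Coquelicot Require Import Coquelicot.
From Stdlib Require Import Lra Lia Psatz Classical FunctionalExtensionality ClassicalEpsilon.
From Coquelicot Require Import Derive_2d Compactness.
Require Import Defs.
Open Scope R_scope.

(** The round metric is stationary under the flow. Granting this, M = 0 and R = 2 at all
    times, both barriers are identically 1, the initial data of the approximations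
    are forced, and (E) has the explicit solution u = sqrt(t / (t - 1)); everything
    else is read off from this formula.

    The rigidity of the flow is the main point, since the potential F is only known to
    be smooth at each fixed time. It is obtained from the scalar curvature R alone. The
    velocity of the metric is 2M = L_X g + (r - R) g with X the gradient of F. By
    naturality the first term changes R by X R, and the conformal second one by
    Lap R + R (R - r) ([scal_evolution], [flow_scal_evolution]). At the extrema of F the
    Poisson equation Lap F = R - r shows that r lies between the extreme values of R
    ([mean_bounds]). Hence where |R - 2| is maximal on the sphere it grows at most at a rate
    proportional to itself; as it vanishes at t = 1, the maximum principle
    ([parabolic_uniqueness]) gives R = 2 ([flow_scal_constant]). Now F is harmonic on
    a surface of positive curvature. Where |dF|^2 is maximal its derivative vanishes, so
    dF is in the kernel of the traceless Hessian, which is therefore zero, and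
    Bochner's formula reads Lap |dF|^2 = R |dF|^2; so dF = 0 ([harmonic_gradient_max],
    [flow_potential_constant]). Then M = 0 and g(t) is the round metric ([flow_round]).

    The curvature is handled through Brioschi's formula ([local_scal_brioschi]), which
    turns its two first variations into polynomial identities in the jets of the metric
    ([brioschi_var_lie], [brioschi_var_conformal]). The maximum principle needs scalars
    that are smooth across the equator, where the preferred chart changes; their
    independence of the chart follows from the transformation law of the Christoffel
    symbols ([Gamma_change], [scal_change], [laplace_change]). Maxima over
    [a, b] x sphere exist by compactness of [a, b] x [-1, 1]^2 in the two charts.

    For (E) the same maximum principle applies to the difference of a solution and
    sqrt(t / (t - 1)), because the cubic term has the good sign ([solution_unique],
    [data_lapse]). Finally, t = 1 + s^2 makes the metric even in s, so that the boundary is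
    totally geodesic ([boundary_geodesic]), and in Cartesian coordinates the metric
    is delta_ij + x_i x_j / (r^2 (r - 1)), whose decay and flux at infinity are computed
    directly ([cartesian_perturbation], [perturbation_mass]). *)

(** * Directional derivatives and functions of class C^k *)

Definition is_dir {V : NormedModule R_AbsRing} (f : V -> R) (v x : V) (l : R) :=
  is_derive (fun h : R => f (plus x (scal h v))) 0 l.

Section Calculus.
Context {V : NormedModule R_AbsRing}.
Implicit Types (f g : V -> R) (v w x : V) (D : V -> Prop).

Lemma line_zero v x : plus x (scal 0 v) = x.
Proof. rewrite (@scal_zero_l R_Ring V). apply plus_zero_r. Qed.

Lemma line_line v x (s t : R) :
  plus (plus x (scal s v)) (scal t v) = plus x (scal (s + t) v).
Proof.
  rewrite <- plus_assoc. f_equal. symmetry. apply (@scal_distr_r R_Ring V).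
Qed.

Lemma is_dir_unique f v x l : is_dir f v x l -> dir f v x = l.
Proof. apply is_derive_unique. Qed.

Lemma ex_dir_is f v x : ex_dir f v x -> is_dir f v x (dir f v x).
Proof. intros H. apply Derive_correct, H. Qed.

Lemma is_dir_ex f v x l : is_dir f v x l -> ex_dir f v x.
Proof. intros H. now exists l. Qed.

Lemma continuous_line v x (h : R) : continuous (fun t : R => plus x (scal t v)) h.
Proof.
  apply (@continuous_plus R_UniformSpace R_AbsRing V).
  - apply continuous_const.
  - apply (@continuous_scal_l R_UniformSpace R_AbsRing V). apply continuous_id.
Qed.

Lemma locally_line D v x : open D -> D x ->
  locally (0 : R) (fun h : R => D (plus x (scal h v))).
Proof.
  intros HD Hx. apply (continuous_line v x 0).
  apply HD. now rewrite line_zero.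
Qed.

Lemma is_dir_ext D f g v x l : open D -> D x -> (forall z, D z -> f z = g z) ->
  is_dir f v x l -> is_dir g v x l.
Proof.
  intros HD Hx E. apply is_derive_ext_loc.
  generalize (locally_line D v x HD Hx). apply filter_imp. auto.
Qed.

Lemma dir_ext D f g v x : open D -> D x -> (forall z, D z -> f z = g z) ->
  dir f v x = dir g v x.
Proof.
  intros HD Hx E. apply Derive_ext_loc.
  generalize (locally_line D v x HD Hx). apply filter_imp. auto.
Qed.

Lemma ex_dir_ext D f g v x : open D -> D x -> (forall z, D z -> f z = g z) ->
  ex_dir f v x -> ex_dir g v x.
Proof. intros HD Hx E [l H]. exists l. now apply (is_dir_ext D f). Qed.

Lemma is_dir_const (c : R) v x : is_dir (fun _ => c) v x 0.
Proof. exact (@is_derive_const R_AbsRing R_NormedModule c 0). Qed.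

Lemma is_dir_plus f g v x a b : is_dir f v x a -> is_dir g v x b ->
  is_dir (fun z => f z + g z) v x (a + b).
Proof. exact (@is_derive_plus R_AbsRing R_NormedModule _ _ 0 a b). Qed.

Lemma is_dir_mult f g v x a b : is_dir f v x a -> is_dir g v x b ->
  is_dir (fun z => f z * g z) v x (a * g x + f x * b).
Proof.
  intros H K. unfold is_dir.
  generalize (is_derive_mult _ _ 0 a b H K Rmult_comm).
  rewrite line_zero. auto.
Qed.

Lemma is_dir_comp (phi : R -> R) f v x a b :
  is_derive phi (f x) b -> is_dir f v x a ->
  is_dir (fun z => phi (f z)) v x (a * b).
Proof.
  intros H K. unfold is_dir.
  apply (is_derive_comp phi (fun h : R => f (plus x (scal h v))) 0 b a).
  now rewrite line_zero. exact K.
Qed.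

Lemma is_dir_opp f v x a : is_dir f v x a -> is_dir (fun z => - f z) v x (- a).
Proof. exact (@is_derive_opp R_AbsRing R_NormedModule _ 0 a). Qed.

Lemma is_dir_minus f g v x a b : is_dir f v x a -> is_dir g v x b ->
  is_dir (fun z => f z - g z) v x (a - b).
Proof. exact (@is_derive_minus R_AbsRing R_NormedModule _ _ 0 a b). Qed.

Lemma is_dir_inv f v x a : is_dir f v x a -> f x <> 0 ->
  is_dir (fun z => / f z) v x (- a / f x ^ 2).
Proof.
  intros H K. unfold is_dir.
  generalize (is_derive_inv _ 0 a H). rewrite line_zero. auto.
Qed.

Lemma is_dir_sqrt f v x a : is_dir f v x a -> 0 < f x ->
  is_dir (fun z => sqrt (f z)) v x (a / (2 * sqrt (f x))).
Proof.
  intros H K. unfold is_dir.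
  generalize (is_derive_sqrt _ 0 a H). rewrite line_zero. auto.
Qed.

Lemma is_dir_line f v x (s l : R) : is_dir f v (plus x (scal s v)) l ->
  is_derive (fun h : R => f (plus x (scal h v))) s l.
Proof.
  intros H. unfold is_dir in H.
  apply (is_derive_ext (fun h : R => f (plus (plus x (scal s v)) (scal (h - s) v)))).
  { intros t. rewrite line_line. do 3 f_equal. ring. }
  replace l with (scal 1 l) by apply (@scal_one R_Ring R_ModuleSpace).
  apply (is_derive_comp (fun h => f (plus (plus x (scal s v)) (scal h v)))
           (fun h => h - s)).
  - rewrite Rminus_diag. exact H.
  - auto_derive; [trivial|ring].
Qed.

Lemma Ck_continuous k D f x : Ck k D f -> D x -> continuous f x.
Proof. destruct k; intros [H _]; auto. Qed.

Lemma Ck_ex k D f v x : Ck (S k) D f -> D x -> ex_dir f v x.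
Proof. intros [_ H]. apply (H v). Qed.

Lemma Ck_dir k D f v : Ck (S k) D f -> Ck k D (dir f v).
Proof. intros [_ H]. apply (H v). Qed.

Lemma Ck_pred k D f : Ck (S k) D f -> Ck k D f.
Proof.
  revert f. induction k as [|k IH]; intros f H.
  - split; auto. intros x. now apply (Ck_continuous 1).
  - split. { intros x. now apply (Ck_continuous (S (S k))). }
    intros v; split. { intros x. now apply (Ck_ex (S k)). }
    apply IH. now apply Ck_dir.
Qed.

Lemma Ck_sub k (D D' : V -> Prop) f : (forall x, D x -> D' x) ->
  Ck k D' f -> Ck k D f.
Proof.
  intros HD. revert f. induction k as [|k IH]; intros f [H1 H2]; split; auto.
  intros v. destruct (H2 v). split; auto.
Qed.

Lemma continuous_ext_open D f g x : open D -> D x ->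
  (forall z, D z -> f z = g z) -> continuous f x -> continuous g x.
Proof.
  intros HD Hx E H. apply (continuous_ext_loc _ f x).
  - generalize (HD x Hx). apply filter_imp. intros z Hz. auto.
  - exact H.
Qed.

Lemma Ck_ext k D f g : open D -> (forall x, D x -> f x = g x) ->
  Ck k D f -> Ck k D g.
Proof.
  intros HD. revert f g. induction k as [|k IH]; intros f g E [H1 H2]; split; auto.
  1,2: intros x Hx; apply (continuous_ext_open D f); auto.
  intros v. destruct (H2 v) as [H3 H4]. split.
  - intros x Hx. apply (ex_dir_ext D f); auto.
  - apply (IH (dir f v)); auto. intros x Hx. now apply (dir_ext D).
Qed.

Lemma Ck_const k D (c : R) : Ck k D (fun _ => c).
Proof.
  revert c. induction k as [|k IH]; intros c; split; auto.
  1,2: intros; apply continuous_const.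
  intros v. split.
  - intros x _. apply (is_dir_ex _ _ _ 0), is_dir_const.
  - replace (dir (fun _ : V => c) v) with (fun _ : V => 0).
    apply IH. apply functional_extensionality. intros x.
    symmetry. apply is_dir_unique, is_dir_const.
Qed.

Lemma Ck_plus k D f g : open D -> Ck k D f -> Ck k D g ->
  Ck k D (fun z => f z + g z).
Proof.
  intros HD. revert f g. induction k as [|k IH]; intros f g [F1 F2] [G1 G2];
    split; auto.
  1,2: intros; apply (@continuous_plus _ R_AbsRing R_NormedModule); auto.
  intros v. destruct (F2 v) as [F3 F4], (G2 v) as [G3 G4].
  assert (E : forall x, D x ->
    is_dir (fun z => f z + g z) v x (dir f v x + dir g v x)).
  { intros x Hx. apply is_dir_plus; apply ex_dir_is; auto. }
  split. { intros x Hx. eapply is_dir_ex, E, Hx. }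
  apply (Ck_ext k D (fun x => dir f v x + dir g v x)); auto.
  intros x Hx. symmetry. apply is_dir_unique. auto.
Qed.

Lemma Ck_mult k D f g : open D -> Ck k D f -> Ck k D g ->
  Ck k D (fun z => f z * g z).
Proof.
  intros HD. revert f g. induction k as [|k IH]; intros f g F G;
    split; auto.
  1,2: intros; apply (@continuous_mult _ R_AbsRing);
       eapply Ck_continuous; eauto.
  intros v.
  assert (E : forall x, D x ->
    is_dir (fun z => f z * g z) v x (dir f v x * g x + f x * dir g v x)).
  { intros x Hx. apply is_dir_mult; apply ex_dir_is; eapply Ck_ex; eauto. }
  split. { intros x Hx. eapply is_dir_ex, E, Hx. }
  apply (Ck_ext k D (fun x => dir f v x * g x + f x * dir g v x)); auto.
  { intros x Hx. symmetry. apply is_dir_unique. auto. }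
  apply Ck_plus; auto; apply IH; auto using Ck_dir, Ck_pred.
Qed.

Lemma Ck_scal k D (c : R) f : open D -> Ck k D f -> Ck k D (fun z => c * f z).
Proof. intros HD H. apply Ck_mult; auto. apply Ck_const. Qed.

Lemma Ck_opp k D f : open D -> Ck k D f -> Ck k D (fun z => - f z).
Proof.
  intros HD H. apply (Ck_ext k D (fun z => -1 * f z)); auto.
  intros; ring. now apply Ck_scal.
Qed.

Lemma Ck_minus k D f g : open D -> Ck k D f -> Ck k D g ->
  Ck k D (fun z => f z - g z).
Proof.
  intros HD F G. apply Ck_plus; auto. now apply Ck_opp.
Qed.

Lemma Ck_inv k D f : open D -> (forall x, D x -> f x <> 0) -> Ck k D f ->
  Ck k D (fun z => / f z).
Proof.
  intros HD Hf. revert Hf. induction k as [|k IH]; intros Hf F; split; auto.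
  1,2: intros x Hx; apply continuous_comp;
    [eapply Ck_continuous; eauto | apply continuous_Rinv; auto].
  intros v.
  assert (E : forall x, D x ->
    is_dir (fun z => / f z) v x (- dir f v x / f x ^ 2)).
  { intros x Hx. apply is_dir_inv; auto. apply ex_dir_is; eapply Ck_ex; eauto. }
  split. { intros x Hx. eapply is_dir_ex, E, Hx. }
  apply (Ck_ext k D (fun x => - dir f v x * (/ f x * / f x))); auto.
  { intros x Hx. symmetry. apply is_dir_unique. 
    replace (- dir f v x * (/ f x * / f x)) with (- dir f v x / f x ^ 2); auto.
    field. auto. }
  apply Ck_mult; auto. apply Ck_opp; auto using Ck_dir.
  apply Ck_mult; auto using Ck_pred.
Qed.

Lemma Ck_div k D f g : open D -> (forall x, D x -> g x <> 0) -> Ck k D f ->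
  Ck k D g -> Ck k D (fun z => f z / g z).
Proof. intros HD Hg F G. apply Ck_mult; auto. now apply Ck_inv. Qed.

Lemma Ck_sqrt k D f : open D -> (forall x, D x -> 0 < f x) -> Ck k D f ->
  Ck k D (fun z => sqrt (f z)).
Proof.
  intros HD Hf. induction k as [|k IH]; intros F; split; auto.
  1,2: intros x Hx; apply continuous_comp;
    [eapply Ck_continuous; eauto | apply continuous_sqrt].
  intros v.
  assert (E : forall x, D x ->
    is_dir (fun z => sqrt (f z)) v x (dir f v x / (2 * sqrt (f x)))).
  { intros x Hx. apply is_dir_sqrt; auto. apply ex_dir_is; eapply Ck_ex; eauto. }
  split. { intros x Hx. eapply is_dir_ex, E, Hx. }
  apply (Ck_ext k D (fun x => dir f v x / (2 * sqrt (f x)))); auto.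
  { intros x Hx. symmetry. now apply is_dir_unique, E. }
  apply Ck_div; auto using Ck_dir.
  - intros x Hx. generalize (sqrt_lt_R0 _ (Hf x Hx)). lra.
  - apply Ck_scal; auto using Ck_pred.
Qed.

Lemma open_everywhere : open (@everywhere V).
Proof. intros x _. apply filter_forall. intros; exact I. Qed.

(** Two differentiations commute: restricted to the plane spanned by the two
    directions this is Schwarz's theorem. *)
Lemma dir_comm D f v w x : open D -> Ck 2 D f -> D x ->
  dir (dir f v) w x = dir (dir f w) v x.
Proof.
  intros HD F Hx.
  set (L := fun s t : R => plus (plus x (scal s v)) (scal t w) : V).
  assert (Lc : forall s t, continuous (fun p : R * R => L (fst p) (snd p)) (s, t)).
  { intros s t. unfold L.
    apply (@continuous_plus _ R_AbsRing V).
    apply (@continuous_plus _ R_AbsRing V).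
    apply continuous_const.
    apply (@continuous_scal_l _ R_AbsRing V (fst : R * R -> R)). apply continuous_fst.
    apply (@continuous_scal_l _ R_AbsRing V (snd : R * R -> R)). apply continuous_snd. }
  assert (L0 : L 0 0 = x).
  { unfold L. rewrite (@scal_zero_l R_Ring V), plus_zero_r.
    rewrite (@scal_zero_l R_Ring V), plus_zero_r. reflexivity. }
  assert (LL : forall s t, L s t = plus (plus x (scal t w)) (scal s v)).
  { intros s t. unfold L. rewrite <- plus_assoc, (plus_comm (scal s v)).
    apply plus_assoc. }
  assert (cc : forall g : V -> R, continuous g x ->
     filterlim (fun p : R * R => g (L (fst p) (snd p))) (locally (0, 0))
       (locally (g (L 0 0)))).
  { intros g Hg. apply (filterlim_comp _ _ _ (fun p : R * R => L (fst p) (snd p)) g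
      _ (locally (L 0 0))). apply (Lc 0 0). rewrite L0. exact Hg. }
  assert (loc : locally_2d (fun s t => D (L s t)) 0 0).
  { apply locally_2d_locally. apply (Lc 0 0). apply HD. change (D (L 0 0)). now rewrite L0. }
  assert (D1 : forall (g : V -> R) s t, Ck 1 D g -> D (L s t) ->
     is_derive (fun z => g (L z t)) s (dir g v (L s t))).
  { intros g s t G Hst.
    apply (is_derive_ext (fun z => g (plus (plus x (scal t w)) (scal z v)))).
    { intros z. now rewrite LL. }
    rewrite LL in *. apply is_dir_line. apply ex_dir_is. eapply Ck_ex; eauto. }
  assert (D2 : forall (g : V -> R) s t, Ck 1 D g -> D (L s t) ->
     is_derive (fun z => g (L s z)) t (dir g w (L s t))).
  { intros g s t G Hst. apply is_dir_line. apply ex_dir_is. eapply Ck_ex; eauto. }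
  assert (F1 : Ck 1 D f) by now apply Ck_pred.
  assert (Fv : Ck 1 D (dir f v)) by now apply Ck_dir.
  assert (Fw : Ck 1 D (dir f w)) by now apply Ck_dir.
  assert (loc' : locally_2d (fun s t => locally_2d (fun s t => D (L s t)) s t) 0 0).
  { refine (locally_2d_impl_strong (fun s t => D (L s t))
      (fun s t => locally_2d (fun s t => D (L s t)) s t) 0 0 _ loc).
    apply locally_2d_forall. auto. }
  assert (inner1 : forall s t, locally_2d (fun s t => D (L s t)) s t ->
     is_derive (fun z => Derive (fun y => f (L z y)) t) s (dir (dir f w) v (L s t))).
  { intros s t [d Hd].
    apply (is_derive_ext_loc (fun z => dir f w (L z t))).
    - exists d. intros z Hz. symmetry. apply is_derive_unique, D2; auto.
      apply Hd. exact Hz. rewrite Rminus_diag, Rabs_R0. apply cond_pos.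
    - apply D1; auto. apply Hd; rewrite Rminus_diag, Rabs_R0; apply cond_pos. }
  assert (inner2 : forall s t, locally_2d (fun s t => D (L s t)) s t ->
     is_derive (fun z => Derive (fun y => f (L y z)) s) t (dir (dir f v) w (L s t))).
  { intros s t [d Hd].
    apply (is_derive_ext_loc (fun z => dir f v (L s z))).
    - exists d. intros z Hz. symmetry. apply is_derive_unique, D1; auto.
      apply Hd. rewrite Rminus_diag, Rabs_R0. apply cond_pos. exact Hz.
    - apply D2; auto. apply Hd; rewrite Rminus_diag, Rabs_R0; apply cond_pos. }
  assert (at0 := locally_2d_singleton _ _ _ loc').
  rewrite <- L0.
  rewrite <- (is_derive_unique _ _ _ (inner1 0 0 at0)).
  rewrite <- (is_derive_unique _ _ _ (inner2 0 0 at0)).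
  symmetry. apply Schwarz with (f := fun s t => f (L s t)).
  - destruct loc' as [d Hd]. exists d. intros s t Hs Ht.
    specialize (Hd s t Hs Ht). assert (H0 := locally_2d_singleton _ _ _ Hd).
    repeat split.
    + eexists; apply D1; auto.
    + eexists; apply D2; auto.
    + eexists; now apply inner1.
    + eexists; now apply inner2.
  - apply (continuity_2d_pt_ext_loc (fun s t => dir (dir f w) v (L s t))).
    + destruct loc' as [d Hd]. exists d. intros s t Hs Ht.
      symmetry. apply is_derive_unique. now apply inner1, Hd.
    + apply continuity_2d_pt_filterlim.
      apply (cc (dir (dir f w) v)). apply (Ck_continuous 0 D); auto.
      now apply Ck_dir.
  - apply (continuity_2d_pt_ext_loc (fun s t => dir (dir f v) w (L s t))).
    + destruct loc' as [d Hd]. exists d. intros s t Hs Ht.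
      symmetry. apply is_derive_unique. now apply inner2, Hd.
    + apply continuity_2d_pt_filterlim.
      apply (cc (dir (dir f v) w)). apply (Ck_continuous 0 D); auto.
      now apply Ck_dir.
Qed.

Lemma is_dir_linear f : (forall x (h : R) v, f (plus x (scal h v)) = f x + h * f v) ->
  forall v x, is_dir f v x (f v).
Proof.
  intros L v x. unfold is_dir.
  apply (is_derive_ext (fun h => f x + h * f v)).
  { intros h. symmetry. apply L. }
  auto_derive; [trivial|ring].
Qed.

Lemma Ck_linear k D f : open D -> (forall x, continuous f x) ->
  (forall x (h : R) v, f (plus x (scal h v)) = f x + h * f v) -> Ck k D f.
Proof.
  intros HD C L. destruct k as [|k]; split; auto. intros v. split.
  - intros x _. eapply is_dir_ex, is_dir_linear, L.
  - apply (Ck_ext k D (fun _ => f v)); auto. 2: apply Ck_const.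
    intros x _. symmetry. now apply is_dir_unique, is_dir_linear.
Qed.

End Calculus.

(** * Calculus in the plane *)

Lemma open_plane : open (everywhere : plane -> Prop).
Proof.
  exact (@open_everywhere (prod_NormedModule R_AbsRing R_NormedModule R_NormedModule)).
Qed.

Definition C1_on (D : plane -> Prop) (f : plane -> R) : Prop :=
  forall y, D y -> forall i, ex_dir f (basis i) y /\ continuous (pd i f) y.

Lemma Ck_C1_on k D f : Ck (S k) D f -> C1_on D f.
Proof.
  intros H y Hy i. split.
  - eapply Ck_ex; eauto.
  - apply (Ck_continuous k D); auto. now apply Ck_dir.
Qed.

Lemma is_derive_slice1 (f : plane -> R) (a b l : R) :
  is_dir f (basis i1) (a, b) l -> is_derive (fun z => f (z, b)) a l.
Proof.
  assert (E : forall z, plus ((0, b) : plane) (scal z (basis i1)) = (z, b)).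
  { intros z. unfold plus, scal; simpl. unfold prod_plus, prod_scal; simpl.
    unfold plus, scal; simpl. unfold mult; simpl. f_equal; ring. }
  intros H. apply (is_derive_ext (fun z => f (plus ((0, b) : plane) (scal z (basis i1))))).
  - intros z. now rewrite E.
  - assert (K := is_dir_line f (basis i1) ((0, b) : plane) a l).
    rewrite E in K. exact (K H).
Qed.

Lemma is_derive_slice2 (f : plane -> R) (a b l : R) :
  is_dir f (basis i2) (a, b) l -> is_derive (fun z => f (a, z)) b l.
Proof.
  assert (E : forall z, plus ((a, 0) : plane) (scal z (basis i2)) = (a, z)).
  { intros z. unfold plus, scal; simpl. unfold prod_plus, prod_scal; simpl.
    unfold plus, scal; simpl. unfold mult; simpl. f_equal; ring. }
  intros H. apply (is_derive_ext (fun z => f (plus ((a, 0) : plane) (scal z (basis i2))))).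
  - intros z. now rewrite E.
  - assert (K := is_dir_line f (basis i2) ((a, 0) : plane) b l).
    rewrite E in K. exact (K H).
Qed.

(** Continuity of the partial derivatives gives differentiability, hence the
    chain rule along curves. *)
Lemma chain_curve (D : plane -> Prop) (f : plane -> R) (c1 c2 : R -> R) (s d1 d2 : R) :
  open D -> C1_on D f -> D (c1 s, c2 s) -> is_derive c1 s d1 -> is_derive c2 s d2 ->
  is_derive (fun h => f (c1 h, c2 h)) s
    (sum2 (fun i => pd i f (c1 s, c2 s) * match i with i1 => d1 | i2 => d2 end)).
Proof.
  intros HD Hf Hs H1 H2. unfold sum2.
  apply is_derive_Reals.
  apply (derivable_pt_lim_comp_2d (fun u v => f (u, v)) c1 c2);
    [|now apply is_derive_Reals|now apply is_derive_Reals].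
  apply filterdiff_differentiable_pt_lim.
  apply (is_derive_filterdiff (fun u v => f (u, v)) (c1 s) (c2 s)
    (fun u v => pd i1 f (u, v)) (pd i2 f (c1 s, c2 s))).
  - generalize (HD _ Hs). apply filter_imp. intros [u v] Huv. simpl.
    apply is_derive_slice1, ex_dir_is, (Hf (u, v) Huv i1).
  - apply is_derive_slice2, ex_dir_is, (Hf _ Hs i2).
  - apply (continuous_ext (pd i1 f)). { now intros [u v]. }
    apply (Hf _ Hs i1).
Qed.

Lemma is_dir_chain {V : NormedModule R_AbsRing} (D : plane -> Prop)
  (f : plane -> R) (T1 T2 : V -> R) (v x : V) (d1 d2 : R) :
  open D -> C1_on D f -> D (T1 x, T2 x) -> is_dir T1 v x d1 -> is_dir T2 v x d2 ->
  is_dir (fun z => f (T1 z, T2 z)) v x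
    (sum2 (fun i => pd i f (T1 x, T2 x) * match i with i1 => d1 | i2 => d2 end)).
Proof.
  intros HD Hf Hx H1 H2. unfold is_dir.
  generalize (chain_curve D f (fun h => T1 (plus x (scal h v)))
     (fun h => T2 (plus x (scal h v))) 0 d1 d2 HD Hf).
  rewrite !line_zero. auto.
Qed.

(** If g2 were positive, g' would be positive on the right of 0 and g would exceed
    its maximum. *)
Lemma second_derivative_test (g g' : R -> R) (g2 : R) :
  (forall s, is_derive g s (g' s)) -> is_derive g' 0 g2 ->
  (forall s, g s <= g 0) -> g' 0 = 0 /\ g2 <= 0.
Proof.
  intros Hg Hg' Hmax.
  assert (Z : g' 0 = 0).
  { assert (K := proj1 (is_derive_Reals _ _ _) (Hg 0)).
    rewrite <- (derive_pt_eq_0 _ _ _ (exist _ _ K) K).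
    apply (deriv_maximum g (-1) 1); try lra. auto. }
  split; auto.
  destruct (Rle_lt_dec g2 0) as [|L]; auto. exfalso.
  assert (H := proj1 (is_derive_Reals _ _ _) Hg' g2 L).
  destruct H as [d H]. assert (Hd := cond_pos d).
  assert (P : forall c, 0 < c < d -> 0 < g' c).
  { intros c Hc. specialize (H c ltac:(lra)). rewrite Rabs_right in H by lra.
    specialize (H ltac:(lra)). rewrite Rplus_0_l, Z in H.
    apply Rabs_def2 in H. destruct H as [_ H].
    assert (K : 0 < (g' c - 0) / c) by lra.
    apply (Rmult_lt_compat_r c) in K; [|lra].
    replace ((g' c - 0) / c * c) with (g' c) in K by (field; lra). lra. }
  assert (M : forall p q, p < q -> exists c, p <= c <= q /\ g q - g p = g' c * (q - p)).
  { intros p q Hpq. destruct (MVT_gen g p q g') as [c [Hc E]].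
    - intros; apply Hg.
    - intros. apply continuity_pt_filterlim,
        (@ex_derive_continuous R_AbsRing R_NormedModule).
      eexists; apply Hg.
    - rewrite Rmin_left, Rmax_right in Hc by lra. eauto. }
  (* two intervals, since the mean value point of [0, d/4] may be 0 itself *)
  destruct (M 0 (d / 4) ltac:(lra)) as [c [Hc E]].
  destruct (M (d / 4) (d / 2) ltac:(lra)) as [c' [Hc' E']].
  specialize (Hmax (d / 2)).
  assert (P' := P c' ltac:(lra)).
  assert (0 <= g' c). { destruct (Req_dec c 0) as [->|]; [lra|]. left; apply P; lra. }
  nra.
Qed.

(** Stated for functions with continuous partial derivatives of order two along
    the axes, the regularity of classical solutions of (E); the two mixed
    derivatives are kept apart because they are not assumed to be equal. *)
Lemma max_hessian (f : plane -> R) (y : plane) (v1 v2 : R) :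
  C1_on everywhere f -> (forall i, C1_on everywhere (pd i f)) ->
  (forall z, f z <= f y) ->
  (forall i, pd i f y = 0) /\
  pd i1 (pd i1 f) y * v1 ^ 2
  + (pd i2 (pd i1 f) y + pd i1 (pd i2 f) y) * (v1 * v2)
  + pd i2 (pd i2 f) y * v2 ^ 2 <= 0.
Proof.
  intros F1 F2 Hmax. destruct y as [a b].
  assert (T : forall w1 w2,
    pd i1 f (a, b) * w1 + pd i2 f (a, b) * w2 = 0 /\
    pd i1 (pd i1 f) (a, b) * w1 ^ 2
    + (pd i2 (pd i1 f) (a, b) + pd i1 (pd i2 f) (a, b)) * (w1 * w2)
    + pd i2 (pd i2 f) (a, b) * w2 ^ 2 <= 0).
  { intros w1 w2.
    destruct (second_derivative_test (fun s => f (a + s * w1, b + s * w2))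
      (fun s => pd i1 f (a + s * w1, b + s * w2) * w1
              + pd i2 f (a + s * w1, b + s * w2) * w2)
      (pd i1 (pd i1 f) (a, b) * w1 ^ 2
       + (pd i2 (pd i1 f) (a, b) + pd i1 (pd i2 f) (a, b)) * (w1 * w2)
       + pd i2 (pd i2 f) (a, b) * w2 ^ 2)) as [H1 H2].
    - intros s. apply (chain_curve everywhere f (fun s => a + s * w1)
        (fun s => b + s * w2) s w1 w2);
        [apply open_plane | exact F1 | exact I | |];
        (auto_derive; [trivial|ring]).
    - assert (K : forall i, is_derive (fun s => pd i f (a + s * w1, b + s * w2)) 0
         (pd i1 (pd i f) (a, b) * w1 + pd i2 (pd i f) (a, b) * w2)).
      { intros i.
        generalize (chain_curve everywhere (pd i f) (fun s => a + s * w1)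
          (fun s => b + s * w2) 0 w1 w2 open_plane (F2 i) I).
        unfold sum2. rewrite !Rmult_0_l, !Rplus_0_r. intros H; apply H.
        all: auto_derive; [trivial|ring]. }
      generalize (K i1) (K i2). generalize (pd i1 f) (pd i2 f). intros p q K1 K2.
      evar_last.
      apply (@is_derive_plus R_AbsRing R_NormedModule).
      apply (@is_derive_scal_l R_AbsRing R_NormedModule). apply K1.
      apply (@is_derive_scal_l R_AbsRing R_NormedModule). apply K2.
      unfold plus, scal; simpl; unfold mult; simpl. ring.
    - intros s. rewrite !Rmult_0_l, !Rplus_0_r. apply Hmax.
    - rewrite !Rmult_0_l, !Rplus_0_r in H1. auto. }
  split; [|apply T].
  intros [|].
  - destruct (T 1 0) as [H _]. lra.
  - destruct (T 0 1) as [H _]. lra.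
Qed.

(** A positive definite form is a sum of squares of linear forms, so that its
    contraction with a nonpositive Hessian is nonpositive. *)
Lemma max_contraction (f : plane -> R) (y : plane) (A B C : R) :
  C1_on everywhere f -> (forall i, C1_on everywhere (pd i f)) ->
  (forall z, f z <= f y) -> 0 < A -> 0 < A * C - B ^ 2 ->
  A * pd i1 (pd i1 f) y + B * (pd i2 (pd i1 f) y + pd i1 (pd i2 f) y)
  + C * pd i2 (pd i2 f) y <= 0.
Proof.
  intros F1 F2 Hmax HA HD.
  destruct (max_hessian f y A B F1 F2 Hmax) as [_ H1].
  destruct (max_hessian f y 0 1 F1 F2 Hmax) as [_ H2].
  (* completing the square: A times the contraction is the Hessian of the
     vector (A, B) plus the determinant times the second pure derivative *)
  apply (Rmult_le_reg_l A); auto. rewrite Rmult_0_r.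
  set (p := pd i1 (pd i1 f) y) in *. set (q := pd i2 (pd i1 f) y + _) in *.
  set (r := pd i2 (pd i2 f) y) in *. nra.
Qed.

(** * Local Riemannian geometry of surfaces *)

Definition smooth (f : plane -> R) := forall k, Ck k everywhere f.

Lemma smooth_is f v y : smooth f -> is_dir f v y (dir f v y).
Proof. intros H. apply ex_dir_is. apply (Ck_ex 0 everywhere); [apply H|exact I]. Qed.

Lemma smooth_pd i f : smooth f -> smooth (pd i f).
Proof. intros H k. apply (Ck_dir k everywhere). apply H. Qed.

Lemma smooth_const c : smooth (fun _ => c).
Proof. intros k. apply Ck_const. Qed.

Lemma smooth_plus f g : smooth f -> smooth g -> smooth (fun y => f y + g y).
Proof. intros F G k. apply Ck_plus; auto. apply open_plane. Qed.

Lemma smooth_minus f g : smooth f -> smooth g -> smooth (fun y => f y - g y).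
Proof. intros F G k. apply Ck_minus; auto. apply open_plane. Qed.

Lemma smooth_opp f : smooth f -> smooth (fun y => - f y).
Proof. intros F k. apply Ck_opp; auto. apply open_plane. Qed.

Lemma smooth_mult f g : smooth f -> smooth g -> smooth (fun y => f y * g y).
Proof. intros F G k. apply Ck_mult; auto. apply open_plane. Qed.

Lemma smooth_div f g : smooth f -> smooth g -> (forall y, g y <> 0) ->
  smooth (fun y => f y / g y).
Proof. intros F G H k. apply Ck_div; auto. apply open_plane. Qed.

Lemma smooth_C1_on f : smooth f -> C1_on everywhere f.
Proof. intros F. apply (Ck_C1_on 0). apply F. Qed.

Lemma pd_comm f i j y : smooth f -> pd i (pd j f) y = pd j (pd i f) y.
Proof. intros F. apply (dir_comm everywhere); auto. apply open_plane. exact I. Qed.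

Lemma pd_unique f i y l : is_dir f (basis i) y l -> pd i f y = l.
Proof. apply is_dir_unique. Qed.

Create HintDb smooth.
#[export] Hint Resolve smooth_pd smooth_const smooth_plus smooth_minus smooth_opp
  smooth_mult smooth_div : smooth.

Ltac differentiate :=
  lazymatch goal with
  | |- is_dir (fun _ => ?c) _ _ _ => apply is_dir_const
  | |- is_dir (fun z => @?f z + @?g z) _ _ _ =>
      apply (is_dir_plus f g); differentiate
  | |- is_dir (fun z => @?f z - @?g z) _ _ _ =>
      apply (is_dir_minus f g); differentiate
  | |- is_dir (fun z => @?f z * @?g z) _ _ _ =>
      apply (is_dir_mult f g); differentiate
  | |- is_dir (fun z => - @?f z) _ _ _ => apply (is_dir_opp f); differentiate
  | |- is_dir (fun z => ?f z) ?v ?y _ => apply (smooth_is f v y); auto with smooth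
  | |- is_dir ?f ?v ?y _ => apply (smooth_is f v y); auto with smooth
  end.

(** What the coordinate expressions of a Riemannian metric satisfy. *)
Record regular (G : local_metric) : Prop := {
  regular_smooth : forall i j, smooth (G i j);
  regular_sym : G i2 i1 = G i1 i2;
  regular_pos : forall y, 0 < G i1 i1 y;
  regular_det : forall y, 0 < det G y
}.
#[export] Hint Resolve regular_smooth : smooth.

(** Christoffel symbols of the first kind. *)
Definition low (G : local_metric) (l i j : idx) (y : plane) : R :=
  / 2 * (pd i (G j l) y + pd j (G i l) y - pd l (G i j) y).

Section Regular.
Context (G : local_metric) (RG : regular G).

Lemma det_neq y : det G y <> 0.
Proof. generalize (regular_det G RG y). lra. Qed.

Lemma is_dir_inv_metric m k l y :
  is_dir (inv G k l) (basis m) y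
    (- sum2 (fun a => sum2 (fun b => inv G k a y * pd m (G a b) y * inv G b l y))).
Proof.
  assert (N := det_neq).
  assert (S := regular_smooth G RG).
  assert (Sd : is_dir (det G) (basis m) y
    (pd m (G i1 i1) y * G i2 i2 y + G i1 i1 y * pd m (G i2 i2) y
     - (pd m (G i1 i2) y * G i2 i1 y + G i1 i2 y * pd m (G i2 i1) y))).
  { unfold det. differentiate. }
  assert (K : forall f d, is_dir f (basis m) y d ->
    is_dir (fun z => f z / det G z) (basis m) y
     (d * / det G y + f y * (- (pd m (G i1 i1) y * G i2 i2 y + G i1 i1 y * pd m (G i2 i2) y
     - (pd m (G i1 i2) y * G i2 i1 y + G i1 i2 y * pd m (G i2 i1) y)) / det G y ^ 2))).
  { intros f d Hf. apply (is_dir_mult f (fun z => / det G z)); auto.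
    apply is_dir_inv; auto. }
  assert (N' := N y).
  destruct k, l; (evar_last; [apply K; differentiate|]);
    unfold sum2, inv, det in *; rewrite ?(regular_sym G RG) in *;
    unfold pd in *; field; auto.
Qed.

Lemma smooth_inv i j : smooth (inv G i j).
Proof.
  assert (smooth (det G)) by (unfold det; auto 6 with smooth).
  destruct i, j; apply smooth_div; auto with smooth; apply det_neq.
Qed.

Lemma smooth_low l i j : smooth (low G l i j).
Proof. unfold low. auto 8 with smooth. Qed.

Lemma smooth_Gamma k i j : smooth (Gamma G k i j).
Proof.
  assert (smooth (fun y => sum2 (fun l => inv G k l y * low G l i j y))).
  { unfold sum2. apply smooth_plus; apply smooth_mult;
     auto using smooth_inv, smooth_low. }
  intros n. apply (Ck_ext n everywhere
    (fun y => sum2 (fun l => inv G k l y * low G l i j y))); auto.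
  apply open_plane. intros y _. unfold Gamma, low, sum2. ring.
Qed.

Lemma pd_Gamma m k i j y : pd m (Gamma G k i j) y =
  sum2 (fun l =>
    - sum2 (fun a => sum2 (fun b => inv G k a y * pd m (G a b) y * inv G b l y))
      * low G l i j y
    + inv G k l y * (/ 2 * (pd m (pd i (G j l)) y + pd m (pd j (G i l)) y
                            - pd m (pd l (G i j)) y))).
Proof.
  apply pd_unique.
  assert (S := regular_smooth G RG).
  apply (is_dir_ext everywhere (fun y => sum2 (fun l => inv G k l y * low G l i j y))).
  { apply open_plane. } { exact I. }
  { intros z _. unfold Gamma, low, sum2. ring. }
  assert (L : forall l, is_dir (low G l i j) (basis m) y
     (/ 2 * (pd m (pd i (G j l)) y + pd m (pd j (G i l)) y - pd m (pd l (G i j)) y))).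
  { intros l. unfold low. evar_last. differentiate. unfold pd; ring. }
  unfold sum2. apply is_dir_plus; apply (is_dir_mult (inv G k _)); auto;
    apply (is_dir_inv_metric m).
Qed.

(** This characterizes the Christoffel symbols, and gives their behaviour under a
    change of coordinates without computing with the inverse metric. *)
Lemma lower_Gamma l i j y :
  sum2 (fun k => G l k y * Gamma G k i j y) = low G l i j y.
Proof.
  assert (N := det_neq y).
  unfold Gamma. fold (low G). unfold sum2, inv, det in *.
  destruct l; unfold low; rewrite ?(regular_sym G RG) in *; field; auto.
Qed.

End Regular.

(** Brioschi's formula for twice the Gauss curvature of
    E dx^2 + 2F dxdy + G dy^2, with the second derivatives entering only
    through L = E_yy - 2F_xy + G_xx. *)
Definition brioschi_num (E F G E1 E2 F1 F2 G1 G2 L : R) : R :=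
  - L * (E * G - F ^ 2)
  + / 2 * (E * (E2 * G2 - 2 * F1 * G2 + G1 ^ 2)
     + F * (E1 * G2 - E2 * G1 - 2 * E2 * F2 + 4 * F1 * F2 - 2 * F1 * G1)
     + G * (E1 * G1 - 2 * E1 * F2 + E2 ^ 2)).

Definition brioschi (E F G E1 E2 F1 F2 G1 G2 L : R) : R :=
  brioschi_num E F G E1 E2 F1 F2 G1 G2 L / (E * G - F ^ 2) ^ 2.

Definition brioschi_at (G : local_metric) (y : plane) : R :=
  brioschi (G i1 i1 y) (G i1 i2 y) (G i2 i2 y)
    (pd i1 (G i1 i1) y) (pd i2 (G i1 i1) y)
    (pd i1 (G i1 i2) y) (pd i2 (G i1 i2) y)
    (pd i1 (G i2 i2) y) (pd i2 (G i2 i2) y)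
    (pd i2 (pd i2 (G i1 i1)) y - 2 * pd i1 (pd i2 (G i1 i2)) y
     + pd i1 (pd i1 (G i2 i2)) y).

(** The curvature becomes an explicit rational function of the 2-jet of the metric,
    so that its first variation is a matter of algebra. *)
Lemma local_scal_brioschi (G : local_metric) y : regular G ->
  local_scal G y = brioschi_at G y.
Proof.
  intros RG. assert (N := det_neq G RG y). assert (S := regular_smooth G RG).
  unfold local_scal, Ricci, sum2.
  rewrite !(pd_Gamma G RG). unfold Gamma, low, sum2.
  rewrite (regular_sym G RG).
  rewrite !(pd_comm _ i2 i1); auto.
  unfold brioschi_at, brioschi, brioschi_num. unfold inv, det in *.
  rewrite (regular_sym G RG) in *.
  generalize dependent (G i1 i1 y). intros E.
  generalize dependent (G i1 i2 y). intros F.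
  generalize dependent (G i2 i2 y). intros GG N.
  generalize (pd i1 (G i1 i1) y) (pd i2 (G i1 i1) y)
    (pd i1 (G i1 i2) y) (pd i2 (G i1 i2) y)
    (pd i1 (G i2 i2) y) (pd i2 (G i2 i2) y).
  generalize (pd i2 (pd i2 (G i1 i1)) y) (pd i1 (pd i2 (G i1 i2)) y)
     (pd i1 (pd i1 (G i2 i2)) y) (pd i2 (pd i2 (G i1 i2)) y) (pd i1 (pd i1 (G i1 i2)) y)
     (pd i2 (pd i2 (G i2 i2)) y) (pd i1 (pd i1 (G i1 i1)) y)
     (pd i1 (pd i2 (G i1 i1)) y) (pd i1 (pd i2 (G i2 i2)) y).
  intros. assert (E * GG - F ^ 2 <> 0) by (simpl; lra).
  field. simpl in *; lra.
Qed.

(** * First variation of the scalar curvature *)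

(** Differential of Brioschi's expression; the lower case arguments are the
    variations of the upper case ones. *)
Definition brioschi_var (E F G E1 E2 F1 F2 G1 G2 L e f g e1 e2 f1 f2 g1 g2 l : R) : R :=
  ((- l * (E * G - F ^ 2) - L * (e * G + E * g - 2 * F * f)
    + / 2 * (e * (E2 * G2 - 2 * F1 * G2 + G1 ^ 2)
       + f * (E1 * G2 - E2 * G1 - 2 * E2 * F2 + 4 * F1 * F2 - 2 * F1 * G1)
       + g * (E1 * G1 - 2 * E1 * F2 + E2 ^ 2)
       + E * (e2 * G2 + E2 * g2 - 2 * f1 * G2 - 2 * F1 * g2 + 2 * G1 * g1)
       + F * (e1 * G2 + E1 * g2 - e2 * G1 - E2 * g1 - 2 * e2 * F2 - 2 * E2 * f2
              + 4 * f1 * F2 + 4 * F1 * f2 - 2 * f1 * G1 - 2 * F1 * g1)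
       + G * (e1 * G1 + E1 * g1 - 2 * e1 * F2 - 2 * E1 * f2 + 2 * E2 * e2)))
   * (E * G - F ^ 2)
   - 2 * brioschi_num E F G E1 E2 F1 F2 G1 G2 L * (e * G + E * g - 2 * F * f))
  / (E * G - F ^ 2) ^ 3.

Lemma is_derive_brioschi (E F G E1 E2 F1 F2 G1 G2 L : R -> R)
  (s e f g e1 e2 f1 f2 g1 g2 l : R) :
  E s * G s - F s ^ 2 <> 0 ->
  is_derive E s e -> is_derive F s f -> is_derive G s g ->
  is_derive E1 s e1 -> is_derive E2 s e2 -> is_derive F1 s f1 ->
  is_derive F2 s f2 -> is_derive G1 s g1 -> is_derive G2 s g2 ->
  is_derive L s l ->
  is_derive (fun t => brioschi (E t) (F t) (G t) (E1 t) (E2 t) (F1 t) (F2 t)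
                        (G1 t) (G2 t) (L t)) s
    (brioschi_var (E s) (F s) (G s) (E1 s) (E2 s) (F1 s) (F2 s)
       (G1 s) (G2 s) (L s) e f g e1 e2 f1 f2 g1 g2 l).
Proof.
  intros N HE HF HG HE1 HE2 HF1 HF2 HG1 HG2 HL.
  unfold brioschi, brioschi_num. auto_derive.
  - repeat split; try (eexists; eassumption).
    intros H. apply N. simpl in H. rewrite !Rmult_1_r in H.
    apply Rmult_integral in H. simpl. rewrite Rmult_1_r. unfold Rminus. tauto.
  - change (fun x : R => E x) with E. change (fun x : R => F x) with F.
    change (fun x : R => G x) with G. change (fun x : R => L x) with L.
    change (fun x : R => E1 x) with E1. change (fun x : R => E2 x) with E2.
    change (fun x : R => F1 x) with F1. change (fun x : R => F2 x) with F2.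
    change (fun x : R => G1 x) with G1. change (fun x : R => G2 x) with G2.
    rewrite (is_derive_unique _ _ _ HE), (is_derive_unique _ _ _ HF),
      (is_derive_unique _ _ _ HG), (is_derive_unique _ _ _ HE1),
      (is_derive_unique _ _ _ HE2), (is_derive_unique _ _ _ HF1),
      (is_derive_unique _ _ _ HF2), (is_derive_unique _ _ _ HG1),
      (is_derive_unique _ _ _ HG2), (is_derive_unique _ _ _ HL).
    unfold brioschi_var, brioschi_num. field. simpl in *. lra.
Qed.

Lemma brioschi_var_plus (E F G E1 E2 F1 F2 G1 G2 L e f g e1 e2 f1 f2 g1 g2 l
  e' f' g' e1' e2' f1' f2' g1' g2' l' : R) :
  brioschi_var E F G E1 E2 F1 F2 G1 G2 L (e + e') (f + f') (g + g') (e1 + e1')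
    (e2 + e2') (f1 + f1') (f2 + f2') (g1 + g1') (g2 + g2') (l + l')
  = brioschi_var E F G E1 E2 F1 F2 G1 G2 L e f g e1 e2 f1 f2 g1 g2 l
    + brioschi_var E F G E1 E2 F1 F2 G1 G2 L e' f' g' e1' e2' f1' f2' g1' g2' l'.
Proof. unfold brioschi_var, Rdiv. ring. Qed.

Lemma brioschi_var_scal (E F G E1 E2 F1 F2 G1 G2 L a e f g e1 e2 f1 f2 g1 g2 l : R) :
  brioschi_var E F G E1 E2 F1 F2 G1 G2 L (a * e) (a * f) (a * g) (a * e1)
    (a * e2) (a * f1) (a * f2) (a * g1) (a * g2) (a * l)
  = a * brioschi_var E F G E1 E2 F1 F2 G1 G2 L e f g e1 e2 f1 f2 g1 g2 l.
Proof. unfold brioschi_var, Rdiv. ring. Qed.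

(** Naturality of the curvature under diffeomorphisms, infinitesimally: once the
    transport term along X is removed, a Lie derivative does not change it.
    [Xai] is the derivative of the a-th component of X in direction i. *)
Lemma brioschi_var_lie (E F G E1 E2 F1 F2 G1 G2 E12 E22 F11 F12 F22 G11 G12
  X11 X12 X21 X22 X111 X112 X122 X211 X212 X222 : R) :
  brioschi_var E F G E1 E2 F1 F2 G1 G2 (E22 - 2 * F12 + G11)
    (2 * (E * X11 + F * X21))
    (F * X11 + G * X21 + E * X12 + F * X22)
    (2 * (F * X12 + G * X22))
    (X11 * E1 + X21 * E2 + 2 * (E1 * X11 + F1 * X21 + E * X111 + F * X211))
    (X12 * E1 + X22 * E2 + 2 * (E2 * X11 + F2 * X21 + E * X112 + F * X212))
    (X11 * F1 + X21 * F2 + (F1 * X11 + G1 * X21 + E1 * X12 + F1 * X22)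
      + (F * X111 + G * X211 + E * X112 + F * X212))
    (X12 * F1 + X22 * F2 + (F2 * X11 + G2 * X21 + E2 * X12 + F2 * X22)
      + (F * X112 + G * X212 + E * X122 + F * X222))
    (X11 * G1 + X21 * G2 + 2 * (F1 * X12 + G1 * X22 + F * X112 + G * X212))
    (X12 * G1 + X22 * G2 + 2 * (F2 * X12 + G2 * X22 + F * X122 + G * X222))
    ((X122 * E1 + X222 * E2 + 2 * X12 * E12 + 2 * X22 * E22
      + 2 * (E22 * X11 + F22 * X21 + 2 * E2 * X112 + 2 * F2 * X212))
     - 2 * (X112 * F1 + X212 * F2 + X11 * F12 + X12 * F11 + X21 * F22 + X22 * F12
        + (F12 * X11 + G12 * X21 + E12 * X12 + F12 * X22)
        + (F1 * X112 + F2 * X111 + G1 * X212 + G2 * X211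
           + E1 * X122 + E2 * X112 + F1 * X222 + F2 * X212))
     + (X111 * G1 + X211 * G2 + 2 * X11 * G11 + 2 * X21 * G12
        + 2 * (F11 * X12 + G11 * X22 + 2 * F1 * X112 + 2 * G1 * X212))) = 0.
Proof.
  unfold brioschi_var, brioschi_num.
  match goal with |- ?n / _ = 0 => replace n with 0; [unfold Rdiv; ring|] end.
  field.
Qed.

(** Conformal variation: the scalar curvature of exp(s psi) g is
    exp(-s psi) (R - s Lap psi). *)
Lemma brioschi_var_conformal (E F G E1 E2 F1 F2 G1 G2 L p p1 p2 p11 p12 p22 : R) :
  E * G - F ^ 2 <> 0 ->
  brioschi_var E F G E1 E2 F1 F2 G1 G2 L (p * E) (p * F) (p * G)
    (p1 * E + p * E1) (p2 * E + p * E2) (p1 * F + p * F1) (p2 * F + p * F2)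
    (p1 * G + p * G1) (p2 * G + p * G2)
    (p * L + 2 * p2 * E2 + p22 * E
     - 2 * (p1 * F2 + p2 * F1 + p12 * F) + 2 * p1 * G1 + p11 * G)
  = - (G * p11 - 2 * F * p12 + E * p22) / (E * G - F ^ 2)
    + (p1 * (G * (/ 2 * (G * E1 - F * (2 * F1 - E2)))
             - 2 * F * (/ 2 * (G * E2 - F * G1))
             + E * (/ 2 * (G * (2 * F2 - G1) - F * G2)))
       + p2 * (G * (/ 2 * (E * (2 * F1 - E2) - F * E1))
             - 2 * F * (/ 2 * (E * G1 - F * E2))
             + E * (/ 2 * (E * G2 - F * (2 * F2 - G1))))) / (E * G - F ^ 2) ^ 2
    - p * brioschi E F G E1 E2 F1 F2 G1 G2 L.
Proof.
  intros N. unfold brioschi_var, brioschi, brioschi_num. field. simpl in *; lra.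
Qed.

(** * Curvature along a family of metrics *)

Lemma pd_plus i f g y : smooth f -> smooth g ->
  pd i (fun z => f z + g z) y = pd i f y + pd i g y.
Proof. intros F G. apply pd_unique, is_dir_plus; now apply smooth_is. Qed.

Lemma pd_mult i f g y : smooth f -> smooth g ->
  pd i (fun z => f z * g z) y = pd i f y * g y + f y * pd i g y.
Proof. intros F G. apply pd_unique, is_dir_mult; now apply smooth_is. Qed.

Lemma pd2_plus i j f g y : smooth f -> smooth g ->
  pd i (pd j (fun z => f z + g z)) y = pd i (pd j f) y + pd i (pd j g) y.
Proof.
  intros F G. rewrite <- pd_plus; auto with smooth. f_equal.
  apply functional_extensionality. intros z. now apply pd_plus.
Qed.

Lemma pd2_mult i j f g y : smooth f -> smooth g ->
  pd i (pd j (fun z => f z * g z)) y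
  = pd i (pd j f) y * g y + pd j f y * pd i g y
    + (pd i f y * pd j g y + f y * pd i (pd j g) y).
Proof.
  intros F G. rewrite <- !pd_mult; auto with smooth.
  rewrite <- pd_plus; auto with smooth. f_equal.
  apply functional_extensionality. intros z. now apply pd_mult.
Qed.

Lemma pd_comm_fun i j f : smooth f -> pd i (pd j f) = pd j (pd i f).
Proof. intros F. apply functional_extensionality. intros y. now apply pd_comm. Qed.

Definition slice (E : R * plane -> R) (s : R) : plane -> R := fun y => E (s, y).

Lemma slice_line (E : R * plane -> R) v s y (h : R) :
  slice E s (plus y (scal h v)) =
  E (plus ((s, y) : R * plane) (scal h ((0, v) : R * plane))).
Proof.
  unfold slice. f_equal. unfold plus at 2, scal at 2. simpl.
  unfold prod_plus, prod_scal. simpl. f_equal.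
  unfold plus, scal; simpl. unfold mult; simpl. ring.
Qed.

Lemma slice_dir E v s : dir (slice E s) v = slice (dir E (0, v)) s.
Proof.
  apply functional_extensionality. intros y. unfold dir. 
  apply Derive_ext. intros h. now rewrite slice_line.
Qed.

Lemma slice_ex_dir E v s y : ex_dir E (0, v) (s, y) -> ex_dir (slice E s) v y.
Proof.
  intros [l H]. exists l. apply (is_derive_ext (fun h : R =>
    E (plus ((s, y) : R * plane) (scal h ((0, v) : R * plane))))); auto.
  intros h. now rewrite slice_line.
Qed.

Lemma slice_continuous E s y : continuous E (s, y) -> continuous (slice E s) y.
Proof.
  intros H. unfold slice.
  apply (continuous_comp_2 (fun _ => s) (fun z : plane => z) (fun a b => E (a, b))).
  apply continuous_const. apply continuous_id.
  apply (continuous_ext E); auto. now intros [].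
Qed.

Lemma time_line (t : R) (y : plane) :
  plus ((0, y) : R * plane) (scal t ((1, (0, 0)) : R * plane)) = (t, y).
Proof.
  unfold plus, scal. simpl. unfold prod_plus, prod_scal. simpl. destruct y as [a b].
  unfold plus, scal; simpl. unfold prod_plus, prod_scal, plus, scal, mult; simpl.
  unfold mult; simpl. f_equal; [|f_equal]; ring.
Qed.

Lemma is_derive_time (f : R * plane -> R) s y l : is_dir f (1, (0, 0)) (s, y) l ->
  is_derive (fun t => f (t, y)) s l.
Proof.
  intros H. apply (is_derive_ext (fun t : R =>
    f (plus ((0, y) : R * plane) (scal t ((1, (0, 0)) : R * plane))))).
  - intros t. now rewrite time_line.
  - assert (K := is_dir_line f ((1, (0, 0)) : R * plane) ((0, y) : R * plane) s l).
    rewrite time_line in K. exact (K H).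
Qed.

Lemma is_derive_slice E s y : (forall k, Ck k everywhere E) ->
  is_derive (fun t => slice E t y) s (slice (dt E) s y).
Proof.
  intros H. apply is_derive_time, ex_dir_is.
  exact (Ck_ex 0 everywhere E (1, (0, 0)) (s, y) (H 1%nat) I).
Qed.

Lemma dt_dx E i : (forall k, Ck k everywhere E) -> dt (dx i E) = dx i (dt E).
Proof.
  intros H. apply functional_extensionality. intros p.
  apply (dir_comm everywhere); auto. 2: exact I.
  exact (@open_everywhere (prod_NormedModule R_AbsRing R_NormedModule
    (prod_NormedModule R_AbsRing R_NormedModule R_NormedModule))).
Qed.

Lemma Ck_dx E i : (forall k, Ck k everywhere E) -> forall k, Ck k everywhere (dx i E).
Proof. intros H k. now apply (Ck_dir k everywhere). Qed.

(** Space and time derivatives commute by the joint smoothness of the family. *)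
Lemma is_derive_pd_slice E s i y : (forall k, Ck k everywhere E) ->
  is_derive (fun t => pd i (slice E t) y) s (pd i (slice (dt E) s) y).
Proof.
  intros H. apply (is_derive_ext (fun t => slice (dx i E) t y)).
  { intros t. unfold pd. now rewrite slice_dir. }
  unfold pd. rewrite slice_dir. change (dir (dt E) (0, basis i)) with (dx i (dt E)).
  rewrite <- dt_dx; auto. apply is_derive_slice. now apply Ck_dx.
Qed.

Lemma is_derive_pd2_slice E s i j y : (forall k, Ck k everywhere E) ->
  is_derive (fun t => pd i (pd j (slice E t)) y) s (pd i (pd j (slice (dt E) s)) y).
Proof.
  intros H. apply (is_derive_ext (fun t => pd i (slice (dx j E) t) y)).
  { intros t. f_equal. unfold pd. now rewrite slice_dir. }
  replace (pd j (slice (dt E) s)) with (slice (dt (dx j E)) s).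
  { apply is_derive_pd_slice. now apply Ck_dx. }
  rewrite dt_dx; auto. unfold pd. now rewrite slice_dir.
Qed.

(** The differential of the scalar curvature at G in the direction h. *)
Definition scal_var (G h : local_metric) (y : plane) : R :=
  brioschi_var (G i1 i1 y) (G i1 i2 y) (G i2 i2 y)
    (pd i1 (G i1 i1) y) (pd i2 (G i1 i1) y)
    (pd i1 (G i1 i2) y) (pd i2 (G i1 i2) y)
    (pd i1 (G i2 i2) y) (pd i2 (G i2 i2) y)
    (pd i2 (pd i2 (G i1 i1)) y - 2 * pd i1 (pd i2 (G i1 i2)) y
     + pd i1 (pd i1 (G i2 i2)) y)
    (h i1 i1 y) (h i1 i2 y) (h i2 i2 y)
    (pd i1 (h i1 i1) y) (pd i2 (h i1 i1) y)
    (pd i1 (h i1 i2) y) (pd i2 (h i1 i2) y)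
    (pd i1 (h i2 i2) y) (pd i2 (h i2 i2) y)
    (pd i2 (pd i2 (h i1 i1)) y - 2 * pd i1 (pd i2 (h i1 i2)) y
     + pd i1 (pd i1 (h i2 i2)) y).

Lemma det_square G y : regular G -> G i1 i1 y * G i2 i2 y - G i1 i2 y ^ 2 <> 0.
Proof.
  intros RG. generalize (det_neq G RG y). unfold det.
  rewrite (regular_sym G RG). simpl. lra.
Qed.

Lemma is_derive_local_scal (E : idx -> idx -> R * plane -> R) s y :
  (forall i j k, Ck k everywhere (E i j)) ->
  locally s (fun t => regular (fun i j => slice (E i j) t)) ->
  is_derive (fun t => local_scal (fun i j => slice (E i j) t) y) s
    (scal_var (fun i j => slice (E i j) s) (fun i j => slice (dt (E i j)) s) y).
Proof.
  intros HE HR.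
  apply (is_derive_ext_loc (fun t => brioschi_at (fun i j => slice (E i j) t) y)).
  { destruct HR as [d Hd]. exists d. intros t Ht. symmetry.
    apply (local_scal_brioschi _ y (Hd t Ht)). }
  apply locally_singleton in HR.
  unfold scal_var. apply (is_derive_brioschi
    (fun t => slice (E i1 i1) t y) (fun t => slice (E i1 i2) t y)
    (fun t => slice (E i2 i2) t y)
    (fun t => pd i1 (slice (E i1 i1) t) y) (fun t => pd i2 (slice (E i1 i1) t) y)
    (fun t => pd i1 (slice (E i1 i2) t) y) (fun t => pd i2 (slice (E i1 i2) t) y)
    (fun t => pd i1 (slice (E i2 i2) t) y) (fun t => pd i2 (slice (E i2 i2) t) y)
    (fun t => pd i2 (pd i2 (slice (E i1 i1) t)) y
       - 2 * pd i1 (pd i2 (slice (E i1 i2) t)) y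
       + pd i1 (pd i1 (slice (E i2 i2) t)) y)).
  { apply (det_square _ y HR). }
  1: exact (is_derive_slice _ s y (HE i1 i1)).
  1: exact (is_derive_slice _ s y (HE i1 i2)).
  1: exact (is_derive_slice _ s y (HE i2 i2)).
  1: exact (is_derive_pd_slice _ s i1 y (HE i1 i1)).
  1: exact (is_derive_pd_slice _ s i2 y (HE i1 i1)).
  1: exact (is_derive_pd_slice _ s i1 y (HE i1 i2)).
  1: exact (is_derive_pd_slice _ s i2 y (HE i1 i2)).
  1: exact (is_derive_pd_slice _ s i1 y (HE i2 i2)).
  1: exact (is_derive_pd_slice _ s i2 y (HE i2 i2)).
  apply (@is_derive_plus R_AbsRing R_NormedModule).
  apply (@is_derive_minus R_AbsRing R_NormedModule).
  2: apply (is_derive_scal (fun t => pd i1 (pd i2 (slice (E i1 i2) t)) y)).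
  all: apply is_derive_pd2_slice; auto.
Qed.

Section Space.
Context (G : local_metric) (RG : regular G).

Lemma smooth_scal : smooth (local_scal G).
Proof.
  assert (S := regular_smooth G RG).
  assert (smooth (brioschi_at G)).
  { assert (S11 := S i1 i1). assert (S12 := S i1 i2). assert (S22 := S i2 i2).
    clear S. unfold brioschi_at, brioschi. apply smooth_div.
    - unfold brioschi_num, pow, Rminus.
      repeat first [apply smooth_plus | apply smooth_mult | apply smooth_opp
        | apply smooth_const | apply smooth_pd]; auto.
    - unfold pow, Rminus.
      repeat first [apply smooth_plus | apply smooth_mult | apply smooth_opp
        | apply smooth_const | apply smooth_pd]; auto.
    - intros y. apply pow_nonzero, det_square, RG. }
  intros k. refine (Ck_ext k everywhere _ _ open_plane _ (H k)).
  intros y _. symmetry. now apply local_scal_brioschi.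
Qed.

Lemma pd_scal k y : pd k (local_scal G) y = scal_var G (fun i j => pd k (G i j)) y.
Proof.
  assert (S := regular_smooth G RG).
  apply pd_unique. apply (is_dir_ext everywhere (brioschi_at G)).
  { apply open_plane. } { exact I. }
  { intros z _. symmetry. apply (local_scal_brioschi _ z RG). }
  unfold scal_var. unfold is_dir.
  set (ln := fun h : R => plus y (scal h (basis k))).
  assert (L0 : ln 0 = y) by exact (line_zero (basis k) y).
  assert (A : forall f, smooth f -> is_derive (fun h => f (ln h)) 0 (pd k f y)).
  { intros f Hf. apply (smooth_is f (basis k) y Hf). }
  generalize (is_derive_brioschi
    (fun t => (G i1 i1) (ln t)) (fun t => (G i1 i2) (ln t))
    (fun t => (G i2 i2) (ln t))
    (fun t => pd i1 (G i1 i1) (ln t)) (fun t => pd i2 (G i1 i1) (ln t))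
    (fun t => pd i1 (G i1 i2) (ln t)) (fun t => pd i2 (G i1 i2) (ln t))
    (fun t => pd i1 (G i2 i2) (ln t)) (fun t => pd i2 (G i2 i2) (ln t))
    (fun t => pd i2 (pd i2 (G i1 i1)) (ln t)
       - 2 * pd i1 (pd i2 (G i1 i2)) (ln t)
       + pd i1 (pd i1 (G i2 i2)) (ln t)) 0).
  cbv beta. rewrite L0. intros B. apply B; clear B.
  { now apply det_square. }
  1-3: now apply A.
  1-6: rewrite pd_comm; auto; apply A; auto with smooth.
  assert (C : forall i j f, smooth f ->
    is_derive (fun t => pd i (pd j f) (ln t)) 0 (pd i (pd j (pd k f)) y)).
  { intros i j f Hf. replace (pd i (pd j (pd k f)) y) with (pd k (pd i (pd j f)) y).
    apply A; auto with smooth.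
    rewrite pd_comm; auto with smooth. f_equal. apply functional_extensionality.
    intros z. now apply pd_comm. }
  apply (@is_derive_plus R_AbsRing R_NormedModule).
  apply (@is_derive_minus R_AbsRing R_NormedModule).
  2: apply (is_derive_scal (fun t => pd i1 (pd i2 (G i1 i2)) (ln t))).
  all: apply C; auto.
Qed.

(** The components of the Lie derivative of the metric along X. *)
Definition lie (X1 X2 : plane -> R) : local_metric := fun i j y =>
  X1 y * pd i1 (G i j) y + X2 y * pd i2 (G i j) y
  + (G i1 j y * pd i X1 y + G i2 j y * pd i X2 y
     + (G i i1 y * pd j X1 y + G i i2 y * pd j X2 y)).

Ltac expand :=
  repeat first [rewrite pd2_plus by auto 10 with smooth
    | rewrite pd2_mult by auto 10 with smooth
    | rewrite pd_plus by auto 10 with smooth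
    | rewrite pd_mult by auto 10 with smooth];
  repeat match goal with
  | |- context [pd ?i (fun z => ?f z)] =>
      change (pd i (fun z => f z)) with (pd i f)
  end.

Lemma scal_var_lie X1 X2 y : smooth X1 -> smooth X2 ->
  scal_var G (lie X1 X2) y
  = X1 y * pd i1 (local_scal G) y + X2 y * pd i2 (local_scal G) y.
Proof.
  intros H1 H2. assert (S := regular_smooth G RG).
  rewrite !pd_scal. unfold scal_var, lie. rewrite !(regular_sym G RG).
  expand.
  rewrite ?(pd_comm_fun i2 i1) by auto with smooth.
  rewrite <- !brioschi_var_scal.
  rewrite <- brioschi_var_plus. symmetry.
  rewrite <- (Rplus_0_l (brioschi_var _ _ _ _ _ _ _ _ _ _ (_ + _) _ _ _ _ _ _ _ _ _)).
  rewrite <- (brioschi_var_lie (G i1 i1 y) (G i1 i2 y) (G i2 i2 y)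
    (pd i1 (G i1 i1) y) (pd i2 (G i1 i1) y)
    (pd i1 (G i1 i2) y) (pd i2 (G i1 i2) y)
    (pd i1 (G i2 i2) y) (pd i2 (G i2 i2) y)
    (pd i1 (pd i2 (G i1 i1)) y) (pd i2 (pd i2 (G i1 i1)) y)
    (pd i1 (pd i1 (G i1 i2)) y) (pd i1 (pd i2 (G i1 i2)) y)
    (pd i2 (pd i2 (G i1 i2)) y)
    (pd i1 (pd i1 (G i2 i2)) y) (pd i1 (pd i2 (G i2 i2)) y)
    (pd i1 X1 y) (pd i2 X1 y) (pd i1 X2 y) (pd i2 X2 y)
    (pd i1 (pd i1 X1) y) (pd i1 (pd i2 X1) y) (pd i2 (pd i2 X1) y)
    (pd i1 (pd i1 X2) y) (pd i1 (pd i2 X2) y) (pd i2 (pd i2 X2) y)).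
  rewrite <- brioschi_var_plus.
  f_equal; ring.
Qed.

Lemma scal_var_plus (h h' : local_metric) y :
  (forall i j, smooth (h i j)) -> (forall i j, smooth (h' i j)) ->
  scal_var G (fun i j z => h i j z + h' i j z) y = scal_var G h y + scal_var G h' y.
Proof.
  intros H H'. unfold scal_var. expand. rewrite <- brioschi_var_plus. f_equal. ring.
Qed.

Lemma scal_var_conformal psi y : smooth psi ->
  scal_var G (fun i j z => psi z * G i j z) y
  = - local_laplace G psi y - psi y * local_scal G y.
Proof.
  intros H. assert (S := regular_smooth G RG).
  rewrite (local_scal_brioschi G y RG). unfold brioschi_at, scal_var. expand.
  rewrite ?(pd_comm_fun i2 i1) by auto with smooth.
  assert (N := det_square G y RG).
  generalize (brioschi_var_conformal (G i1 i1 y) (G i1 i2 y) (G i2 i2 y)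
    (pd i1 (G i1 i1) y) (pd i2 (G i1 i1) y)
    (pd i1 (G i1 i2) y) (pd i2 (G i1 i2) y)
    (pd i1 (G i2 i2) y) (pd i2 (G i2 i2) y)
    (pd i2 (pd i2 (G i1 i1)) y - 2 * pd i1 (pd i2 (G i1 i2)) y
     + pd i1 (pd i1 (G i2 i2)) y) (psi y) (pd i1 psi y) (pd i2 psi y)
    (pd i1 (pd i1 psi) y) (pd i1 (pd i2 psi) y) (pd i2 (pd i2 psi) y) N).
  intros E. etransitivity; [etransitivity; [|exact E]|].
  - f_equal; ring.
  - unfold Rminus at 1. apply (f_equal2 Rplus); [|reflexivity].
    unfold local_laplace, local_hess, Gamma, sum2, inv, det.
    rewrite !(regular_sym G RG). rewrite ?(pd_comm_fun i2 i1) by auto with smooth.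
    field. simpl in N. lra.
Qed.

Lemma smooth_lie X1 X2 i j : smooth X1 -> smooth X2 -> smooth (lie X1 X2 i j).
Proof.
  intros H1 H2. assert (S := regular_smooth G RG). unfold lie. auto 10 with smooth.
Qed.

End Space.

(** A velocity L_X G + psi G moves the metric by a diffeomorphism and a conformal
    change, hence d_s R = X R - Lap psi - psi R. *)
Lemma scal_evolution (E : idx -> idx -> R * plane -> R) s y X1 X2 psi :
  (forall i j k, Ck k everywhere (E i j)) ->
  locally s (fun t => regular (fun i j => slice (E i j) t)) ->
  smooth X1 -> smooth X2 -> smooth psi ->
  let G := fun i j => slice (E i j) s in
  (forall i j z, dt (E i j) (s, z) = lie G X1 X2 i j z + psi z * G i j z) ->
  is_derive (fun t => local_scal (fun i j => slice (E i j) t) y) s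
    (X1 y * pd i1 (local_scal G) y + X2 y * pd i2 (local_scal G) y
     - local_laplace G psi y - psi y * local_scal G y).
Proof.
  intros HE HR H1 H2 Hp G Hh.
  assert (RG : regular G) by exact (locally_singleton _ _ HR).
  evar_last. { exact (is_derive_local_scal E s y HE HR). }
  fold G.
  replace (fun i j => slice (dt (E i j)) s)
    with (fun i j z => lie G X1 X2 i j z + psi z * G i j z).
  2: { do 3 (apply functional_extensionality; intros ?). symmetry. apply Hh. }
  rewrite (scal_var_plus G (lie G X1 X2) (fun i j z => psi z * G i j z)).
  - rewrite scal_var_lie, scal_var_conformal; auto. ring.
  - intros; now apply smooth_lie.
  - intros. apply smooth_mult; auto. now apply regular_smooth.
Qed.

(** * The gradient field of the potential *)

Definition grad (G : local_metric) (f : plane -> R) (k : idx) : plane -> R :=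
  fun y => inv G k i1 y * pd i1 f y + inv G k i2 y * pd i2 f y.

Lemma smooth_grad G f k : regular G -> smooth f -> smooth (grad G f k).
Proof.
  intros RG F. unfold grad.
  apply smooth_plus; apply smooth_mult; auto using smooth_inv with smooth.
Qed.

Lemma pd_grad G f k i y : regular G -> smooth f ->
  pd i (grad G f k) y =
  sum2 (fun l => - sum2 (fun a => sum2 (fun b =>
       inv G k a y * pd i (G a b) y * inv G b l y)) * pd l f y
    + inv G k l y * pd i (pd l f) y).
Proof.
  intros RG F. apply pd_unique. unfold grad, sum2.
  apply (is_dir_plus (fun y => inv G k i1 y * pd i1 f y));
  apply (is_dir_mult (inv G k _)); try apply (is_dir_inv_metric G RG i k);
  apply smooth_is; auto with smooth.
Qed.

(** A Hessian is half the Lie derivative along the gradient: up to a conformal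
    factor the flow only moves the metric by diffeomorphisms. *)
Lemma lie_grad G f i j y : regular G -> smooth f ->
  lie G (grad G f i1) (grad G f i2) i j y = 2 * local_hess G f i j y.
Proof.
  intros RG F. unfold lie. rewrite !(pd_grad G f) by auto.
  unfold local_hess, Gamma, grad, sum2.
  assert (N := det_neq G RG y).
  unfold inv, det in *.
  destruct i, j; rewrite ?(regular_sym G RG) in *;
    rewrite ?(pd_comm f i2 i1) by auto; field; auto.
Qed.

(** * Change of coordinates *)

(** The primed coefficients are those of the pullback by the matrix with rows (a, b)
    and (c, d); both denominators are determinants of metrics. *)
Lemma contraction_change (E F G h11 h12 h21 h22 a b c d : R) :
  let E' := E * a ^ 2 + 2 * F * a * c + G * c ^ 2 in
  let F' := E * a * b + F * (a * d + b * c) + G * c * d in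
  let G' := E * b ^ 2 + 2 * F * b * d + G * d ^ 2 in
  E' * G' - F' * F' <> 0 -> E * G - F * F <> 0 ->
  (G' * (h11 * a * a + h12 * a * c + h21 * c * a + h22 * c * c)
   - F' * (h11 * a * b + h12 * a * d + h21 * c * b + h22 * c * d)
   - F' * (h11 * b * a + h12 * b * c + h21 * d * a + h22 * d * c)
   + E' * (h11 * b * b + h12 * b * d + h21 * d * b + h22 * d * d))
   / (E' * G' - F' * F')
  = (G * h11 - F * h12 - F * h21 + E * h22) / (E * G - F * F).
Proof.
  intros E' F' G' N' N.
  assert (D : E' * G' - F' * F' = (E * G - F * F) * (a * d - b * c) ^ 2).
  { unfold E', F', G'. ring. }
  rewrite D in *.
  assert (a * d - b * c <> 0).
  { intros H. apply N'. rewrite H. ring. }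
  unfold E', F', G'. field. split; auto.
Qed.

Lemma sum2_zero (a : idx -> R) : (forall i, a i = 0) -> sum2 a = 0.
Proof. intros H. unfold sum2. rewrite !H. ring. Qed.

Definition contract (G H : local_metric) (y : plane) : R :=
  sum2 (fun i => sum2 (fun j => inv G i j y * H i j y)).

(** In this section G' is the pullback of G by the map with components T, whose
    Jacobian matrix is J. *)
Section Change.
Context (D : plane -> Prop) (T : idx -> plane -> R) (G G' : local_metric).
Context (HD : open D) (HT : forall a k, Ck k D (T a)).
Context (RG : regular G) (RG' : regular G').

Definition at_T (y : plane) : plane := (T i1 y, T i2 y).
Definition J (a i : idx) : plane -> R := pd i (T a).

Context (HG : forall i j y, D y -> G' i j y =
  sum2 (fun a => sum2 (fun b => G a b (at_T y) * (J a i y * J b j y)))).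

Lemma T_is a i y : D y -> is_dir (T a) (basis i) y (J a i y).
Proof. intros Hy. apply ex_dir_is, (Ck_ex 0 D); auto. Qed.

Lemma J_is a i m y : D y -> is_dir (J a i) (basis m) y (pd m (J a i) y).
Proof. intros Hy. apply ex_dir_is, (Ck_ex 0 D); auto. apply (Ck_dir 1 D), HT. Qed.

Lemma dJ_is a i j m y : D y ->
  is_dir (pd j (J a i)) (basis m) y (pd m (pd j (J a i)) y).
Proof.
  intros Hy. apply ex_dir_is, (Ck_ex 0 D); auto.
  apply (Ck_dir 1 D). apply (Ck_dir 2 D), HT.
Qed.

Lemma J_sym a i j y : D y -> pd j (J a i) y = pd i (J a j) y.
Proof. intros Hy. apply (dir_comm D); auto. Qed.

Lemma dJ_sym a i j m y : D y -> pd m (pd j (J a i)) y = pd j (pd m (J a i)) y.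
Proof. intros Hy. apply (dir_comm D); auto. apply (Ck_dir 2 D), HT. Qed.

Lemma comp_is f m y : smooth f -> D y ->
  is_dir (fun z => f (at_T z)) (basis m) y
    (sum2 (fun d => pd d f (at_T y) * J d m y)).
Proof.
  intros Hf Hy.
  generalize (is_dir_chain everywhere f (T i1) (T i2) (basis m) y _ _ open_plane
    (smooth_C1_on f Hf) I (T_is i1 m y Hy) (T_is i2 m y Hy)).
  unfold sum2. auto.
Qed.

Lemma pd_metric_change m i j y : D y -> pd m (G' i j) y =
  sum2 (fun a => sum2 (fun b =>
    sum2 (fun d => pd d (G a b) (at_T y) * J d m y) * (J a i y * J b j y)
    + G a b (at_T y) * (pd m (J a i) y * J b j y + J a i y * pd m (J b j) y))).
Proof.
  intros Hy. apply pd_unique.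
  apply (is_dir_ext D (fun y =>
     sum2 (fun a => sum2 (fun b => G a b (at_T y) * (J a i y * J b j y))))); auto.
  { intros z Hz. symmetry. now apply HG. }
  assert (S := regular_smooth G RG).
  assert (K : forall a b, is_dir (fun y => G a b (at_T y) * (J a i y * J b j y))
    (basis m) y
    (sum2 (fun d => pd d (G a b) (at_T y) * J d m y) * (J a i y * J b j y)
    + G a b (at_T y) * (pd m (J a i) y * J b j y + J a i y * pd m (J b j) y))).
  { intros a b. apply (is_dir_mult (fun y => G a b (at_T y))).
    now apply comp_is. apply (is_dir_mult (J a i)); now apply J_is. }
  unfold sum2 in *. apply is_dir_plus; apply is_dir_plus; apply K.
Qed.

Lemma low_change l i j y : D y -> low G' l i j y =
  sum2 (fun d => J d l y *
    (sum2 (fun a => sum2 (fun b => low G d a b (at_T y) * (J a i y * J b j y)))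
     + sum2 (fun c => G d c (at_T y) * pd j (J c i) y))).
Proof.
  intros Hy. unfold low. rewrite !pd_metric_change by auto.
  unfold sum2. rewrite !(regular_sym G RG).
  rewrite !(J_sym _ i l), !(J_sym _ j l), !(J_sym _ i j) by auto.
  field.
Qed.

Lemma det_change y : D y ->
  det G' y = det G (at_T y) * (J i1 i1 y * J i2 i2 y - J i1 i2 y * J i2 i1 y) ^ 2.
Proof. intros Hy. unfold det. rewrite !HG by auto. unfold sum2. ring. Qed.

Lemma jacobian_neq y : D y -> J i1 i1 y * J i2 i2 y - J i1 i2 y * J i2 i1 y <> 0.
Proof.
  intros Hy E. apply (det_neq G' RG' y). rewrite det_change, E by auto. ring.
Qed.

Lemma solve2 (a b c d p q : R) : a * d - b * c <> 0 ->
  a * p + b * q = 0 -> c * p + d * q = 0 -> p = 0 /\ q = 0.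
Proof.
  intros N H1 H2. split; apply (Rmult_eq_reg_l (a * d - b * c)); auto.
  - replace ((a * d - b * c) * p) with (d * (a * p + b * q) - b * (c * p + d * q)) by ring.
    rewrite H1, H2. ring.
  - replace ((a * d - b * c) * q) with (a * (c * p + d * q) - c * (a * p + b * q)) by ring.
    rewrite H1, H2. ring.
Qed.

(** Transformation law of the Christoffel symbols, obtained from the one of the
    lowered symbols by cancelling the invertible matrix J^T G. *)
Lemma Gamma_change c i j y : D y ->
  sum2 (fun k => J c k y * Gamma G' k i j y)
  = sum2 (fun a => sum2 (fun b => Gamma G c a b (at_T y) * (J a i y * J b j y)))
    + pd j (J c i) y.
Proof.
  intros Hy.
  set (w := fun c => sum2 (fun k => J c k y * Gamma G' k i j y)
    - (sum2 (fun a => sum2 (fun b => Gamma G c a b (at_T y) * (J a i y * J b j y)))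
    + pd j (J c i) y)).
  assert (K : forall l, sum2 (fun d => sum2 (fun c =>
     J d l y * G d c (at_T y) * w c)) = 0).
  { intros l. generalize (lower_Gamma G' RG' l i j y). rewrite low_change by auto.
    assert (L : forall d a b, low G d a b (at_T y) =
       sum2 (fun k => G d k (at_T y) * Gamma G k a b (at_T y))).
    { intros. symmetry. now apply lower_Gamma. }
    unfold w, sum2 in *. rewrite !HG, !L by auto. unfold sum2.
    intros E. apply Rminus_diag_eq in E. rewrite <- E. ring. }
  assert (Z : w i1 = 0 /\ w i2 = 0).
  { assert (K1 := K i1). assert (K2 := K i2). unfold sum2 in K1, K2.
    apply (solve2
     (J i1 i1 y * G i1 i1 (at_T y) + J i2 i1 y * G i2 i1 (at_T y))
     (J i1 i1 y * G i1 i2 (at_T y) + J i2 i1 y * G i2 i2 (at_T y))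
     (J i1 i2 y * G i1 i1 (at_T y) + J i2 i2 y * G i2 i1 (at_T y))
     (J i1 i2 y * G i1 i2 (at_T y) + J i2 i2 y * G i2 i2 (at_T y))); try lra.
    replace (_ - _) with (det G (at_T y)
      * (J i1 i1 y * J i2 i2 y - J i1 i2 y * J i2 i1 y)) by (unfold det; ring).
    apply Rmult_integral_contrapositive_currified.
    now apply det_neq. now apply jacobian_neq. }
  destruct Z as [Z1 Z2]. unfold w in Z1, Z2.
  destruct c; apply Rminus_diag_uniq; assumption.
Qed.

Lemma contract_change (H H' : local_metric) y : D y ->
  (forall i j, H' i j y =
    sum2 (fun a => sum2 (fun b => H a b (at_T y) * (J a i y * J b j y)))) ->
  contract G' H' y = contract G H (at_T y).
Proof.
  intros Hy HH.
  assert (N := det_neq G RG (at_T y)). assert (N' := det_neq G' RG' y).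
  generalize (contraction_change (G i1 i1 (at_T y)) (G i1 i2 (at_T y))
    (G i2 i2 (at_T y)) (H i1 i1 (at_T y)) (H i1 i2 (at_T y))
    (H i2 i1 (at_T y)) (H i2 i2 (at_T y)) (J i1 i1 y) (J i1 i2 y)
    (J i2 i1 y) (J i2 i2 y)).
  cbv zeta.
  assert (E11 := HG i1 i1 y Hy). assert (E12 := HG i1 i2 y Hy).
  assert (E22 := HG i2 i2 y Hy). unfold sum2 in E11, E12, E22.
  rewrite (regular_sym G RG) in E11, E12, E22.
  unfold det in N, N'. rewrite (regular_sym G RG) in N.
  rewrite (regular_sym G' RG') in N'.
  match goal with |- (?p * ?r - ?q * _ <> 0 -> _) -> _ => 
    replace p with (G' i1 i1 y) by (rewrite E11; ring);
    replace q with (G' i1 i2 y) by (rewrite E12; ring);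
    replace r with (G' i2 i2 y) by (rewrite E22; ring) end.
  intros C. specialize (C N' N).
  unfold contract, sum2, inv, det. rewrite !(regular_sym G RG), !(regular_sym G' RG').
  rewrite !HH. unfold sum2.
  etransitivity; [etransitivity; [|exact C]|]; field; auto.
Qed.

Section Scalar.
Context (f f' : plane -> R) (Hf : smooth f) (Hf' : forall y, D y -> f' y = f (at_T y)).

Lemma pd_change i y : D y ->
  pd i f' y = sum2 (fun a => pd a f (at_T y) * J a i y).
Proof.
  intros Hy. apply pd_unique. apply (is_dir_ext D (fun z => f (at_T z))); auto.
  { intros z Hz. symmetry. auto. }
  now apply comp_is.
Qed.

Lemma pd2_change i j y : D y -> pd i (pd j f') y =
  sum2 (fun a => sum2 (fun b => pd b (pd a f) (at_T y) * J b i y) * J a j y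
     + pd a f (at_T y) * pd i (J a j) y).
Proof.
  intros Hy. apply pd_unique. apply (is_dir_ext D
    (fun y => sum2 (fun a => pd a f (at_T y) * J a j y))); auto.
  { intros z Hz. symmetry. now apply pd_change. }
  unfold sum2 at 1 2.
  apply is_dir_plus; (apply (is_dir_mult (fun z => pd _ f (at_T z)));
   [apply comp_is; auto with smooth | now apply J_is]).
Qed.

Lemma hess_change i j y : D y -> local_hess G' f' i j y =
  sum2 (fun a => sum2 (fun b => local_hess G f a b (at_T y) * (J a i y * J b j y))).
Proof.
  intros Hy. unfold local_hess. rewrite pd2_change by auto.
  assert (C := fun c => Gamma_change c i j y Hy).
  transitivity (sum2 (fun a => sum2 (fun b => pd b (pd a f) (at_T y) * J b i y) * J a j y
     + pd a f (at_T y) * pd i (J a j) y)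
     - (pd i1 f (at_T y) * sum2 (fun k => J i1 k y * Gamma G' k i j y)
        + pd i2 f (at_T y) * sum2 (fun k => J i2 k y * Gamma G' k i j y))).
  - f_equal. unfold sum2. rewrite !pd_change by auto. unfold sum2. ring.
  - rewrite (C i1), (C i2). unfold sum2.
    rewrite !(J_sym _ j i) by auto. rewrite !(pd_comm f i2 i1) by auto. ring.
Qed.

Lemma laplace_change y : D y -> local_laplace G' f' y = local_laplace G f (at_T y).
Proof.
  intros Hy. apply (contract_change (local_hess G f) (local_hess G' f') y Hy).
  intros. now apply hess_change.
Qed.

Lemma gradient_norm_change y : D y ->
  contract G' (fun i j z => pd i f' z * pd j f' z) y
  = contract G (fun i j z => pd i f z * pd j f z) (at_T y).
Proof.
  intros Hy. apply (contract_change (fun i j z => pd i f z * pd j f z)); auto.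
  intros i j. rewrite !pd_change by auto. unfold sum2. ring.
Qed.
End Scalar.

(** The components R^k_{i12} of the curvature tensor; the antisymmetry in the last two
    indices leaves no others on a surface. *)
Definition riem (G : local_metric) (k i : idx) (y : plane) : R :=
  pd i1 (Gamma G k i i2) y - pd i2 (Gamma G k i i1) y
  + sum2 (fun l => Gamma G k i1 l y * Gamma G l i i2 y
                   - Gamma G k i2 l y * Gamma G l i i1 y).

Lemma Gamma_sym H k i j : regular H -> Gamma H k i j = Gamma H k j i.
Proof.
  intros RH. apply functional_extensionality. intros y. unfold Gamma, sum2.
  destruct i, j; rewrite ?(regular_sym H RH); field.
Qed.

Lemma Ricci_riem H i y : regular H ->
  Ricci H i i1 y = - riem H i2 i y /\ Ricci H i i2 y = riem H i1 i y.
Proof.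
  intros RH. unfold Ricci, riem, sum2.
  split; ring.
Qed.

Lemma pd_Gamma_change m c i j y : D y ->
  sum2 (fun k => pd m (J c k) y * Gamma G' k i j y
                 + J c k y * pd m (Gamma G' k i j) y)
  = sum2 (fun a => sum2 (fun b =>
      sum2 (fun d => pd d (Gamma G c a b) (at_T y) * J d m y) * (J a i y * J b j y)
      + Gamma G c a b (at_T y)
        * (pd m (J a i) y * J b j y + J a i y * pd m (J b j) y)))
    + pd m (pd j (J c i)) y.
Proof.
  intros Hy.
  transitivity (pd m (fun y => sum2 (fun k => J c k y * Gamma G' k i j y)) y).
  - symmetry. apply pd_unique. unfold sum2.
    apply is_dir_plus; (apply (is_dir_mult (J c _));
      [now apply J_is | apply smooth_is; now apply smooth_Gamma]).
  - apply pd_unique. apply (is_dir_ext D (fun y =>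
      sum2 (fun a => sum2 (fun b => Gamma G c a b (at_T y) * (J a i y * J b j y)))
      + pd j (J c i) y)); auto.
    { intros z Hz. symmetry. now apply Gamma_change. }
    assert (K : forall a b, is_dir (fun y => Gamma G c a b (at_T y) * (J a i y * J b j y))
      (basis m) y
      (sum2 (fun d => pd d (Gamma G c a b) (at_T y) * J d m y) * (J a i y * J b j y)
      + Gamma G c a b (at_T y)
         * (pd m (J a i) y * J b j y + J a i y * pd m (J b j) y))).
    { intros a b. apply (is_dir_mult (fun y => Gamma G c a b (at_T y))).
      apply comp_is; auto. now apply smooth_Gamma.
      apply (is_dir_mult (J a i)); now apply J_is. }
    apply is_dir_plus; [|now apply dJ_is].
    unfold sum2 in *. apply is_dir_plus; apply is_dir_plus; apply K.
Qed.

(** The third derivatives of T cancel in the antisymmetrization. *)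
Lemma riem_change c i y : D y ->
  sum2 (fun k => J c k y * riem G' k i y)
  = (J i1 i1 y * J i2 i2 y - J i1 i2 y * J i2 i1 y)
    * sum2 (fun a => riem G c a (at_T y) * J a i y).
Proof.
  intros Hy.
  (* defects of the transformation laws of the Christoffel symbols and of their
     derivatives, of which the identity is a combination *)
  set (X := fun c i j => sum2 (fun k => J c k y * Gamma G' k i j y)
    - (sum2 (fun a => sum2 (fun b => Gamma G c a b (at_T y) * (J a i y * J b j y)))
       + pd j (J c i) y)).
  set (Y := fun m j => sum2 (fun k => pd m (J c k) y * Gamma G' k i j y
                 + J c k y * pd m (Gamma G' k i j) y)
     - (sum2 (fun a => sum2 (fun b =>
        sum2 (fun d => pd d (Gamma G c a b) (at_T y) * J d m y) * (J a i y * J b j y)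
        + Gamma G c a b (at_T y)
         * (pd m (J a i) y * J b j y + J a i y * pd m (J b j) y)))
       + pd m (pd j (J c i)) y)).
  assert (Q : forall c i j, X c i j = 0).
  { intros. apply Rminus_diag_eq. now apply Gamma_change. }
  assert (A : forall m j, Y m j = 0).
  { intros. apply Rminus_diag_eq. now apply pd_Gamma_change. }
  apply Rminus_diag_uniq.
  transitivity (Y i1 i2 - Y i2 i1
    + sum2 (fun l => Gamma G' l i i2 y * X c i1 l)
    - sum2 (fun l => Gamma G' l i i1 y * X c i2 l)
    + sum2 (fun a => sum2 (fun b => Gamma G c a b (at_T y) * J a i1 y * X b i i2))
    - sum2 (fun a => sum2 (fun b => Gamma G c a b (at_T y) * J a i2 y * X b i i1))).
  - clear A Q. unfold X, Y, riem.
    rewrite (dJ_sym c i i1 i2) by auto.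
    unfold sum2.
    rewrite !(J_sym _ i2 i1) by auto.
    rewrite !(Gamma_sym G _ i2 i1) by auto.
    destruct i; rewrite ?(J_sym _ i2 i1) by auto; ring.
  - rewrite !A. rewrite !sum2_zero; [ring| | | |]; intros; try apply sum2_zero;
      intros; rewrite Q; ring.
Qed.

Lemma scal_change y : D y -> local_scal G' y = local_scal G (at_T y).
Proof.
  intros Hy. apply (contract_change (Ricci G) (Ricci G') y Hy).
  intros i j.
  assert (N := jacobian_neq y Hy).
  assert (A1 := riem_change i1 i y Hy). assert (A2 := riem_change i2 i y Hy).
  assert (R1 := Ricci_riem G i1 (at_T y) RG). assert (R2 := Ricci_riem G i2 (at_T y) RG).
  destruct (Ricci_riem G' i y RG') as [R3 R4].
  destruct R1 as [R11 R12], R2 as [R21 R22].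
  unfold sum2 in *.
  apply (Rmult_eq_reg_l (J i1 i1 y * J i2 i2 y - J i1 i2 y * J i2 i1 y)); auto.
  destruct j; rewrite ?R3, ?R4, R11, R12, R21, R22.
  - transitivity (J i2 i1 y * (J i1 i1 y * riem G' i1 i y + J i1 i2 y * riem G' i2 i y)
      - J i1 i1 y * (J i2 i1 y * riem G' i1 i y + J i2 i2 y * riem G' i2 i y)).
    ring. rewrite A1, A2. ring.
  - transitivity (J i2 i2 y * (J i1 i1 y * riem G' i1 i y + J i1 i2 y * riem G' i2 i y)
      - J i1 i2 y * (J i2 i1 y * riem G' i1 i y + J i2 i2 y * riem G' i2 i y)).
    ring. rewrite A1, A2. ring.
Qed.

End Change.

(** * Stereographic charts of the sphere *)

Lemma chart_denominator (a b : R) : 0 < 1 + a ^ 2 + b ^ 2.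
Proof. nra. Qed.

Lemma pole_square c : pole c * pole c = 1.
Proof. destruct c; simpl; ring. Qed.

Ltac explicit_dir :=
  unfold is_dir, plus, scal; simpl; unfold prod_plus, prod_scal; simpl;
  unfold plus, scal; simpl; unfold mult; simpl.

Lemma dparam1 c a b : dparam c i1 (a, b) =
  (2 * (1 - a ^ 2 + b ^ 2) / (1 + a ^ 2 + b ^ 2) ^ 2,
   - 4 * a * b / (1 + a ^ 2 + b ^ 2) ^ 2,
   4 * pole c * a / (1 + a ^ 2 + b ^ 2) ^ 2).
Proof.
  assert (P := chart_denominator a b).
  unfold dparam. f_equal; [f_equal|]; apply is_dir_unique; explicit_dir;
  auto_derive; simpl in P |- *; rewrite ?Rmult_0_l, ?Rplus_0_r, ?Rmult_0_r, ?Rplus_0_r;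
  try (repeat split; lra); field; lra.
Qed.

Lemma dparam2 c a b : dparam c i2 (a, b) =
  (- 4 * a * b / (1 + a ^ 2 + b ^ 2) ^ 2,
   2 * (1 + a ^ 2 - b ^ 2) / (1 + a ^ 2 + b ^ 2) ^ 2,
   4 * pole c * b / (1 + a ^ 2 + b ^ 2) ^ 2).
Proof.
  assert (P := chart_denominator a b).
  unfold dparam. f_equal; [f_equal|]; apply is_dir_unique; explicit_dir;
  auto_derive; simpl in P |- *; rewrite ?Rmult_0_l, ?Rplus_0_r, ?Rmult_0_r, ?Rplus_0_r;
  try (repeat split; lra); field; lra.
Qed.

Lemma param_on_sphere c y : on_sphere (param c y).
Proof.
  destruct y as [a b]. assert (P := chart_denominator a b).
  unfold on_sphere, dot, param.
  replace (pole c * (a ^ 2 + b ^ 2 - 1) / (1 + a ^ 2 + b ^ 2) *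
    (pole c * (a ^ 2 + b ^ 2 - 1) / (1 + a ^ 2 + b ^ 2)))
   with ((pole c * pole c) * ((a ^ 2 + b ^ 2 - 1) / (1 + a ^ 2 + b ^ 2) *
    ((a ^ 2 + b ^ 2 - 1) / (1 + a ^ 2 + b ^ 2)))) by (field; lra).
  rewrite pole_square. field. lra.
Qed.

Lemma dparam_tangent c i y : tangent (param c y) (dparam c i y).
Proof.
  destruct y as [a b]. assert (P := chart_denominator a b).
  unfold tangent, dot, param.
  destruct i; [rewrite dparam1|rewrite dparam2]; destruct c; simpl pole; field; lra.
Qed.

Lemma dparam_dot c i j a b :
  dot (dparam c i (a, b)) (dparam c j (a, b)) =
  match i, j with i1, i1 | i2, i2 => 4 / (1 + a ^ 2 + b ^ 2) ^ 2 | _, _ => 0 end.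
Proof.
  assert (P := chart_denominator a b).
  destruct i, j; rewrite ?dparam1, ?dparam2; unfold dot; destruct c; simpl pole; field; lra.
Qed.

(** The coordinate vector fields span the tangent planes: they are orthogonal of
    equal length. *)
Lemma tangent_span c a b v : tangent (param c (a, b)) v ->
  v = plus (scal (dot v (dparam c i1 (a, b)) * ((1 + a ^ 2 + b ^ 2) ^ 2 / 4))
             (dparam c i1 (a, b)))
           (scal (dot v (dparam c i2 (a, b)) * ((1 + a ^ 2 + b ^ 2) ^ 2 / 4))
             (dparam c i2 (a, b))).
Proof.
  destruct v as [[v1 v2] v3]. intros H. assert (P := chart_denominator a b).
  unfold tangent, dot, param in H.
  assert (K : 2 * a * v1 + 2 * b * v2 + pole c * (a ^ 2 + b ^ 2 - 1) * v3 = 0).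
  { apply (Rmult_eq_reg_r (/ (1 + a ^ 2 + b ^ 2))).
    - rewrite Rmult_0_l, <- H. field. lra.
    - apply Rinv_neq_0_compat. lra. }
  clear H. rewrite dparam1, dparam2.
  unfold plus, scal; simpl. unfold prod_plus, prod_scal; simpl.
  unfold plus, scal; simpl. unfold prod_plus, prod_scal; simpl.
  unfold plus, scal; simpl. unfold mult; simpl.
  set (w := 2 * a * v1 + 2 * b * v2 + pole c * (a ^ 2 + b ^ 2 - 1) * v3) in K.
  assert (Hp := pole_square c).
  f_equal; [f_equal|].
  - transitivity (v1 - w * (2 * a / (1 + a ^ 2 + b ^ 2) ^ 2));
      [rewrite K; ring|]. unfold w.
    destruct c; simpl pole; field; lra.
  - transitivity (v2 - w * (2 * b / (1 + a ^ 2 + b ^ 2) ^ 2));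
      [rewrite K; ring|]. unfold w.
    destruct c; simpl pole; field; lra.
  - transitivity (v3 - w * (pole c * (a ^ 2 + b ^ 2 - 1) / (1 + a ^ 2 + b ^ 2) ^ 2));
      [rewrite K; ring|]. unfold w.
    destruct c; simpl pole; field; lra.
Qed.

Lemma dparam_neq0 c a b (p q : R) :
  plus (scal p (dparam c i1 (a, b))) (scal q (dparam c i2 (a, b))) = (0, 0, 0) ->
  p = 0 /\ q = 0.
Proof.
  assert (P := chart_denominator a b).
  rewrite dparam1, dparam2. intros H.
  set (n := 1 + a ^ 2 + b ^ 2) in *.
  assert (Hp := pole_square c).
  assert (n <> 0) by lra.
  assert (H1 : p * (2 * (1 - a ^ 2 + b ^ 2) / n ^ 2) + q * (- 4 * a * b / n ^ 2) = 0)
    by exact (f_equal (fun x : space => fst (fst x)) H).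
  assert (H2 : p * (- 4 * a * b / n ^ 2) + q * (2 * (1 + a ^ 2 - b ^ 2) / n ^ 2) = 0)
    by exact (f_equal (fun x : space => snd (fst x)) H).
  assert (H3 : p * (4 * pole c * a / n ^ 2) + q * (4 * pole c * b / n ^ 2) = 0)
    by exact (f_equal (fun x : space => snd x) H).
  assert (K1 : p * (2 * (1 - a ^ 2 + b ^ 2)) + q * (- 4 * a * b) = 0).
  { rewrite <- (Rmult_0_r (n ^ 2)), <- H1. field; auto. }
  assert (K2 : p * (- 4 * a * b) + q * (2 * (1 + a ^ 2 - b ^ 2)) = 0).
  { rewrite <- (Rmult_0_r (n ^ 2)), <- H2. field; auto. }
  assert (K3 : p * a + q * b = 0).
  { transitivity (pole c * pole c * (p * a + q * b)). rewrite Hp; ring.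
    rewrite <- (Rmult_0_r (pole c * n ^ 2 / 4)), <- H3. field; auto. }
  (* subtracting multiples of the last equation leaves n p = n q = 0 *)
  split; apply (Rmult_eq_reg_l n); auto; unfold n; rewrite Rmult_0_r.
  - transitivity (/ 2 * (p * (2 * (1 - a ^ 2 + b ^ 2)) + q * (- 4 * a * b))
      + 2 * a * (p * a + q * b)). field. rewrite K1, K3. ring.
  - transitivity (/ 2 * (p * (- 4 * a * b) + q * (2 * (1 + a ^ 2 - b ^ 2)))
      + 2 * b * (p * a + q * b)). field. rewrite K2, K3. ring.
Qed.

Definition other (c : chart) : chart :=
  match c with from_north => from_south | from_south => from_north end.

(** The transition map is the inversion y / |y|^2, in both directions. *)
Definition inversion (a : idx) : plane -> R := fun y =>
  match a with i1 => fst y | i2 => snd y end / (fst y * fst y + snd y * snd y).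

Definition punctured (y : plane) : Prop := fst y * fst y + snd y * snd y <> 0.

Lemma continuous_fst' (y : plane) : continuous (fst : plane -> R) y.
Proof. destruct y. apply continuous_fst. Qed.
Lemma continuous_snd' (y : plane) : continuous (snd : plane -> R) y.
Proof. destruct y. apply continuous_snd. Qed.

Lemma open_punctured : open (punctured : plane -> Prop).
Proof.
  apply (open_comp (fun y : plane => fst y * fst y + snd y * snd y) (fun r => r <> 0)).
  - intros y _.
    apply (@continuous_plus _ R_AbsRing R_NormedModule
      (fun y : plane => fst y * fst y) (fun y => snd y * snd y));
    [ apply (@continuous_mult _ R_AbsRing (fst : plane -> R) fst)
    | apply (@continuous_mult _ R_AbsRing (snd : plane -> R) snd)];
    auto using continuous_fst', continuous_snd'.
  - apply open_neq.
Qed.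

Lemma smooth_fst : smooth fst.
Proof.
  intros k. apply Ck_linear; [apply open_plane | intros; apply continuous_fst' | reflexivity].
Qed.

Lemma smooth_snd : smooth snd.
Proof.
  intros k. apply Ck_linear; [apply open_plane | intros; apply continuous_snd' | reflexivity].
Qed.

Lemma Ck_inversion a k : Ck k punctured (inversion a).
Proof.
  assert (S1 : Ck k punctured fst) by (apply (Ck_sub k _ everywhere); [constructor|apply smooth_fst]).
  assert (S2 : Ck k punctured snd) by (apply (Ck_sub k _ everywhere); [constructor|apply smooth_snd]).
  assert (O := open_punctured).
  unfold inversion. destruct a; (apply Ck_div; auto;
    apply Ck_plus; auto; apply Ck_mult; auto).
Qed.

Lemma J_inversion a i p q : p * p + q * q <> 0 ->
  J inversion a i (p, q) =
  match a, i with
  | i1, i1 => (q ^ 2 - p ^ 2) | i2, i2 => (p ^ 2 - q ^ 2)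
  | _, _ => - 2 * p * q end / (p * p + q * q) ^ 2.
Proof.
  intros N. unfold J, pd. apply is_dir_unique. unfold inversion.
  destruct a, i; explicit_dir; (auto_derive;
   rewrite ?Rmult_0_l, ?Rplus_0_r, ?Rmult_0_r, ?Rplus_0_r; [auto|field; auto]).
Qed.

Lemma param_inversion c y : punctured y ->
  param (other c) (at_T inversion y) = param c y.
Proof.
  destruct y as [p q]. unfold punctured; simpl. intros N.
  assert (P := chart_denominator p q).
  assert (0 < p * p + q * q) by nra.
  unfold at_T, inversion, param; simpl.
  assert (K : (p / (p * p + q * q)) ^ 2 + (q / (p * p + q * q)) ^ 2 = / (p * p + q * q)).
  { field. auto. }
  simpl in *. rewrite Rplus_assoc, K. 
  assert (1 + / (p * p + q * q) <> 0).
  { generalize (Rinv_0_lt_compat (p * p + q * q)). lra. }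
  f_equal; [f_equal|]; destruct c; simpl; field; repeat split; nra.
Qed.

Lemma dparam_inversion c i y : punctured y -> dparam c i y =
  plus (scal (J inversion i1 i y) (dparam (other c) i1 (at_T inversion y)))
       (scal (J inversion i2 i y) (dparam (other c) i2 (at_T inversion y))).
Proof.
  destruct y as [p q]. unfold punctured; simpl. intros N.
  assert (P := chart_denominator p q).
  assert (0 < p * p + q * q) by nra.
  unfold at_T. rewrite !J_inversion by auto. unfold inversion; simpl fst; simpl snd.
  rewrite dparam1, dparam2.
  assert (K : 1 + (p / (p * p + q * q)) ^ 2 + (q / (p * p + q * q)) ^ 2
     = (1 + p ^ 2 + q ^ 2) / (p * p + q * q)).
  { field. auto. }
  rewrite !K.
  destruct i; rewrite ?dparam1, ?dparam2;
  unfold plus, scal; simpl; unfold prod_plus, prod_scal; simpl;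
  unfold plus, scal; simpl; unfold prod_plus, prod_scal; simpl;
  unfold plus, scal; simpl; unfold mult; simpl;
  (f_equal; [f_equal|]); destruct c; simpl; field; repeat split; nra.
Qed.

(** * Metrics of the sphere in the charts *)

Lemma coord_param c y : coord c (param c y) = y.
Proof.
  destruct y as [a b]. assert (P := chart_denominator a b).
  unfold coord, param.
  replace (1 - pole c * (pole c * (a ^ 2 + b ^ 2 - 1) / (1 + a ^ 2 + b ^ 2)))
    with (2 / (1 + a ^ 2 + b ^ 2)).
  - f_equal; field; lra.
  - transitivity (1 - (pole c * pole c) * (a ^ 2 + b ^ 2 - 1) / (1 + a ^ 2 + b ^ 2)).
    rewrite pole_square. field; lra. field; lra.
Qed.

Lemma chart_at_pole x : pole (chart_at x) * snd x <= 0.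
Proof. unfold chart_at. destruct (Rle_dec (snd x) 0); simpl; lra. Qed.

Lemma param_coord x : on_sphere x ->
  param (chart_at x) (coord (chart_at x) x) = x.
Proof.
  destruct x as [[x1 x2] x3]. intros H. assert (L := chart_at_pole (x1, x2, x3)).
  simpl snd in L. set (c := chart_at _) in *. clearbody c.
  unfold on_sphere, dot in H. unfold coord, param.
  assert (Hp := pole_square c).
  assert (N : 1 - pole c * x3 <> 0) by lra.
  assert (E : 1 + (x1 / (1 - pole c * x3)) ^ 2 + (x2 / (1 - pole c * x3)) ^ 2
    = 2 / (1 - pole c * x3)).
  { transitivity (((1 - pole c * x3) ^ 2 + x1 * x1 + x2 * x2) / (1 - pole c * x3) ^ 2).
    field; auto.
    replace ((1 - pole c * x3) ^ 2 + x1 * x1 + x2 * x2)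
      with (1 - 2 * pole c * x3 + (pole c * pole c) * (x3 * x3) + (x1 * x1 + x2 * x2)) by ring.
    rewrite Hp. replace (x1 * x1 + x2 * x2) with (1 - x3 * x3) by lra. field; auto. }
  rewrite E.
  replace ((x1 / (1 - pole c * x3)) ^ 2 + (x2 / (1 - pole c * x3)) ^ 2 - 1)
   with (2 / (1 - pole c * x3) - 2) by (rewrite <- E; ring).
  f_equal; [f_equal; field; auto|].
  transitivity (pole c * pole c * x3); [field; auto|rewrite Hp; ring].
Qed.

(** The unit discs of the two charts cover the sphere; this square contains them and
    is a product of intervals. *)
Definition in_square (y : plane) : Prop :=
  -1 <= fst y <= 1 /\ -1 <= snd y <= 1.

Lemma coord_square x : on_sphere x -> in_square (coord (chart_at x) x).
Proof.
  destruct x as [[x1 x2] x3]. intros H. assert (L := chart_at_pole (x1, x2, x3)).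
  simpl snd in L. set (c := chart_at _) in *. clearbody c.
  unfold on_sphere, dot in H. unfold coord, in_square; simpl.
  assert (A : forall z, z * z <= 1 -> -1 <= z / (1 - pole c * x3) <= 1).
  { intros z Hz. assert (-1 <= z <= 1) by nra.
    split.
    - apply (Rmult_le_reg_r (1 - pole c * x3)); [lra|].
      unfold Rdiv. rewrite Rmult_assoc, Rinv_l by lra. lra.
    - apply (Rmult_le_reg_r (1 - pole c * x3)); [lra|].
      unfold Rdiv. rewrite Rmult_assoc, Rinv_l by lra. lra. }
  split; apply A; nra.
Qed.

Lemma chart_cases c y :
  chart_at (param c y) = c \/
  (chart_at (param c y) = other c /\ punctured y /\
   coord (other c) (param c y) = at_T inversion y).
Proof.
  destruct (classic (punctured y)) as [Hy|Hy].
  - assert (K : coord (other c) (param c y) = at_T inversion y).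
    { rewrite <- (param_inversion c y Hy). apply coord_param. }
    destruct c, (chart_at _); auto.
  - left. destruct y as [a b]. unfold punctured in Hy; simpl in Hy.
    apply NNPP in Hy. assert (a = 0) by nra. assert (b = 0) by nra. subst.
    unfold chart_at. destruct (Rle_dec _ _) as [Q|Q]; destruct c; auto; exfalso;
     [|apply Q]; simpl in *; unfold Rdiv in *;
     replace (1 + 0 * (0 * 1) + 0 * (0 * 1)) with 1 in * by ring; rewrite ?Rinv_1 in *; lra.
Qed.

(** Scalars are defined in a preferred chart, which jumps along the equator;
    invariance under the transition map frees them from this choice, so that they can
    be differentiated everywhere. *)
Lemma chart_independence (S : chart -> plane -> R) c y :
  (forall c y, punctured y -> S c y = S (other c) (at_T inversion y)) ->
  S (chart_at (param c y)) (coord (chart_at (param c y)) (param c y)) = S c y.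
Proof.
  intros H. destruct (chart_cases c y) as [E|[E [P K]]]; rewrite E.
  - now rewrite coord_param.
  - rewrite K. symmetry. now apply H.
Qed.

Lemma tangent_comb x a b v w : tangent x v -> tangent x w ->
  tangent x (plus (scal a v) (scal b w)).
Proof.
  destruct x as [[x1 x2] x3], v as [[v1 v2] v3], w as [[w1 w2] w3].
  unfold tangent, dot; simpl. unfold plus, scal; simpl. unfold mult; simpl. 
  intros H K.
  transitivity (a * (x1 * v1 + x2 * v2 + x3 * v3) + b * (x1 * w1 + x2 * w2 + x3 * w3)).
  ring. rewrite H, K; ring.
Qed.

Section Inner.
Context (h : metric) (x : space) (Hh : inner_product_at h x).

Lemma inner_left a b v v' w : tangent x v -> tangent x v' -> tangent x w ->
  h x (plus (scal a v) (scal b v')) w = a * h x v w + b * h x v' w.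
Proof.
  intros Hv Hv' Hw. destruct Hh as [_ [L _]].
  assert (Z : h x (scal b v') w = b * h x v' w).
  { assert (Z0 : h x zero w = 0).
    { replace (zero : space) with (plus (scal (-1) v') v').
      rewrite L by auto. ring.
      destruct v' as [[p q] r]. unfold plus, scal, zero; simpl.
      unfold prod_plus, prod_scal, prod_zero; simpl. unfold plus, scal, zero; simpl.
      unfold prod_plus, prod_scal, prod_zero; simpl. unfold plus, scal, zero; simpl.
      unfold mult; simpl. f_equal; [f_equal|]; ring. }
    replace (scal b v') with (plus (scal b v') (zero : space)) by apply plus_zero_r.
    rewrite L, Z0 by (auto; unfold tangent, dot, zero; destruct x as [[? ?] ?]; simpl; 
      unfold zero; simpl; ring). ring. }
  rewrite L, Z; auto.
  replace (scal b v') with (plus (scal 0 v) (scal b v')).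
  now apply tangent_comb.
  rewrite (@scal_zero_l R_Ring). apply plus_zero_l.
Qed.

Lemma inner_right a b v v' w : tangent x v -> tangent x v' -> tangent x w ->
  h x w (plus (scal a v) (scal b v')) = a * h x w v + b * h x w v'.
Proof.
  intros Hv Hv' Hw. destruct Hh as [S _].
  rewrite S, inner_left by auto using tangent_comb. now rewrite (S v), (S v').
Qed.
End Inner.

Section Chart.
Context (h : metric) (Hh : riemannian h).

Lemma inner_param c y : inner_product_at h (param c y).
Proof. apply Hh, param_on_sphere. Qed.

Lemma comp_regular c : regular (comp h c).
Proof.
  assert (I := inner_param c). assert (T := dparam_tangent c).
  assert (P : forall y, 0 < comp h c i1 i1 y).
  { intros [a b]. apply I; auto. intros H.
    destruct (dparam_neq0 c a b 1 0); try lra.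
    rewrite H. rewrite (@scal_zero_l R_Ring), plus_zero_r. 
    unfold scal; simpl. unfold prod_scal; simpl. unfold scal; simpl.
    unfold prod_scal; simpl. unfold scal; simpl. unfold mult; simpl.
    f_equal; [f_equal|]; ring. }
  assert (S : comp h c i2 i1 = comp h c i1 i2).
  { apply functional_extensionality. intros y. apply I; auto. }
  split; auto.
  - intros i j k. apply Hh.
  - intros y. specialize (P y).
    set (E := comp h c i1 i1 y) in *. set (F := comp h c i1 i2 y).
    set (G := comp h c i2 i2 y).
    (* the positive norm of E d_2 - F d_1 is E times the determinant *)
    assert (Q : 0 < h (param c y)
       (plus (scal (- F) (dparam c i1 y)) (scal E (dparam c i2 y)))
       (plus (scal (- F) (dparam c i1 y)) (scal E (dparam c i2 y)))).
    { apply I. now apply tangent_comb. destruct y as [a b]. intros H.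
      destruct (dparam_neq0 c a b _ _ H). lra. }
    rewrite inner_left, !inner_right in Q by auto using tangent_comb.
    change (0 < E * G - F * comp h c i2 i1 y).
    rewrite S. fold F.
    change (h (param c y) (dparam c i1 y) (dparam c i1 y)) with E in Q.
    change (h (param c y) (dparam c i1 y) (dparam c i2 y)) with F in Q.
    change (h (param c y) (dparam c i2 y) (dparam c i2 y)) with G in Q.
    change (h (param c y) (dparam c i2 y) (dparam c i1 y)) with (comp h c i2 i1 y) in Q.
    rewrite S in Q. fold F in Q. nra.
Qed.

Lemma comp_change c i j y : punctured y -> comp h c i j y =
  sum2 (fun a => sum2 (fun b => comp h (other c) a b (at_T inversion y)
    * (J inversion a i y * J inversion b j y))).
Proof.
  intros Hy. unfold comp.
  rewrite (dparam_inversion c i y Hy), (dparam_inversion c j y Hy).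
  rewrite <- (param_inversion c y Hy).
  assert (I := inner_param (other c) (at_T inversion y)).
  assert (T := fun i => dparam_tangent (other c) i (at_T inversion y)).
  rewrite inner_left, !inner_right by auto using tangent_comb.
  unfold sum2. ring.
Qed.

Lemma scalar_curvature_chart c y :
  scalar_curvature h (param c y) = local_scal (comp h c) y.
Proof.
  apply (chart_independence (fun c => local_scal (comp h c))).
  clear c y. intros c y Hy.
  apply (scal_change punctured inversion (comp h (other c)) (comp h c)
    open_punctured Ck_inversion); auto using comp_regular, comp_change.
Qed.

Lemma laplacian_chart f c y : smooth_on_sphere f ->
  laplacian h f (param c y) = local_laplace (comp h c) (fun z => f (param c z)) y.
Proof.
  intros Hf.
  apply (chart_independence (fun c => local_laplace (comp h c) (fun z => f (param c z)))).
  clear c y. intros c y Hy.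
  apply (laplace_change punctured inversion (comp h (other c)) (comp h c)
    open_punctured Ck_inversion); auto using comp_regular, comp_change.
  - intros k. apply Hf.
  - intros z Hz. now rewrite param_inversion.
Qed.

Definition gradient_norm (f : space -> R) (x : space) : R :=
  let c := chart_at x in
  contract (comp h c)
    (fun i j z => pd i (fun z => f (param c z)) z * pd j (fun z => f (param c z)) z)
    (coord c x).

Lemma gradient_norm_chart f c y : smooth_on_sphere f ->
  gradient_norm f (param c y) =
  contract (comp h c)
    (fun i j z => pd i (fun z => f (param c z)) z * pd j (fun z => f (param c z)) z) y.
Proof.
  intros Hf.
  apply (chart_independence (fun c => contract (comp h c)
    (fun i j z => pd i (fun z => f (param c z)) z * pd j (fun z => f (param c z)) z))).
  clear c y. intros c y Hy.
  apply (gradient_norm_change punctured inversion (comp h (other c)) (comp h c)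
    open_punctured Ck_inversion); auto using comp_regular, comp_change.
  - intros k. apply Hf.
  - intros z Hz. now rewrite param_inversion.
Qed.

End Chart.

(** * The parabolic maximum principle on the sphere *)

Definition continuous_from (a : R) (f : R * plane -> R) (p : R * plane) : Prop :=
  filterlim f (within (fun q => a <= fst q) (locally p)) (locally (f p)).

Lemma continuous_continuous_from a (f : R * plane -> R) p :
  continuous f p -> continuous_from a f p.
Proof.
  intros H P HP. generalize (H P HP). unfold filtermap, within.
  apply filter_imp. auto.
Qed.

Definition in_box (a b : R) (p : R * plane) : Prop :=
  a <= fst p <= b /\ in_square (snd p).

(** Extreme value theorem, by compactness of the box: if no point were maximal,
    finitely many neighbourhoods on each of which f is below one of its values
    would cover the box, and the best of these values could not be covered. *)
Lemma box_maximum (a b : R) (f : R * plane -> R) :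
  a <= b -> (forall p, in_box a b p -> continuous_from a f p) ->
  exists p, in_box a b p /\ forall q, in_box a b q -> f q <= f p.
Proof.
  intros Hab Hf. apply NNPP. intros NM.
  assert (A : forall p, in_box a b p -> exists q, in_box a b q /\ f p < f q).
  { intros p Hp. apply NNPP. intros N. apply NM. exists p. split; auto.
    intros q Hq. apply Rnot_lt_le. intros L. apply N. eauto. }
  set (pt := fun t : Tn 3 R => ((fst t, (fst (snd t), fst (snd (snd t)))) : R * plane)).
  assert (B : forall t : Tn 3 R, exists dq : posreal * (R * plane),
    in_box a b (pt t) -> in_box a b (snd dq) /\
    forall t', in_box a b (pt t') -> close_n 3 (fst dq) t' t -> f (pt t') < f (snd dq)).
  { intros t. destruct (classic (in_box a b (pt t))) as [Hp|N].
    2: { exists (mkposreal 1 Rlt_0_1, pt t). tauto. }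
    destruct (A _ Hp) as [q [Hq L]].
    assert (L' : 0 < f q - f (pt t)) by lra.
    destruct (proj1 (filterlim_locally _ _) (Hf _ Hp) (mkposreal _ L')) as [d Hd].
    exists (d, q). intros _. split; auto. intros t' Ht' Hc.
    destruct t as [t1 [t2 [t3 ?]]], t' as [s1 [s2 [s3 ?]]]. simpl in Hc.
    assert (K := Hd (s1, (s2, s3))). unfold pt in *; simpl in *.
    assert (K' : Rabs (f (s1, (s2, s3)) - f (t1, (t2, t3))) < f q - f (t1, (t2, t3))).
    { apply K. split; [|split]; apply Hc. apply Ht'. }
    apply Rabs_def2 in K'. lra. }
  set (dq := fun t => proj1_sig (constructive_indefinite_description _ (B t))).
  assert (Hdq : forall t, in_box a b (pt t) -> in_box a b (snd (dq t)) /\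
    forall t', in_box a b (pt t') -> close_n 3 (fst (dq t)) t' t ->
      f (pt t') < f (snd (dq t))).
  { intros t. apply (proj2_sig (constructive_indefinite_description _ (B t))). }
  clearbody dq.
  assert (box_n : forall t : Tn 3 R, bounded_n 3 (a, (-1, (-1, tt))) (b, (1, (1, tt))) t
     <-> in_box a b (pt t)).
  { intros [t1 [t2 [t3 ?]]]. unfold in_box, in_square, pt. simpl. tauto. }
  apply (compactness_list 3 (a, (-1, (-1, tt))) (b, (1, (1, tt))) (fun t => fst (dq t))).
  intros [l Hl].
  assert (M : exists p, in_box a b p /\
     forall t, List.In t l -> in_box a b (pt t) -> f (snd (dq t)) <= f p).
  { clear Hl. induction l as [|t l [p [Hp IH]]].
    - exists (a, (0, 0)). split; [|simpl; tauto].
      unfold in_box, in_square; simpl. lra.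
    - destruct (classic (in_box a b (pt t) /\ f p < f (snd (dq t)))) as [[H1 H2]|N].
      + exists (snd (dq t)). split. now apply Hdq.
        intros s [<-|Hs] Bs. lra. specialize (IH s Hs Bs). lra.
      + exists p. split; auto. intros s [<-|Hs] Bs; auto.
        apply Rnot_lt_le. tauto. }
  destruct M as [[p1 [p2 p3]] [Hp M]].
  destruct (Hl (p1, (p2, (p3, tt)))) as [t [Ht [Bt C]]].
  { now apply box_n. }
  apply box_n in Bt. specialize (M t Ht Bt).
  assert (K := proj2 (Hdq t Bt) (p1, (p2, (p3, tt))) Hp C).
  change (f (p1, (p2, p3)) < f (snd (dq t))) in K.
  apply (Rlt_irrefl (f (p1, (p2, p3)))). apply (Rlt_le_trans _ _ _ K M).
Qed.

Lemma left_derivative (h : R -> R) (a t d : R) : a < t ->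
  is_derive h t d -> (forall s, a <= s <= t -> h s <= h t) -> 0 <= d.
Proof.
  intros Hat Hd Hmax. apply Rnot_lt_le. intros L.
  assert (H := proj1 (is_derive_Reals _ _ _) Hd (- d) ltac:(lra)).
  destruct H as [e H]. assert (He := cond_pos e).
  set (k := Rmin (e / 2) (t - a)).
  assert (Hk : 0 < k) by (apply Rmin_pos; lra).
  assert (Hk1 := Rmin_l (e / 2) (t - a)). assert (Hk2 := Rmin_r (e / 2) (t - a)).
  fold k in Hk1, Hk2.
  specialize (H (- k) ltac:(lra)).
  rewrite Rabs_Ropp, Rabs_right in H by lra. specialize (H ltac:(lra)).
  apply Rabs_def2 in H. destruct H as [H _].
  assert (K : (h (t + - k) - h t) / - k < 0) by lra.
  apply (Rmult_lt_compat_r k) in K; [|lra].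
  replace ((h (t + - k) - h t) / - k * k) with (h t - h (t + - k)) in K by (field; lra).
  specialize (Hmax (t + - k) ltac:(lra)). lra.
Qed.

Lemma is_derive_exp_weight (k sg : R) (phi : R -> R) (t l : R) : is_derive phi t l ->
  is_derive (fun s => exp (- k * s) * (sg * phi s)) t
    (exp (- k * t) * (sg * l - k * (sg * phi t))).
Proof.
  intros H. auto_derive. { eexists; exact H. }
  change (fun x : R => phi x) with phi.
  rewrite (is_derive_unique phi t l H). ring.
Qed.

Lemma space_time_maximum (a b : R) (g : R -> space -> R) : a <= b ->
  (forall c p, in_box a b p -> continuous_from a (in_chart g c) p) ->
  exists t0 x0, a <= t0 <= b /\ on_sphere x0 /\
    forall t x, a <= t <= b -> on_sphere x -> g t x <= g t0 x0.
Proof.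
  intros Hab Gc.
  destruct (box_maximum a b (in_chart g from_north) Hab (Gc _)) as [p1 [[B1 _] M1]].
  destruct (box_maximum a b (in_chart g from_south) Hab (Gc _)) as [p2 [[B2 _] M2]].
  assert (W : forall s z, a <= s <= b -> on_sphere z ->
    g s z <= in_chart g from_north p1 \/ g s z <= in_chart g from_south p2).
  { intros s z Hs Hz. assert (Q := coord_square z Hz). assert (E := param_coord z Hz).
    rewrite <- E. revert Q. destruct (chart_at z); intros Q; [left|right].
    now apply (M1 (s, coord from_north z)).
    now apply (M2 (s, coord from_south z)). }
  destruct (Rle_lt_dec (in_chart g from_south p2) (in_chart g from_north p1)) as [L|L].
  - exists (fst p1), (param from_north (snd p1)).
    split; [|split]; auto using param_on_sphere. intros s z Hs Hz.
    destruct (W s z Hs Hz); unfold in_chart in *; lra.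
  - exists (fst p2), (param from_south (snd p2)).
    split; [|split]; auto using param_on_sphere. intros s z Hs Hz.
    destruct (W s z Hs Hz); unfold in_chart in *; lra.
Qed.

Lemma sphere_maximum (f : space -> R) :
  (forall c y, continuous (fun y : plane => f (param c y)) y) ->
  exists x0, on_sphere x0 /\ forall x, on_sphere x -> f x <= f x0.
Proof.
  intros H. destruct (space_time_maximum 0 0 (fun _ => f)) as [t0 [x0 [_ [Hx M]]]].
  - lra.
  - intros c p _. apply continuous_continuous_from.
    apply (continuous_comp (snd : R * plane -> plane) (fun y => f (param c y)) p).
    destruct p; apply continuous_snd.
    apply H.
  - exists x0. split; auto. intros x. apply (M 0). lra.
Qed.

(** Only the points where |f(t, .)| is maximal matter, which is what makes the
    terms in the gradient of f harmless and gives the Laplacian a sign. *)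
Lemma parabolic_uniqueness (a b C : R) (f : R -> space -> R) :
  (forall c p, a <= fst p <= b -> continuous_from a (in_chart f c) p) ->
  (forall x, on_sphere x -> f a x = 0) ->
  (forall t x sg, (sg = 1 \/ sg = -1) -> a < t <= b -> on_sphere x -> 0 < sg * f t x ->
    (forall z, on_sphere z -> Rabs (f t z) <= sg * f t x) ->
    exists l : R, is_derive (fun s => f s x) t l /\ sg * l <= C * (sg * f t x)) ->
  forall t x, a <= t <= b -> on_sphere x -> f t x = 0.
Proof.
  intros Hc H0 Hd t x Ht Hx.
  set (g := fun t x => exp (- (C + 1) * t) * Rabs (f t x)).
  assert (Gc : forall c p, in_box a b p -> continuous_from a (in_chart g c) p).
  { intros c p [Hp _]. unfold continuous_from, in_chart, g.
    apply (filterlim_comp_2 (G := locally (exp (- (C + 1) * fst p)))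
      (H := locally (Rabs (f (fst p) (param c (snd p)))))
      (fun q : R * plane => exp (- (C + 1) * fst q))
      (fun q : R * plane => Rabs (f (fst q) (param c (snd q)))) Rmult).
    - apply (continuous_continuous_from a (fun q : R * plane => exp (- (C + 1) * fst q))).
      apply (continuous_comp (fst : R * plane -> R) (fun t => exp (- (C + 1) * t))).
      destruct p; apply continuous_fst.
      apply (@ex_derive_continuous R_AbsRing R_NormedModule). now auto_derive.
    - apply (filterlim_comp _ _ _ (fun q : R * plane => f (fst q) (param c (snd q))) Rabs
        _ (locally (f (fst p) (param c (snd p))))).
      apply (Hc c p Hp). apply continuous_Rabs.
    - apply (@filterlim_mult R_AbsRing). }
  assert (Hab : a <= b) by lra.
  destruct (space_time_maximum a b g Hab Gc) as [t0 [x0 [B0 [Hx0 M]]]].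
  assert (E : forall s, 0 < exp s) by apply exp_pos.
  destruct (Req_dec (f t0 x0) 0) as [Z|Z].
  { specialize (M t x Ht Hx). unfold g in M at 2. rewrite Z, Rabs_R0, Rmult_0_r in M.
    unfold g in M. assert (E1 := E (- (C + 1) * t)). assert (A := Rabs_pos (f t x)).
    destruct (Req_dec (f t x) 0); auto. apply Rabs_pos_lt in H. nra. }
  assert (Ha : a < t0).
  { destruct (Req_dec a t0) as [<-|]; [|lra]. exfalso. auto. }
  assert (S : exists sg, (sg = 1 \/ sg = -1) /\ 0 < sg * f t0 x0 /\
     sg * f t0 x0 = Rabs (f t0 x0) /\ forall r, sg * r <= Rabs r).
  { destruct (Rle_lt_dec 0 (f t0 x0)).
    - exists 1. rewrite Rabs_right by lra. repeat split; auto; try lra.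
      intros r0. generalize (Rle_abs r0). lra.
    - exists (-1). rewrite Rabs_left by lra. repeat split; auto; try lra.
      intros r0. generalize (Rle_abs (- r0)). rewrite Rabs_Ropp. lra. }
  destruct S as [sg [S1 [S2 [S3 S4]]]].
  destruct (Hd t0 x0 sg S1 ltac:(lra) Hx0 S2) as [l [Hl L]].
  { intros z Hz. rewrite S3. specialize (M t0 z B0 Hz). unfold g in M.
    apply Rmult_le_reg_l in M; auto. }
  exfalso.
  assert (K : 0 <= exp (- (C + 1) * t0) * (sg * l - (C + 1) * (sg * f t0 x0))).
  { apply (left_derivative (fun s => exp (- (C + 1) * s) * (sg * f s x0)) a t0); auto.
    - apply (is_derive_exp_weight (C + 1) sg (fun s => f s x0)). exact Hl.
    - intros s Hs. rewrite S3. specialize (M s x0 ltac:(lra) Hx0). unfold g in M.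
      assert (S5 := S4 (f s x0)). assert (E1 := E (- (C + 1) * s)). nra. }
  assert (E1 := E (- (C + 1) * t0)). nra.
Qed.

(** * The Laplacian at extrema *)

Lemma inv_positive G y : regular G ->
  0 < inv G i1 i1 y /\ 0 < inv G i1 i1 y * inv G i2 i2 y - inv G i1 i2 y ^ 2.
Proof.
  intros RG. assert (P := regular_det G RG y). assert (P1 := regular_pos G RG y).
  assert (P2 : 0 < G i2 i2 y).
  { unfold det in P. rewrite (regular_sym G RG) in P. nra. }
  split. { unfold inv. now apply Rdiv_lt_0_compat. }
  replace (inv G i1 i1 y * inv G i2 i2 y - inv G i1 i2 y ^ 2) with (/ det G y).
  now apply Rinv_0_lt_compat.
  assert (N := det_neq G RG y).
  unfold inv, det in *. rewrite (regular_sym G RG) in *. field. auto.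
Qed.

Lemma laplace_at_max G f y : regular G -> C1_on everywhere f ->
  (forall i, C1_on everywhere (pd i f)) -> (forall z, f z <= f y) ->
  (forall i, pd i f y = 0) /\ local_laplace G f y <= 0.
Proof.
  intros RG F1 F2 M. destruct (max_hessian f y 0 0 F1 F2 M) as [Z _]. split; auto.
  destruct (inv_positive G y RG) as [P1 P2].
  generalize (max_contraction f y _ _ _ F1 F2 M P1 P2).
  unfold local_laplace, local_hess, sum2. rewrite !Z.
  replace (inv G i2 i1 y) with (inv G i1 i2 y).
  lra. unfold inv. now rewrite (regular_sym G RG).
Qed.

Lemma pd_opp i f : pd i (fun z => - f z) = fun z => - pd i f z.
Proof. apply functional_extensionality. intros y. apply Derive_opp. Qed.

Lemma laplace_opp G f y : local_laplace G (fun z => - f z) y = - local_laplace G f y.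
Proof.
  unfold local_laplace, local_hess, sum2. rewrite !pd_opp. ring.
Qed.

Lemma C1_on_opp D f : C1_on D f -> C1_on D (fun z => - f z).
Proof.
  intros H y Hy i. destruct (H y Hy i) as [H1 H2]. split.
  - eapply is_dir_ex, is_dir_opp, ex_dir_is, H1.
  - rewrite pd_opp. now apply (@continuous_opp _ R_AbsRing R_NormedModule).
Qed.

Lemma laplace_at_min G f y : regular G -> C1_on everywhere f ->
  (forall i, C1_on everywhere (pd i f)) -> (forall z, f y <= f z) ->
  (forall i, pd i f y = 0) /\ 0 <= local_laplace G f y.
Proof.
  intros RG F1 F2 M.
  destruct (laplace_at_max G (fun z => - f z) y RG) as [Z L].
  - now apply C1_on_opp.
  - intros i. rewrite pd_opp. now apply C1_on_opp.
  - intros z. specialize (M z). lra.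
  - rewrite laplace_opp in L. split; [|lra].
    intros i. specialize (Z i). rewrite pd_opp in Z. lra.
Qed.

Lemma pd_const_minus r f i : smooth f -> pd i (fun z => r - f z) = fun z => - pd i f z.
Proof.
  intros F. apply functional_extensionality. intros y. apply pd_unique.
  replace (- pd i f y) with (0 - pd i f y) by ring.
  apply is_dir_minus. apply is_dir_const. now apply smooth_is.
Qed.

Lemma laplace_const_minus G r f y : smooth f ->
  local_laplace G (fun z => r - f z) y = - local_laplace G f y.
Proof.
  intros F. unfold local_laplace, local_hess, sum2.
  rewrite !pd_const_minus by auto. rewrite !pd_opp. ring.
Qed.

(** * Harmonic functions on a positively curved sphere *)

(** In dimension two the lowered curvature tensor has a single component R_1212,
    equal to half the scalar curvature times the determinant of the metric. *)
Lemma riem_scal G m k y : regular G ->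
  riem G m k y = local_scal G y / 2 *
    match m with i1 => G i2 k y | i2 => - G i1 k y end.
Proof.
  intros RG. assert (N := det_neq G RG y). assert (S := regular_smooth G RG).
  assert (N2 := det_square G y RG).
  rewrite (local_scal_brioschi G y RG).
  unfold riem, sum2.
  rewrite !(pd_Gamma G RG). unfold Gamma, low, sum2.
  rewrite (regular_sym G RG).
  rewrite ?(pd_comm _ i2 i1); auto.
  unfold brioschi_at, brioschi, brioschi_num. unfold inv, det in *.
  rewrite (regular_sym G RG) in *.
  destruct m, k; rewrite ?(pd_comm _ i2 i1); rewrite ?(regular_sym G RG); auto;
  (field; simpl in *; lra).
Qed.

Section Bochner.
Context (G : local_metric) (RG : regular G) (f : plane -> R) (Sf : smooth f).

Let H := local_hess G f.
Let q := contract G (fun i j z => pd i f z * pd j f z).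

Lemma smooth_hess i k : smooth (local_hess G f i k).
Proof.
  unfold local_hess, sum2. apply smooth_minus; auto with smooth.
  apply smooth_plus; apply smooth_mult; auto using smooth_Gamma with smooth.
Qed.

Lemma hess_sym i k z : local_hess G f i k z = local_hess G f k i z.
Proof.
  unfold local_hess. rewrite pd_comm by auto. f_equal. unfold sum2.
  now rewrite !(Gamma_sym G _ i k).
Qed.

Lemma smooth_gradient_norm : smooth q.
Proof.
  unfold q, contract, sum2.
  apply smooth_plus; apply smooth_plus; (apply smooth_mult;
    [now apply smooth_inv | apply smooth_mult; auto with smooth]).
Qed.

(** Compatibility of the Levi-Civita connection with the metric. *)
Lemma pd_gradient_norm k z : pd k q z =
  2 * sum2 (fun i => sum2 (fun j => inv G i j z * H i k z * pd j f z)).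
Proof.
  apply pd_unique. unfold q, contract.
  assert (K : forall i j, is_dir (fun z => inv G i j z * (pd i f z * pd j f z)) (basis k) z
    (- sum2 (fun a => sum2 (fun b => inv G i a z * pd k (G a b) z * inv G b j z))
      * (pd i f z * pd j f z)
     + inv G i j z * (pd k (pd i f) z * pd j f z + pd i f z * pd k (pd j f) z))).
  { intros i j. apply (is_dir_mult (inv G i j)).
    apply (is_dir_inv_metric G RG k i j).
    apply (is_dir_mult (pd i f)); apply smooth_is; auto with smooth. }
  evar_last.
  { unfold sum2 at 1 2. apply is_dir_plus; apply is_dir_plus; apply K. }
  unfold H, local_hess, Gamma, sum2.
  assert (N := det_neq G RG z). unfold inv, det in *.
  destruct k; rewrite ?(regular_sym G RG) in *;
    rewrite ?(pd_comm f i2 i1) by auto; field; auto.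
Qed.

Lemma pd_hess l i k z : pd l (H i k) z =
  pd l (pd i (pd k f)) z
  - sum2 (fun m => pd l (Gamma G m i k) z * pd m f z + Gamma G m i k z * pd l (pd m f) z).
Proof.
  apply pd_unique. unfold H, local_hess.
  apply (is_dir_minus (pd i (pd k f))). apply smooth_is; auto with smooth.
  unfold sum2. apply is_dir_plus;
    (apply (is_dir_mult (Gamma G _ i k)); apply smooth_is; auto using smooth_Gamma with smooth).
Qed.

Context (y : plane) (Hy : forall i j, H i j y = 0).

Lemma pd2_gradient_norm l k : pd l (pd k q) y =
  2 * sum2 (fun i => sum2 (fun j => inv G i j y * pd l (H i k) y * pd j f y)).
Proof.
  apply pd_unique.
  apply (is_dir_ext everywhere (fun z => 2 * sum2 (fun i => sum2 (fun j =>
     inv G i j z * H i k z * pd j f z)))). apply open_plane. exact I.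
  { intros z _. symmetry. apply pd_gradient_norm. }
  assert (K : forall i j, is_dir (fun z => inv G i j z * H i k z * pd j f z) (basis l) y
    (inv G i j y * pd l (H i k) y * pd j f y)).
  { intros i j. evar_last.
    apply (is_dir_mult (fun z => inv G i j z * H i k z)).
    apply (is_dir_mult (inv G i j)).
    apply smooth_is; now apply smooth_inv. apply smooth_is, smooth_hess.
    apply smooth_is; auto with smooth.
    rewrite Hy. unfold pd. ring. }
  evar_last. { apply (is_dir_mult (fun _ => 2)). apply is_dir_const.
  unfold sum2. apply is_dir_plus; apply is_dir_plus; apply K. }
  unfold sum2. ring.
Qed.

Lemma pd_laplace m : pd m (local_laplace G f) y =
  sum2 (fun i => sum2 (fun j => inv G i j y * pd m (H i j) y)).
Proof.
  apply pd_unique. unfold local_laplace.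
  assert (K : forall i j, is_dir (fun z => inv G i j z * H i j z) (basis m) y
    (inv G i j y * pd m (H i j) y)).
  { intros i j. evar_last.
    apply (is_dir_mult (inv G i j)).
    apply smooth_is; now apply smooth_inv. apply smooth_is, smooth_hess.
    rewrite Hy. unfold pd. ring. }
  unfold sum2. apply is_dir_plus; apply is_dir_plus; apply K.
Qed.

(** The Ricci identity for df. Where the Hessian vanishes its covariant derivatives
    are its partial derivatives. *)
Lemma hess_commute k :
  pd i2 (H i1 k) y - pd i1 (H i2 k) y = sum2 (fun m => pd m f y * riem G m k y).
Proof.
  rewrite !pd_hess.
  assert (E : forall i j, pd i (pd j f) y = sum2 (fun n => Gamma G n i j y * pd n f y)).
  { intros i j. generalize (Hy i j). unfold H, local_hess. lra. }
  rewrite (pd_comm (pd k f) i2 i1) by auto with smooth.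
  unfold sum2. rewrite !E. unfold riem, sum2.
  rewrite !(Gamma_sym G _ i2 k), !(Gamma_sym G _ i1 k) by auto.
  rewrite !(Gamma_sym G _ i2 i1) by auto.
  destruct k; rewrite ?(Gamma_sym G _ i2 i1) by auto; ring.
Qed.

(** Bochner's formula at a point where the Hessian and the derivative of the
    Laplacian vanish: only the curvature term survives. *)
Lemma bochner : (forall m, pd m (local_laplace G f) y = 0) ->
  contract G (fun l k z => pd l (pd k q) z) y = local_scal G y * q y.
Proof.
  intros L.
  transitivity (2 * (
    (inv G i1 i1 y * pd i1 f y + inv G i1 i2 y * pd i2 f y)
      * sum2 (fun k => inv G i2 k y * (pd i2 (H i1 k) y - pd i1 (H i2 k) y))
    - (inv G i2 i1 y * pd i1 f y + inv G i2 i2 y * pd i2 f y)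
      * sum2 (fun k => inv G i1 k y * (pd i2 (H i1 k) y - pd i1 (H i2 k) y))
    + ((inv G i1 i1 y * pd i1 f y + inv G i1 i2 y * pd i2 f y) * pd i1 (local_laplace G f) y
     + (inv G i2 i1 y * pd i1 f y + inv G i2 i2 y * pd i2 f y) * pd i2 (local_laplace G f) y))).
  - unfold contract, sum2. rewrite !pd2_gradient_norm, !pd_laplace. unfold sum2.
    assert (S : forall l, pd l (H i2 i1) y = pd l (H i1 i2) y).
    { intros l. f_equal. apply functional_extensionality. intros z. apply hess_sym. }
    rewrite !S. ring.
  - rewrite !L. unfold sum2. rewrite !hess_commute. unfold sum2.
    rewrite !(riem_scal G) by auto. unfold q, contract, sum2.
    assert (N := det_neq G RG y). unfold inv, det in *.
    rewrite !(regular_sym G RG) in *. field. auto.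
Qed.
End Bochner.

(** A symmetric form killing v is a multiple m of the square of the rotated v; its
    trace against a positive form vanishes only if m does. *)
Lemma traceless_degenerate (A B C h11 h12 h22 v1 v2 : R) :
  0 < A -> 0 < A * C - B ^ 2 -> A * h11 + 2 * B * h12 + C * h22 = 0 ->
  h11 * v1 + h12 * v2 = 0 -> h12 * v1 + h22 * v2 = 0 -> v1 <> 0 \/ v2 <> 0 ->
  h11 = 0 /\ h12 = 0 /\ h22 = 0.
Proof.
  intros HA HD HT H1 H2 HV.
  assert (P : 0 < v1 ^ 2 + v2 ^ 2).
  { destruct HV as [V|V]; apply (pow2_gt_0) in V; nra. }
  set (m := h11 + h22).
  assert (E11 : (v1 ^ 2 + v2 ^ 2) * h11 = m * v2 ^ 2).
  { apply Rminus_diag_uniq.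
    transitivity (v1 * (h11 * v1 + h12 * v2) - v2 * (h12 * v1 + h22 * v2)).
    unfold m; ring. rewrite H1, H2; ring. }
  assert (E22 : (v1 ^ 2 + v2 ^ 2) * h22 = m * v1 ^ 2).
  { apply Rminus_diag_uniq.
    transitivity (v2 * (h12 * v1 + h22 * v2) - v1 * (h11 * v1 + h12 * v2)).
    unfold m; ring. rewrite H1, H2; ring. }
  assert (E12 : (v1 ^ 2 + v2 ^ 2) * h12 = - m * v1 * v2).
  { apply Rminus_diag_uniq.
    transitivity (v1 * (h12 * v1 + h22 * v2) + v2 * (h11 * v1 + h12 * v2)).
    unfold m; ring. rewrite H1, H2; ring. }
  assert (Q : 0 < A * v2 ^ 2 - 2 * B * v1 * v2 + C * v1 ^ 2).
  { apply (Rmult_lt_reg_l A); auto.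
    replace (A * (A * v2 ^ 2 - 2 * B * v1 * v2 + C * v1 ^ 2))
      with ((A * v2 - B * v1) ^ 2 + (A * C - B ^ 2) * v1 ^ 2) by ring.
    rewrite Rmult_0_r.
    destruct (Req_dec v1 0) as [->|V].
    - assert (V : v2 <> 0) by (destruct HV as [V|V]; [now destruct V|exact V]).
      apply pow2_gt_0 in V.
      replace (_ + _) with ((A * A) * v2 ^ 2) by ring.
      apply Rmult_lt_0_compat; nra.
    - apply pow2_gt_0 in V. assert (W := pow2_ge_0 (A * v2 - B * v1)).
      assert (U := Rmult_lt_0_compat _ _ HD V). lra. }
  assert (M : m = 0).
  { apply (Rmult_eq_reg_r (A * v2 ^ 2 - 2 * B * v1 * v2 + C * v1 ^ 2)); [|lra].
    transitivity ((v1 ^ 2 + v2 ^ 2) * (A * h11 + 2 * B * h12 + C * h22)).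
    - rewrite !Rmult_plus_distr_l.
      replace ((v1 ^ 2 + v2 ^ 2) * (A * h11)) with (A * ((v1 ^ 2 + v2 ^ 2) * h11)) by ring.
      replace ((v1 ^ 2 + v2 ^ 2) * (2 * B * h12)) with (2 * B * ((v1 ^ 2 + v2 ^ 2) * h12)) by ring.
      replace ((v1 ^ 2 + v2 ^ 2) * (C * h22)) with (C * ((v1 ^ 2 + v2 ^ 2) * h22)) by ring.
      rewrite E11, E22, E12. ring.
    - rewrite HT. ring. }
  rewrite M in *.
  repeat split; apply (Rmult_eq_reg_l (v1 ^ 2 + v2 ^ 2)); try lra.
Qed.

(** If |df|^2 had a positive maximum, the vanishing of its derivative would make
    the gradient a kernel vector of the traceless Hessian, which then is zero, and
    by Bochner's formula |df|^2 would be strictly subharmonic there. *)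
Lemma harmonic_gradient_max G f y : regular G -> smooth f ->
  0 < local_scal G y -> (forall z, local_laplace G f z = 0) ->
  (forall z, contract G (fun i j z => pd i f z * pd j f z) z
     <= contract G (fun i j z => pd i f z * pd j f z) y) ->
  contract G (fun i j z => pd i f z * pd j f z) y <= 0.
Proof.
  intros RG Sf HR HL HM. apply Rnot_lt_le. intros Pq.
  set (q := contract G (fun i j z => pd i f z * pd j f z)) in *.
  assert (Sq : smooth q) by now apply smooth_gradient_norm.
  destruct (inv_positive G y RG) as [P1 P2].
  assert (Is : inv G i2 i1 y = inv G i1 i2 y).
  { unfold inv. now rewrite (regular_sym G RG). }
  assert (Z : forall k, pd k q y = 0).
  { intros k. apply (max_hessian q y 0 0); auto.
    now apply smooth_C1_on. intros; apply smooth_C1_on; auto with smooth. }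
  assert (Hy : local_hess G f i1 i1 y = 0 /\ local_hess G f i1 i2 y = 0
     /\ local_hess G f i2 i2 y = 0).
  { apply (traceless_degenerate (inv G i1 i1 y) (inv G i1 i2 y) (inv G i2 i2 y)
     _ _ _ (inv G i1 i1 y * pd i1 f y + inv G i1 i2 y * pd i2 f y)
     (inv G i2 i1 y * pd i1 f y + inv G i2 i2 y * pd i2 f y)); auto.
    - generalize (HL y). unfold local_laplace, sum2. rewrite Is.
      rewrite (hess_sym G RG f Sf i2 i1). lra.
    - generalize (Z i1). unfold q. rewrite (pd_gradient_norm G RG f Sf).
      unfold sum2. rewrite (hess_sym G RG f Sf i2 i1). lra.
    - generalize (Z i2). unfold q. rewrite (pd_gradient_norm G RG f Sf).
      unfold sum2. lra.
    - apply NNPP. intros N. apply not_or_and in N. destruct N as [N1 N2].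
      apply NNPP in N1. apply NNPP in N2.
      revert Pq. unfold q, contract, sum2.
      replace (_ + _) with (pd i1 f y * (inv G i1 i1 y * pd i1 f y + inv G i1 i2 y * pd i2 f y)
        + pd i2 f y * (inv G i2 i1 y * pd i1 f y + inv G i2 i2 y * pd i2 f y)) by ring.
      rewrite N1, N2. lra. }
  destruct Hy as [H11 [H12 H22]].
  assert (Hy : forall i j, local_hess G f i j y = 0).
  { intros [|] [|]; auto. now rewrite (hess_sym G RG f Sf). }
  assert (B := bochner G RG f Sf y Hy).
  assert (C := max_contraction q y _ _ _ (smooth_C1_on q Sq)
    (fun i => smooth_C1_on _ (smooth_pd i q Sq)) HM P1 P2).
  assert (D : contract G (fun l k z => pd l (pd k q) z) y <= 0).
  { unfold contract, sum2. rewrite Is. lra. }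
  unfold q in D. rewrite B in D.
  - fold q in D. nra.
  - intros m. replace (local_laplace G f) with (fun _ : plane => 0).
    + apply pd_unique, is_dir_const.
    + apply functional_extensionality. intros z. now rewrite HL.
Qed.

Lemma gradient_norm_zero G f y : regular G ->
  contract G (fun i j z => pd i f z * pd j f z) y <= 0 -> forall i, pd i f y = 0.
Proof.
  intros RG. destruct (inv_positive G y RG) as [P1 P2].
  assert (Is : inv G i2 i1 y = inv G i1 i2 y).
  { unfold inv. now rewrite (regular_sym G RG). }
  unfold contract, sum2. rewrite Is.
  set (A := inv G i1 i1 y) in *. set (B := inv G i1 i2 y) in *.
  set (C := inv G i2 i2 y) in *. set (a := pd i1 f y). set (b := pd i2 f y).
  intros H.
  assert (K : (A * a + B * b) ^ 2 + (A * C - B ^ 2) * b ^ 2 <= 0).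
  { replace ((A * a + B * b) ^ 2 + (A * C - B ^ 2) * b ^ 2) with
     (A * (A * (a * a) + B * (a * b) + (B * (b * a) + C * (b * b)))) by ring.
    assert (U := Rmult_le_compat_l A _ _ (Rlt_le _ _ P1) H). lra. }
  assert (Hb : b = 0).
  { destruct (Req_dec b 0) as [|N]; auto. apply pow2_gt_0 in N.
    assert (W := pow2_ge_0 (A * a + B * b)).
    assert (U := Rmult_lt_0_compat _ _ P2 N). lra. }
  intros [|]; auto. fold a. rewrite Hb in K.
  destruct (Req_dec a 0) as [|N]; auto. apply pow2_gt_0 in N. exfalso.
  replace (_ + _) with ((A * A) * a ^ 2) in K by ring.
  assert (U := Rmult_lt_0_compat (A * A) _ ltac:(nra) N). lra.
Qed.

(** * Rigidity of the flow starting from the round metric *)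

Lemma smooth_continuous (f : plane -> R) (y : plane) : smooth f -> continuous f y.
Proof. intros H. exact (Ck_continuous 0 everywhere f y (H 0%nat) I). Qed.

Lemma comp_tangent (h h' : metric) c :
  (forall x v w, on_sphere x -> tangent x v -> tangent x w -> h x v w = h' x v w) ->
  comp h c = comp h' c.
Proof.
  intros H. do 3 (apply functional_extensionality; intros ?). unfold comp.
  apply H; auto using param_on_sphere, dparam_tangent.
Qed.

Definition conformal_factor (y : plane) : R := 4 / (1 + fst y ^ 2 + snd y ^ 2) ^ 2.

Lemma comp_round c i j y :
  comp round c i j y =
  match i, j with i1, i1 | i2, i2 => conformal_factor y | _, _ => 0 end.
Proof. destruct y as [a b]. apply (dparam_dot c i j a b). Qed.

Lemma pd_conformal_factor i y : pd i conformal_factor y =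
  - 16 * match i with i1 => fst y | i2 => snd y end / (1 + fst y ^ 2 + snd y ^ 2) ^ 3.
Proof.
  destruct y as [a b]. assert (P := chart_denominator a b).
  apply pd_unique. unfold conformal_factor. simpl fst; simpl snd.
  destruct i; explicit_dir; (auto_derive; simpl in P |- *;
    rewrite ?Rmult_0_l, ?Rplus_0_r, ?Rmult_0_r, ?Rplus_0_r;
    [try (apply Rmult_integral_contrapositive_currified; lra)
    | field; lra]).
  all: rewrite ?Rmult_1_r; apply Rmult_integral_contrapositive_currified; lra.
Qed.

Lemma pd2_conformal_factor i y : pd i (pd i conformal_factor) y =
  - 16 / (1 + fst y ^ 2 + snd y ^ 2) ^ 3
  + 96 * match i with i1 => fst y ^ 2 | i2 => snd y ^ 2 end
    / (1 + fst y ^ 2 + snd y ^ 2) ^ 4.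
Proof.
  replace (pd i conformal_factor) with (fun y : plane =>
     - 16 * match i with i1 => fst y | i2 => snd y end / (1 + fst y ^ 2 + snd y ^ 2) ^ 3).
  2: { apply functional_extensionality. intros z. symmetry. apply pd_conformal_factor. }
  destruct y as [a b]. assert (P := chart_denominator a b).
  apply pd_unique. simpl fst; simpl snd.
  destruct i; explicit_dir; (auto_derive; simpl in P |- *;
    rewrite ?Rmult_0_l, ?Rplus_0_r, ?Rmult_0_r, ?Rplus_0_r;
    [ rewrite ?Rmult_1_r; repeat apply Rmult_integral_contrapositive_currified; lra
    | field; lra]).
Qed.

Lemma local_scal_round c y : regular (comp round c) -> local_scal (comp round c) y = 2.
Proof.
  intros RG. rewrite (local_scal_brioschi _ y RG). unfold brioschi_at.
  assert (E : forall i j, comp round c i j =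
    match i, j with i1, i1 | i2, i2 => conformal_factor | _, _ => fun _ => 0 end).
  { intros i j. apply functional_extensionality. intros z. rewrite comp_round.
    destruct i, j; reflexivity. }
  rewrite !E.
  assert (Z : forall i z, pd i (fun _ : plane => 0) z = 0).
  { intros i z. apply pd_unique, is_dir_const. }
  assert (Z' : forall i, pd i (fun _ : plane => 0) = fun _ => 0).
  { intros i. apply functional_extensionality. apply Z. }
  rewrite !Z'. rewrite !pd2_conformal_factor, !pd_conformal_factor.
  unfold conformal_factor, brioschi, brioschi_num. destruct y as [a b]. simpl fst; simpl snd.
  assert (P := chart_denominator a b). field. lra.
Qed.

(** Only the curvature is followed in time: of the potential, whose dependence on t
    need not be regular, only the Poisson equation at each fixed time is used. *)
Section Flow.
Context (g : R -> metric) (F : R -> space -> R) (HF : modified_ricci_flow round g F).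

Let G (c : chart) (t : R) : local_metric := comp (g t) c.
Let r (t : R) : R := mean_scalar_curvature (g t).
Let Rs (t : R) (x : space) : R := scalar_curvature (g t) x.

Lemma flow_regular c t : 1 <= t -> regular (G c t).
Proof. intros Ht. apply comp_regular. now apply (flow_riemannian _ _ _ HF). Qed.

Lemma flow_extension c : exists E : idx -> idx -> R * plane -> R,
  (forall i j k, Ck k everywhere (E i j)) /\
  (forall t, 1 <= t -> (fun i j => slice (E i j) t) = G c t).
Proof.
  assert (S := flow_smooth _ _ _ HF c).
  destruct (S i1 i1) as [E11 [H11 K11]]. destruct (S i1 i2) as [E12 [H12 K12]].
  destruct (S i2 i1) as [E21 [H21 K21]]. destruct (S i2 i2) as [E22 [H22 K22]].
  exists (fun i j => match i, j with
    | i1, i1 => E11 | i1, i2 => E12 | i2, i1 => E21 | i2, i2 => E22 end).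
  split.
  - intros [|] [|]; auto.
  - intros t Ht. do 3 (apply functional_extensionality; intros ?).
    unfold slice, G. destruct x, x0; auto.
Qed.

Lemma smooth_potential t c : 1 <= t -> smooth (fun y => F t (param c y)).
Proof. intros Ht k. now apply (potential_smooth _ _ _ HF). Qed.

Lemma flow_velocity c i j t y E : 1 < t -> (forall i j k, Ck k everywhere (E i j)) ->
  (forall t, 1 <= t -> (fun i j => slice (E i j) t) = G c t) ->
  dt (E i j) (t, y) = 2 * Mten (g t) (F t) c i j y.
Proof.
  intros Ht HE HG.
  assert (H := flow_equation _ _ _ HF t c i j y Ht).
  assert (K := is_derive_slice (E i j) t y (HE i j)).
  apply is_derive_unique in K. rewrite <- (is_derive_unique _ _ _ H).
  change (slice (dt (E i j)) t y = Derive (fun s => comp (g s) c i j y) t).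
  rewrite <- K. apply Derive_ext_loc.
  assert (Ht' : 0 < t - 1) by lra.
  exists (mkposreal _ Ht'). intros s Hs. simpl in Hs.
  assert (1 <= s).
  { apply Rabs_def2 in Hs. unfold minus, plus, opp in Hs; simpl in Hs. lra. }
  change (slice (E i j) s y) with ((fun i j => slice (E i j) s) i j y).
  now rewrite HG.
Qed.

(** The velocity is 2M = L_{grad F} g + (r - R) g, which involves the potential at
    the present time alone; it gives d_t R = <dR, dF> + Lap R + R (R - r). *)
Lemma flow_scal_evolution c t y : 1 < t ->
  is_derive (fun s => Rs s (param c y)) t
    (grad (G c t) (fun y => F t (param c y)) i1 y * pd i1 (local_scal (G c t)) y
     + grad (G c t) (fun y => F t (param c y)) i2 y * pd i2 (local_scal (G c t)) y
     + local_laplace (G c t) (local_scal (G c t)) y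
     - (r t - local_scal (G c t) y) * local_scal (G c t) y).
Proof.
  intros Ht. destruct (flow_extension c) as [E [HE HG]].
  assert (RG : regular (G c t)) by (apply flow_regular; lra).
  assert (Sp := smooth_potential t c ltac:(lra)).
  assert (near : locally t (fun s => 1 <= s)).
  { assert (Ht' : 0 < t - 1) by lra.
    exists (mkposreal _ Ht'). intros s Hs. simpl in Hs.
    apply Rabs_def2 in Hs. unfold minus, plus, opp in Hs; simpl in Hs. lra. }
  apply (is_derive_ext_loc (fun s => local_scal (fun i j => slice (E i j) s) y)).
  { revert near. apply filter_imp. intros s Hs. rewrite HG by auto. symmetry.
    apply scalar_curvature_chart. now apply (flow_riemannian _ _ _ HF). }
  evar_last.
  - apply (scal_evolution E t y (grad (G c t) (fun y => F t (param c y)) i1)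
      (grad (G c t) (fun y => F t (param c y)) i2)
      (fun z => r t - local_scal (G c t) z)); auto using smooth_grad.
    + revert near. apply filter_imp. intros s Hs. rewrite HG by auto.
      now apply flow_regular.
    + apply smooth_minus; auto using smooth_scal with smooth.
    + intros i j z. 
      etransitivity; [exact (flow_velocity c i j t z E Ht HE HG)|].
      rewrite HG by lra. rewrite lie_grad by auto.
      change (slice (E i j) t z) with ((fun i j => slice (E i j) t) i j z).
      rewrite HG by lra. unfold Mten, r.
      rewrite scalar_curvature_chart by (apply (flow_riemannian _ _ _ HF); lra).
      unfold G. field.
  - rewrite HG by lra. rewrite laplace_const_minus by now apply smooth_scal. ring.
Qed.

Lemma potential_continuous t c y : 1 <= t ->
  continuous (fun y : plane => F t (param c y)) y.
Proof. intros Ht. now apply smooth_continuous, smooth_potential. Qed.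

(** The Poisson equation at the extrema of the potential places the mean value r
    of the scalar curvature between the extreme values of R. *)
Lemma mean_bounds t : 1 <= t ->
  (exists x, on_sphere x /\ Rs t x <= r t) /\ (exists x, on_sphere x /\ r t <= Rs t x).
Proof.
  intros Ht.
  assert (K : forall x, on_sphere x -> local_laplace (G (chart_at x) t)
     (fun y => F t (param (chart_at x) y)) (coord (chart_at x) x) = Rs t x - r t).
  { intros x Hx. exact (potential_poisson _ _ _ HF t x Ht Hx). }
  split.
  - destruct (sphere_maximum (F t)) as [x [Hx M]].
    { intros; now apply potential_continuous. }
    exists x. split; auto. specialize (K x Hx).
    assert (S := smooth_potential t (chart_at x) Ht).
    destruct (laplace_at_max (G (chart_at x) t) (fun y => F t (param (chart_at x) y))
      (coord (chart_at x) x)) as [_ L]; [now apply flow_regular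
      |now apply smooth_C1_on|intros; apply smooth_C1_on; auto with smooth| |lra].
    intros z. rewrite param_coord by auto. apply M, param_on_sphere.
  - destruct (sphere_maximum (fun x => - F t x)) as [x [Hx M]].
    { intros. apply (@continuous_opp _ R_AbsRing R_NormedModule).
      now apply potential_continuous. }
    exists x. split; auto. specialize (K x Hx).
    assert (S := smooth_potential t (chart_at x) Ht).
    destruct (laplace_at_min (G (chart_at x) t) (fun y => F t (param (chart_at x) y))
      (coord (chart_at x) x)) as [_ L]; [now apply flow_regular
      |now apply smooth_C1_on|intros; apply smooth_C1_on; auto with smooth| |lra].
    intros z. rewrite param_coord by auto.
    specialize (M (param (chart_at x) z) (param_on_sphere _ _)). lra.
Qed.

Lemma scal_initial x : on_sphere x -> Rs 1 x = 2.
Proof.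
  intros Hx. unfold Rs, scalar_curvature.
  assert (R1 := flow_regular (chart_at x) 1 (Rle_refl 1)). unfold G in R1.
  rewrite (comp_tangent (g 1) round) in * by apply (flow_initial _ _ _ HF).
  now apply local_scal_round.
Qed.

Ltac continuity_by P M O C :=
  cbv beta; lazymatch goal with
  | |- continuous (fun _ => ?k) _ => apply (C k)
  | |- continuous (fun q => @?u q + @?v q) _ => apply (P u v); continuity_by P M O C
  | |- continuous (fun q => @?u q * @?v q) _ => apply (M u v); continuity_by P M O C
  | |- continuous (fun q => - @?u q) _ => apply (O u); continuity_by P M O C
  | |- _ => assumption
  end.

Lemma continuous_brioschi (E' F' G' E1 E2 F1 F2 G1 G2 L : R * plane -> R) p :
  E' p * G' p - F' p ^ 2 <> 0 ->
  continuous E' p -> continuous F' p -> continuous G' p ->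
  continuous E1 p -> continuous E2 p -> continuous F1 p -> continuous F2 p ->
  continuous G1 p -> continuous G2 p -> continuous L p ->
  continuous (fun q => brioschi (E' q) (F' q) (G' q) (E1 q) (E2 q) (F1 q) (F2 q)
     (G1 q) (G2 q) (L q)) p.
Proof.
  intros N. intros. unfold brioschi, brioschi_num, Rdiv, Rminus, pow.
  assert (P : forall u v : R * plane -> R, continuous u p -> continuous v p ->
     continuous (fun q => u q + v q) p).
  { intros u v Hu Hv. exact (@continuous_plus _ R_AbsRing R_NormedModule u v p Hu Hv). }
  assert (M : forall u v : R * plane -> R, continuous u p -> continuous v p ->
     continuous (fun q => u q * v q) p).
  { intros u v Hu Hv. exact (@continuous_mult _ R_AbsRing u v p Hu Hv). }
  assert (O : forall u : R * plane -> R, continuous u p -> continuous (fun q => - u q) p).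
  { intros u Hu. exact (@continuous_opp _ R_AbsRing R_NormedModule u p Hu). }
  assert (C : forall k : R, continuous (fun _ : R * plane => k) p).
  { intros k. apply continuous_const. }
  apply M.
  - continuity_by P M O C.
  - apply (continuous_comp (fun q => (E' q * G' q + - (F' q * (F' q * 1))) *
      ((E' q * G' q + - (F' q * (F' q * 1))) * 1)) Rinv).
    + continuity_by P M O C.
    + apply continuous_Rinv. exact (pow_nonzero _ 2 N).
Qed.

Lemma scal_continuous c p : 1 <= fst p -> continuous_from 1 (in_chart Rs c) p.
Proof.
  intros Hp. destruct (flow_extension c) as [E [HE HG]].
  set (h := fun q => brioschi (E i1 i1 q) (E i1 i2 q) (E i2 i2 q)
    (dx i1 (E i1 i1) q) (dx i2 (E i1 i1) q) (dx i1 (E i1 i2) q) (dx i2 (E i1 i2) q)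
    (dx i1 (E i2 i2) q) (dx i2 (E i2 i2) q)
    (dx i2 (dx i2 (E i1 i1)) q - 2 * dx i1 (dx i2 (E i1 i2)) q
      + dx i1 (dx i1 (E i2 i2)) q)).
  assert (A : forall q, 1 <= fst q -> in_chart Rs c q = h q).
  { intros [t y] Ht. simpl in Ht. unfold in_chart, Rs. simpl fst; simpl snd.
    rewrite scalar_curvature_chart by now apply (flow_riemannian _ _ _ HF).
    assert (R1 := flow_regular c t Ht). unfold G in *.
    rewrite (local_scal_brioschi _ y R1). rewrite <- HG by auto.
    unfold brioschi_at, h, pd. rewrite !slice_dir. reflexivity. }
  assert (Ch : continuous h p).
  { assert (C0 : forall e, (forall k, Ck k everywhere e) -> continuous e p).
    { intros e He. exact (Ck_continuous 0 everywhere e p (He 0%nat) I). }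
    apply continuous_brioschi; try (apply C0; auto using Ck_dx; fail).
    - destruct p as [t y]. simpl in Hp.
      generalize (det_square _ y (flow_regular c t Hp)). rewrite <- HG by auto. auto.
    - apply (@continuous_plus _ R_AbsRing R_NormedModule
        (fun q => dx i2 (dx i2 (E i1 i1)) q - 2 * dx i1 (dx i2 (E i1 i2)) q));
        [|apply C0; auto using Ck_dx].
      apply (@continuous_minus _ R_AbsRing R_NormedModule (dx i2 (dx i2 (E i1 i1)))).
      apply C0; auto using Ck_dx.
      apply (@continuous_mult _ R_AbsRing (fun _ => 2)). apply continuous_const.
      apply C0; auto using Ck_dx. }
  apply (continuous_continuous_from 1) in Ch. unfold continuous_from in *.
  rewrite A by auto. revert Ch. apply filterlim_ext_loc.
  unfold within. apply filter_forall. intros q Hq. symmetry. auto.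
Qed.

(** Where |R - 2| is maximal on the sphere it bounds |r - 2|, and the evolution
    equation becomes d_t |R - 2| <= 2 K |R - 2| with K a bound of |R|. *)
Lemma flow_scal_constant t x : 1 <= t -> on_sphere x -> Rs t x = 2.
Proof.
  intros Ht Hx.
  assert (Cphi : forall c p, 1 <= fst p ->
    continuous_from 1 (in_chart (fun t x => Rs t x - 2) c) p).
  { intros c p Hp. unfold continuous_from, in_chart.
    apply (filterlim_comp _ _ _ (fun q => Rs (fst q) (param c (snd q))) (fun s => s - 2)
      _ (locally (Rs (fst p) (param c (snd p))))).
    - now apply (scal_continuous c p).
    - apply (@ex_derive_continuous R_AbsRing R_NormedModule (fun s : R => s - 2)). now auto_derive. }
  destruct (space_time_maximum 1 t (fun t x => Rabs (Rs t x))) as [t0 [x0 [_ [_ B]]]]; auto.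
  { intros c p [Hp _]. unfold continuous_from, in_chart.
    apply (filterlim_comp _ _ _ (fun q => Rs (fst q) (param c (snd q))) Rabs
      _ (locally (Rs (fst p) (param c (snd p))))).
    now apply (scal_continuous c p). apply continuous_Rabs. }
  set (K := Rabs (Rs t0 x0)) in B.
  apply Rminus_diag_uniq.
  apply (parabolic_uniqueness 1 t (2 * K) (fun t x => Rs t x - 2)); auto; try lra.
  { intros c p Hp. now apply Cphi. }
  { intros z Hz. rewrite scal_initial by auto. ring. }
  clear x Hx. intros s x sg Hsg Hs Hx Hpos Hmax.
  set (c := chart_at x). set (y := coord c x).
  assert (Exy : param c y = x) by now apply param_coord.
  assert (RG : regular (G c s)) by (apply flow_regular; lra).
  assert (SR := smooth_scal (G c s) RG).
  assert (chart : forall z, local_scal (G c s) z = Rs s (param c z)).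
  { intros z. symmetry. apply scalar_curvature_chart.
    apply (flow_riemannian _ _ _ HF). lra. }
  assert (D := flow_scal_evolution c s y ltac:(lra)). rewrite Exy in D.
  eexists. split.
  { evar_last. apply (@is_derive_minus R_AbsRing R_NormedModule). exact D.
    apply (@is_derive_const R_AbsRing R_NormedModule). reflexivity. }
  unfold minus, plus, opp, zero; simpl.
  assert (Z : (forall i, pd i (local_scal (G c s)) y = 0) /\
    sg * local_laplace (G c s) (local_scal (G c s)) y <= 0).
  { assert (Hmax' : forall z, sg * local_scal (G c s) z <= sg * local_scal (G c s) y).
    { intros z. rewrite !chart, Exy. specialize (Hmax _ (param_on_sphere c z)).
      destruct Hsg as [-> | ->].
      - generalize (Rle_abs (Rs s (param c z) - 2)). lra.
      - generalize (Rle_abs (- (Rs s (param c z) - 2))). rewrite Rabs_Ropp. lra. }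
    destruct Hsg as [-> | ->].
    - destruct (laplace_at_max (G c s) (local_scal (G c s)) y RG); [now apply smooth_C1_on
       | intros; apply smooth_C1_on; auto with smooth
       | intros z; specialize (Hmax' z); lra |]. split; auto. lra.
    - destruct (laplace_at_min (G c s) (local_scal (G c s)) y RG); [now apply smooth_C1_on
       | intros; apply smooth_C1_on; auto with smooth
       | intros z; specialize (Hmax' z); lra |]. split; auto. lra. }
  destruct Z as [Z L]. rewrite !Z, !chart, Exy.
  destruct (mean_bounds s ltac:(lra)) as [[a [Ha La]] [b [Hb Lb]]].
  assert (Ma := Hmax a Ha). assert (Mb := Hmax b Hb).
  apply Rabs_le_between in Ma. apply Rabs_le_between in Mb.
  assert (BK := B s x ltac:(lra) Hx). apply Rabs_le_between in BK.
  set (ph := Rs s x) in *. set (m := sg * (ph - 2)) in *.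
  assert (rb : - m <= r s - 2 <= m) by lra.
  assert (Q : sg * (- ((r s - ph) * ph)) <= 2 * K * m).
  { assert (Pb : - (2 * m) <= sg * (ph - r s) <= 2 * m).
    { unfold m in *. destruct Hsg as [-> | ->]; lra. }
    replace (sg * (- ((r s - ph) * ph))) with ((sg * (ph - r s)) * ph) by ring.
    set (u := sg * (ph - r s)) in *. nra. }
  rewrite !Rmult_0_r. lra.
Qed.

Lemma flow_mean_constant t : 1 <= t -> r t = 2.
Proof.
  intros Ht. destruct (mean_bounds t Ht) as [[a [Ha La]] [b [Hb Lb]]].
  rewrite flow_scal_constant in La, Lb by auto. lra.
Qed.

(** With constant curvature R = r the potential is harmonic, and its gradient vanishes
    where it is largest. *)
Lemma flow_potential_constant t c y i : 1 <= t -> pd i (fun y => F t (param c y)) y = 0.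
Proof.
  intros Ht.
  assert (Rm := flow_riemannian _ _ _ HF t Ht).
  assert (Sp := potential_smooth _ _ _ HF t Ht).
  apply (gradient_norm_zero (G c t)). { now apply flow_regular. }
  unfold G. rewrite <- (gradient_norm_chart (g t) Rm (F t) c y Sp).
  destruct (sphere_maximum (gradient_norm (g t) (F t))) as [x [Hx M]].
  { intros c' z. apply (continuous_ext (fun y => contract (comp (g t) c')
      (fun i j z => pd i (fun z => F t (param c' z)) z * pd j (fun z => F t (param c' z)) z) y)).
    - intros z'. symmetry. now apply gradient_norm_chart.
    - apply smooth_continuous, smooth_gradient_norm. now apply flow_regular. now apply smooth_potential. }
  apply Rle_trans with (1 := M _ (param_on_sphere c y)).
  set (c' := chart_at x).
  rewrite <- (param_coord x Hx). fold c'. rewrite gradient_norm_chart by auto.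
  apply harmonic_gradient_max.
  - now apply flow_regular.
  - now apply smooth_potential.
  - rewrite <- scalar_curvature_chart by auto.
    fold (Rs t (param c' (coord c' x))).
    rewrite flow_scal_constant by auto using param_on_sphere. lra.
  - intros z. rewrite <- laplacian_chart by auto.
    rewrite (potential_poisson _ _ _ HF) by auto using param_on_sphere.
    fold (r t). fold (Rs t (param c' z)).
    rewrite flow_scal_constant, flow_mean_constant by auto using param_on_sphere. ring.
  - intros z. rewrite <- !(gradient_norm_chart (g t) Rm (F t)) by auto.
    unfold c'. rewrite param_coord by auto. apply M, param_on_sphere.
Qed.

Lemma flow_Mten_zero t c i j y : 1 <= t -> Mten (g t) (F t) c i j y = 0.
Proof.
  intros Ht.
  assert (Z : pd i (pd j (fun z => F t (param c z))) y = 0).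
  { replace (pd j (fun z => F t (param c z))) with (fun _ : plane => 0).
    - apply pd_unique, is_dir_const.
    - apply functional_extensionality. intros z. now rewrite flow_potential_constant. }
  unfold Mten. fold (r t). fold (Rs t (param c y)).
  rewrite flow_scal_constant, flow_mean_constant by auto using param_on_sphere.
  unfold local_hess, sum2. rewrite Z, !flow_potential_constant by auto. ring.
Qed.

Lemma flow_comp t c i j y : 1 <= t -> comp (g t) c i j y = comp round c i j y.
Proof.
  intros Ht. destruct (flow_extension c) as [E [HE HG]].
  rewrite <- (comp_tangent (g 1) round c (flow_initial _ _ _ HF)).
  change (G c t i j y = G c 1 i j y). rewrite <- !HG by lra.
  destruct Ht as [Ht| <-]; auto.
  destruct (MVT_cor2 (fun s => slice (E i j) s y) (fun s => slice (dt (E i j)) s y) 1 t Ht)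
    as [s [E1 Hs]].
  { intros s _. apply is_derive_Reals. now apply is_derive_slice. }
  unfold slice at 3 in E1.
  rewrite (flow_velocity c i j s y E), flow_Mten_zero in E1 by (auto; lra).
  lra.
Qed.

Lemma flow_round t x v w : 1 <= t -> on_sphere x -> tangent x v -> tangent x w ->
  g t x v w = round x v w.
Proof.
  intros Ht Hx Hv Hw.
  assert (Rm := flow_riemannian _ _ _ HF t Ht).
  rewrite <- (param_coord x Hx) in *.
  set (c := chart_at x) in *. destruct (coord c x) as [a b].
  assert (I := inner_param (g t) Rm c (a, b)).
  assert (T := fun i => dparam_tangent c i (a, b)).
  assert (C := fun i j => flow_comp t c i j (a, b) Ht). unfold comp in C.
  rewrite (tangent_span c a b v Hv), (tangent_span c a b w Hw).
  rewrite inner_left, !inner_right by auto using tangent_comb.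
  rewrite !C. unfold round.
  generalize (dot v (dparam c i1 (a, b)) * ((1 + a ^ 2 + b ^ 2) ^ 2 / 4)).
  generalize (dot v (dparam c i2 (a, b)) * ((1 + a ^ 2 + b ^ 2) ^ 2 / 4)).
  generalize (dot w (dparam c i1 (a, b)) * ((1 + a ^ 2 + b ^ 2) ^ 2 / 4)).
  generalize (dot w (dparam c i2 (a, b)) * ((1 + a ^ 2 + b ^ 2) ^ 2 / 4)).
  generalize (dparam c i1 (a, b)) (dparam c i2 (a, b)). intros [[p1 p2] p3] [[q1 q2] q3].
  intros. unfold dot, plus, scal; simpl. unfold plus, scal; simpl. unfold mult; simpl. ring.
Qed.

Lemma flow_M_normsq t x : 1 <= t -> M_normsq (g t) (F t) x = 0.
Proof.
  intros Ht. unfold M_normsq, local_normsq, sum2.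
  rewrite !flow_Mten_zero by auto. ring.
Qed.

Lemma flow_scalar_curvature t x : 1 <= t -> on_sphere x -> scalar_curvature (g t) x = 2.
Proof. exact (flow_scal_constant t x). Qed.

End Flow.

(** * The lapse function *)

Lemma sphere_point : on_sphere (1, 0, 0).
Proof. unfold on_sphere, dot. ring. Qed.

Lemma sup_sphere_const f c : (forall x, on_sphere x -> f x = c) -> sup_sphere f = c.
Proof.
  intros H. unfold sup_sphere. rewrite (is_lub_Rbar_unique _ (Finite c)); auto.
  split.
  - intros r [x [Hx ->]]. rewrite H by auto. simpl. lra.
  - intros b Hb. apply Hb. exists (1, 0, 0). split. apply sphere_point.
    now rewrite H by apply sphere_point.
Qed.

Lemma inf_sphere_const f c : (forall x, on_sphere x -> f x = c) -> inf_sphere f = c.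
Proof.
  intros H. unfold inf_sphere. rewrite (is_glb_Rbar_unique _ (Finite c)); auto.
  split.
  - intros r [x [Hx ->]]. rewrite H by auto. simpl. lra.
  - intros b Hb. apply Hb. exists (1, 0, 0). split. apply sphere_point.
    now rewrite H by apply sphere_point.
Qed.

(** The exact solution of (E) on the round background with zero prescribed
    curvature: the Schwarzschild lapse. *)
Definition lapse (t : R) : R := sqrt (t / (t - 1)).

Lemma lapse_arg t : 1 < t -> 0 < t / (t - 1).
Proof. intros Ht. apply Rdiv_lt_0_compat; lra. Qed.

Lemma lapse_pos t : 1 < t -> 0 < lapse t.
Proof. intros Ht. now apply sqrt_lt_R0, lapse_arg. Qed.

Lemma is_derive_lapse t : 1 < t ->
  is_derive lapse t (/ t * (/ 2 * lapse t - / 2 * lapse t ^ 3)).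
Proof.
  intros Ht. assert (A := lapse_arg t Ht). assert (P := lapse_pos t Ht).
  unfold lapse in *. auto_derive.
  - repeat split; auto. unfold Rdiv in A. lra.
  - change (t * / (t + - (1))) with (t / (t - 1)).
    assert (S : sqrt (t / (t - 1)) ^ 2 = t / (t - 1)) by (apply pow2_sqrt; lra).
    set (v := sqrt (t / (t - 1))) in *.
    apply (Rmult_eq_reg_l (2 * t * v)); [|nra].
    transitivity (t * ((1 * (t - 1) + - (t * 1)) * / (t - 1) ^ 2)).
    { field. split; lra. }
    transitivity (v ^ 2 - (v ^ 2) * (v ^ 2)); [|field; lra].
    rewrite S. field. lra.
Qed.

Section Solution.
Context (g : R -> metric) (F : R -> space -> R) (HF : modified_ricci_flow round g F).

Lemma Mtilde_zero s x : 0 < s -> Mtilde g F s x = 0.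
Proof.
  intros Hs. unfold Mtilde. rewrite (flow_M_normsq g F HF) by lra.
  rewrite Rmult_0_r. apply sqrt_0.
Qed.

Lemma delta_source tau x : 0 < tau -> on_sphere x ->
  Rtilde g tau x / 2 - tau ^ 2 / 2 * Rtilde_N (fun _ _ => 0) tau x = 1.
Proof.
  intros Ht Hx. unfold Rtilde, Rtilde_N.
  rewrite (flow_scalar_curvature g F HF) by (auto; lra). field. lra.
Qed.

Lemma barrier_one (S N : R -> R) t : 0 < t ->
  (forall tau, 0 < tau -> S tau = 1) -> (forall s, 0 < s -> N s = 0) ->
  / t * RInt (fun tau => S tau * exp (- RInt (fun s => s * N s ^ 2 / 2) tau t)) 0 t = 1.
Proof.
  intros Ht HS HN. rewrite (RInt_ext _ (fun _ => 1)).
  - rewrite RInt_const. unfold scal; simpl. unfold mult; simpl. field. lra.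
  - intros tau Htau. rewrite Rmin_left, Rmax_right in Htau by lra.
    rewrite HS by lra. rewrite (RInt_ext _ (fun _ => 0)).
    + rewrite RInt_const. unfold scal; simpl. unfold mult; simpl.
      rewrite Rmult_0_r, Ropp_0, exp_0. apply Rmult_1_l.
    + intros s Hs. rewrite Rmin_left, Rmax_right in Hs by lra.
      rewrite HN by lra. change (s * 0 ^ 2 / 2 = 0 :> R). field.
Qed.

(** Both barriers collapse to 1, so that the initial data are forced. *)
Lemma delta_low_one t : 0 < t -> delta_low g F (fun _ _ => 0) t = 1.
Proof.
  intros Ht. apply (barrier_one _ (fun s => sup_sphere (Mtilde g F s))); auto; intros s Hs.
  - apply inf_sphere_const. intros. now apply delta_source.
  - apply sup_sphere_const. intros. now apply Mtilde_zero.
Qed.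

Lemma delta_up_one t : 0 < t -> delta_up g F (fun _ _ => 0) t = 1.
Proof.
  intros Ht. apply (barrier_one _ (fun s => inf_sphere (Mtilde g F s))); auto; intros s Hs.
  - apply sup_sphere_const. intros. now apply delta_source.
  - apply inf_sphere_const. intros. now apply Mtilde_zero.
Qed.

Lemma C21_slice D (f : R * plane -> R) t : C21 D f -> (forall y, D (t, y)) ->
  C1_on everywhere (slice f t) /\ forall i, C1_on everywhere (pd i (slice f t)).
Proof.
  intros H HD.
  assert (E : forall i, pd i (slice f t) = slice (dx i f) t).
  { intros i. unfold pd. now rewrite slice_dir. }
  split.
  - intros y _ i. destruct (H (t, y) (HD y)) as [_ [_ [_ [H1 _]]]]. split.
    + apply slice_ex_dir, H1.
    + rewrite E. apply slice_continuous, H1.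
  - intros i y _ j. destruct (H (t, y) (HD y)) as [_ [_ [_ [_ H2]]]]. rewrite E. split.
    + apply slice_ex_dir, (H2 i j).
    + unfold pd. rewrite slice_dir. apply slice_continuous, (H2 i j).
Qed.

Lemma C21_time D (w : R -> space -> R) c t y : C21 D (in_chart w c) -> D (t, y) ->
  ex_derive (fun s => w s (param c y)) t.
Proof.
  intros H HD. destruct (H _ HD) as [_ [K _]].
  eexists. exact (is_derive_time (in_chart w c) t y _ (ex_dir_is _ _ _ K)).
Qed.

(** Uniqueness for (E): the difference to the explicit solution satisfies the
    hypotheses of the maximum principle, the cubic term having the good sign. *)
Lemma solution_unique a w : 1 < a ->
  solves_E g F (fun _ _ => 0) a w ->
  (forall x, on_sphere x -> w a x = lapse a) ->
  forall t x, a <= t -> on_sphere x -> w t x = lapse t.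
Proof.
  intros Ha Hw H0 t x Ht Hx. apply Rminus_diag_uniq.
  apply (parabolic_uniqueness a t (/ 2) (fun t x => w t x - lapse t)); auto; try lra.
  - intros c p Hp. unfold continuous_from, in_chart.
    apply (filterlim_comp_2 (G := locally (w (fst p) (param c (snd p))))
      (H := locally (- lapse (fst p)))
      (fun q : R * plane => w (fst q) (param c (snd q)))
      (fun q : R * plane => - lapse (fst q)) Rplus).
    + apply (solves_E_continuous _ _ _ _ _ Hw c p). lra.
    + apply (continuous_continuous_from a (fun q : R * plane => - lapse (fst q))).
      apply (continuous_comp (fst : R * plane -> R) (fun s => - lapse s)).
      destruct p; apply continuous_fst.
      apply (@ex_derive_continuous R_AbsRing R_NormedModule (fun s => - lapse s)).
      apply (@ex_derive_opp R_AbsRing R_NormedModule).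
      eexists; apply is_derive_lapse. lra.
    + apply (@filterlim_plus R_AbsRing R_NormedModule).
  - intros z Hz. rewrite H0 by auto. ring.
  - clear x Hx. intros s x sg Hsg Hs Hx Hpos Hmax.
    set (c := chart_at x). set (y := coord c x).
    assert (Exy : param c y = x) by now apply param_coord.
    assert (RG : regular (comp (g s) c)) by (apply (flow_regular g F HF); lra).
    assert (W := solves_E_C21 _ _ _ _ _ Hw c).
    assert (Dw : is_derive (fun s => w s x) s (Derive (fun s => w s x) s)).
    { apply Derive_correct. rewrite <- Exy.
      apply (C21_time _ w c s y W). simpl. lra. }
    eexists. split.
    { apply (@is_derive_minus R_AbsRing R_NormedModule). exact Dw.
      apply is_derive_lapse. lra. }
    unfold minus, plus, opp; simpl.
    assert (Eq := solves_E_eq _ _ _ _ _ Hw s x ltac:(lra) Hx).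
    rewrite (flow_M_normsq g F HF), (flow_scalar_curvature g F HF) in Eq by (auto; lra).
    change (laplacian (g s) (w s) x)
      with (local_laplace (comp (g s) c) (slice (in_chart w c) s) y) in Eq.
    destruct (C21_slice _ (in_chart w c) s W) as [C1w C2w]. { intros z. simpl. lra. }
    assert (L : sg * local_laplace (comp (g s) c) (slice (in_chart w c) s) y <= 0).
    { assert (Hmax' : forall z, sg * slice (in_chart w c) s z <= sg * slice (in_chart w c) s y).
      { intros z. unfold slice, in_chart. simpl. rewrite Exy.
        specialize (Hmax _ (param_on_sphere c z)).
        destruct Hsg as [-> | ->].
        - generalize (Rle_abs (w s (param c z) - lapse s)). lra.
        - generalize (Rle_abs (- (w s (param c z) - lapse s))). rewrite Rabs_Ropp. lra. }
      destruct Hsg as [-> | ->].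
      - destruct (laplace_at_max _ _ y RG C1w C2w); [|lra].
        intros z; specialize (Hmax' z); lra.
      - destruct (laplace_at_min _ _ y RG C1w C2w); [|lra].
        intros z; specialize (Hmax' z); lra. }
    set (Lw := local_laplace _ _ _) in *.
    set (wx := w s x) in *. set (d := Derive (fun s => w s x) s) in *.
    assert (Pw : 0 < wx) by (apply (solves_E_pos _ _ _ _ _ Hw); auto; lra).
    assert (Pv := lapse_pos s ltac:(lra)). set (v := lapse s) in *.
    set (m := sg * (wx - v)) in *.
    assert (E2 : s * (sg * (d + - (/ s * (/ 2 * v - / 2 * v ^ 3))))
       = / 2 * wx ^ 2 * (sg * Lw) + / 2 * m - / 2 * (m * (wx ^ 2 + wx * v + v ^ 2))).
    { transitivity (sg * (s * d) - sg * (/ 2 * v - / 2 * v ^ 3)). field; lra.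
      rewrite Eq. unfold m. field. }
    assert (A1 : / 2 * wx ^ 2 * (sg * Lw) <= 0).
    { assert (0 <= / 2 * wx ^ 2) by nra. nra. }
    assert (A2 : 0 <= m * (wx ^ 2 + wx * v + v ^ 2)).
    { apply Rmult_le_pos; nra. }
    change (sg * (d + - (/ s * (/ 2 * v - / 2 * v ^ 3))) <= / 2 * m).
    set (l := sg * (d + - (/ s * (/ 2 * v - / 2 * v ^ 3)))) in *.
    assert (Q : s * l <= / 2 * m) by lra.
    destruct (Rle_lt_dec l 0); [lra|]. assert (l <= s * l) by nra. lra.
Qed.
End Solution.

(** The barriers force the initial data to be 1, uniqueness for (E) makes all the rescaled
    approximations identically 1, and so is their limit. *)
Lemma data_lapse alpha g F phi w e ut u :
  modified_ricci_flow round g F ->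
  construction_data alpha g F (fun _ _ => 0) phi w e ut u ->
  forall t x, 1 < t -> on_sphere x -> u t x = lapse t.
Proof.
  intros HF D.
  assert (Phi : forall eps x, 0 < eps < 1 -> on_sphere x -> phi eps x = 1).
  { intros eps x He Hx. assert (B := data_bounds _ _ _ _ _ _ _ _ _ D eps x He Hx).
    rewrite (delta_low_one g F HF), (delta_up_one g F HF) in B by lra.
    assert (P := data_pos _ _ _ _ _ _ _ _ _ D eps x He Hx).
    assert (E : / phi eps x ^ 2 = 1) by lra.
    assert (phi eps x ^ 2 = 1). { rewrite <- (Rinv_inv (phi eps x ^ 2)), E. apply Rinv_1. }
    nra. }
  assert (W : forall eps t x, 0 < eps < 1 -> eps <= t -> on_sphere x ->
     tilde (w eps) t x = 1).
  { assert (T : forall t, 0 < t -> sqrt (t / (t + 1)) * lapse (t + 1) = 1).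
    { intros t Ht. unfold lapse. rewrite <- sqrt_mult.
      - replace (t / (t + 1) * ((t + 1) / (t + 1 - 1))) with 1 by (field; lra).
        apply sqrt_1.
      - left; apply Rdiv_lt_0_compat; lra.
      - left; apply Rdiv_lt_0_compat; lra. }
    intros eps t x He Ht Hx. unfold tilde.
    rewrite (solution_unique g F HF (1 + eps) (w eps)); auto; try lra.
    - apply T. lra.
    - apply (approx_solution _ _ _ _ _ _ _ _ _ D eps He).
    - intros z Hz. assert (A := approx_initial _ _ _ _ _ _ _ _ _ D eps z He Hz).
      rewrite Phi in A by auto. unfold tilde in A. rewrite (Rplus_comm 1).
      apply (Rmult_eq_reg_l (sqrt (eps / (eps + 1)))).
      + rewrite A, T; lra.
      + intros Z. rewrite Z in A. lra. }
  assert (U : forall t x, 0 < t -> on_sphere x -> ut t x = 1).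
  { intros t x Ht Hx. apply Rminus_diag_uniq_sym.
    destruct (Req_dec (1 - ut t x) 0) as [|N]; auto. exfalso.
    apply Rabs_pos_lt in N.
    set (c := chart_at x). set (y := coord c x).
    assert (Exy : param c y = x) by now apply param_coord.
    assert (Hrho : 0 < eucl y (0, 0) + 1) by (generalize (sqrt_pos ((fst y - fst (0,0)) ^ 2 + (snd y - snd (0,0)) ^ 2)); unfold eucl; lra).
    destruct (limit_cvg _ _ _ _ _ _ _ _ _ D c (t / 2) (2 * t) _ ltac:(lra) Hrho
      (Rabs (1 - ut t x) / 2) ltac:(lra)) as [J1 HJ1].
    assert (L := sequence_cvg _ _ _ _ _ _ _ _ _ D).
    apply is_lim_seq_spec in L. destruct (L (mkposreal t Ht)) as [J2 HJ2]. simpl in HJ2.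
    set (j := max J1 J2).
    specialize (HJ1 j (Nat.le_max_l _ _)). specialize (HJ2 j (Nat.le_max_r _ _)).
    destruct HJ1 as [HJ1 _].
    destruct (HJ1 (t, y)) as [K _]. { simpl. lra. }
    unfold in_chart in K. simpl in K. rewrite Exy in K.
    apply Rabs_def2 in HJ2.
    rewrite W in K; auto. lra.
    apply (sequence_range _ _ _ _ _ _ _ _ _ D). lra. }
  intros t x Ht Hx. rewrite (solution_eq _ _ _ _ _ _ _ _ _ D t x Ht Hx).
  rewrite U by (auto; lra). unfold lapse. ring.
Qed.

(** * The totally geodesic boundary *)

Lemma dot_pos v : v <> (0, 0, 0) -> 0 < dot v v.
Proof.
  destruct v as [[a b] c]. intros N. unfold dot.
  destruct (Req_dec a 0) as [->|]; [|nra].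
  destruct (Req_dec b 0) as [->|]; [|nra].
  destruct (Req_dec c 0) as [->|]; [|nra]. now destruct N.
Qed.

Lemma dot_sym v w : dot v w = dot w v.
Proof. destruct v as [[a b] c], w as [[p q] r]. unfold dot. ring. Qed.

Lemma dot_left (a : R) v v' w : dot (plus (scal a v) v') w = a * dot v w + dot v' w.
Proof.
  destruct v as [[v1 v2] v3], v' as [[u1 u2] u3], w as [[w1 w2] w3].
  unfold dot, plus, scal; simpl. unfold plus, scal; simpl. unfold mult; simpl. ring.
Qed.

(** The metric t^2 sigma in the boundary coordinate t = 1 + s^2. *)
Definition cylinder_scale (s : R) : metric := fun x v w => (1 + s ^ 2) ^ 2 * round x v w.

(** The conditions on the denominators are left as goals. *)
Ltac solve_Ck V :=
  cbv beta; lazymatch goal with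
  | |- Ck _ _ (fun _ => ?c) => apply (Ck_const (V := V))
  | |- Ck _ _ (fun x => @?f x + @?g x) => apply (Ck_plus (V := V) _ _ f g); solve_Ck V
  | |- Ck _ _ (fun x => @?f x - @?g x) => apply (Ck_minus (V := V) _ _ f g); solve_Ck V
  | |- Ck _ _ (fun x => @?f x * @?g x) => apply (Ck_mult (V := V) _ _ f g); solve_Ck V
  | |- Ck _ _ (fun x => @?f x ^ 2) =>
      apply (Ck_mult (V := V) _ _ f (fun x => f x * 1)); solve_Ck V
  | |- Ck _ _ (fun x => / @?f x) => apply (Ck_inv (V := V) _ _ f); solve_Ck V
  | |- _ => auto
  end.

Definition space_time : NormedModule R_AbsRing :=
  prod_NormedModule R_AbsRing R_NormedModule
    (prod_NormedModule R_AbsRing R_NormedModule R_NormedModule).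

Section Regularity.
Context (k : nat).

Lemma open_space_time : open (everywhere : R * plane -> Prop).
Proof.
  exact (@open_everywhere space_time).
Qed.

Lemma Ck_time : Ck k everywhere (fun p : R * plane => fst p).
Proof.
  assert (Ct : forall p : R * plane, continuous (fst : R * plane -> R) p).
  { intros []. apply continuous_fst. }
  apply Ck_linear; [apply open_space_time | exact Ct | reflexivity].
Qed.

Lemma Ck_chart_coordinate (pr : plane -> R) : (forall y, continuous pr y) ->
  (forall x (h : R) v, pr (plus x (scal h v)) = pr x + h * pr v) ->
  Ck k everywhere (fun p : R * plane => pr (snd p)).
Proof.
  intros C L.
  assert (Cs : forall p : R * plane, continuous (snd : R * plane -> plane) p).
  { intros []. apply continuous_snd. }
  apply Ck_linear; [apply open_space_time | |intros; apply L].
  intros p. apply (continuous_comp (snd : R * plane -> plane) pr); auto.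
Qed.

Lemma Ck_one_plus_square : Ck k everywhere (fun p : R * plane => 1 + fst p ^ 2).
Proof. assert (O := open_space_time). assert (T := Ck_time). solve_Ck space_time. Qed.

Lemma Ck_boundary_lapse :
  Ck k everywhere (fun p : R * plane => 2 * sqrt (1 + fst p ^ 2)).
Proof.
  assert (O := open_space_time).
  apply (Ck_scal (V := space_time)), (Ck_sqrt (V := space_time));
    auto using Ck_one_plus_square.
  intros x _. nra.
Qed.

Lemma Ck_cylinder i j : Ck k everywhere (fun p : R * plane => (1 + fst p ^ 2) ^ 2 *
   match i, j with i1, i1 | i2, i2 => conformal_factor (snd p) | _, _ => 0 end).
Proof.
  assert (O := open_space_time). assert (T := Ck_time).
  assert (S1 : Ck k everywhere (fun p : R * plane => fst (snd p))).
  { apply (Ck_chart_coordinate fst); [apply continuous_fst' | reflexivity]. }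
  assert (S2 : Ck k everywhere (fun p : R * plane => snd (snd p))).
  { apply (Ck_chart_coordinate snd); [apply continuous_snd' | reflexivity]. }
  assert (Sf : Ck k everywhere (fun p : R * plane => conformal_factor (snd p))).
  { unfold conformal_factor. apply (Ck_div (V := space_time)); solve_Ck space_time.
    intros p _. apply pow_nonzero, Rgt_not_eq.
    exact (chart_denominator (fst (snd p)) (snd (snd p))). }
  destruct i, j; solve_Ck space_time.
Qed.
End Regularity.

(** With t = 1 + s^2 the lapse 2 s u is 2 sqrt(1 + s^2) and the metric t^2 sigma is even
    in s, so that its derivative at s = 0 vanishes. *)
Lemma boundary_geodesic (u : R -> space -> R) (g : R -> metric) :
  (forall t x, 1 < t -> on_sphere x -> u t x = lapse t) ->
  (forall t x v w, 1 <= t -> on_sphere x -> tangent x v -> tangent x w ->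
    g t x v w = round x v w) ->
  totally_geodesic_boundary u g.
Proof.
  intros Hu Hg.
  assert (Hc : forall s c i j y, comp (cylinder_scale s) c i j y =
    (1 + s ^ 2) ^ 2 * match i, j with i1, i1 | i2, i2 => conformal_factor y | _, _ => 0 end).
  { intros s c i j y. rewrite <- (comp_round c). reflexivity. }
  exists (fun s _ => 2 * sqrt (1 + s ^ 2)), cylinder_scale.
  refine (conj _ (conj _ (conj _ (conj _ (conj _ (conj _ _)))))).
  - intros s x Hs Hx. rewrite Hu by (auto; nra). unfold lapse.
    replace (1 + s ^ 2 - 1) with (s * s) by ring.
    rewrite sqrt_div by nra. rewrite sqrt_square by lra. field. lra.
  - intros s x v w Hs Hx Hv Hw. rewrite Hg by (auto; nra). reflexivity.
  - intros c. exact (Ck_boundary_lapse 1).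
  - intros c i j.
    refine (Ck_ext 1 everywhere _ _ open_space_time _ (Ck_cylinder 1 i j)).
    intros p _. symmetry. apply Hc.
  - intros s x Hs Hx. apply Rmult_lt_0_compat. lra. apply sqrt_lt_R0. nra.
  - intros s x _ _. unfold inner_product_at, cylinder_scale, round.
    refine (conj _ (conj _ _)).
    + intros v w _ _. now rewrite dot_sym.
    + intros a v v' w _ _ _. rewrite dot_left. ring.
    + intros v _ N. apply Rmult_lt_0_compat.
      apply pow_lt. nra. now apply dot_pos.
  - intros c i j y.
    rewrite (Derive_ext _ (fun s => (1 + s ^ 2) ^ 2 *
      match i, j with i1, i1 | i2, i2 => conformal_factor y | _, _ => 0 end)) by auto.
    generalize (match i, j with i1, i1 | i2, i2 => conformal_factor y | _, _ => 0 end).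
    intros K. apply Rmult_eq_0_compat_l. apply is_derive_unique.
    auto_derive; [trivial|ring].
Qed.

(** * The ADM mass *)

Definition space3 : NormedModule R_AbsRing :=
  prod_NormedModule R_AbsRing (prod_NormedModule R_AbsRing R_NormedModule R_NormedModule)
    R_NormedModule.

Definition coordinate (i : idx3) (x : space) : R :=
  match i with j1 => fst (fst x) | j2 => snd (fst x) | j3 => snd x end.

Lemma dot_coordinates x y : dot x y = sum3 (fun i => coordinate i x * coordinate i y).
Proof. destruct x as [[? ?] ?], y as [[? ?] ?]. reflexivity. Qed.

Lemma dot_basis x i : dot x (basis3 i) = coordinate i x.
Proof. destruct x as [[? ?] ?], i; simpl; ring. Qed.

Lemma coordinate_basis i k : coordinate i (basis3 k) = kron i k.
Proof. destruct i, k; reflexivity. Qed.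

Lemma norm3_square x : norm3 x ^ 2 = dot x x.
Proof.
  unfold norm3. apply pow2_sqrt. rewrite dot_coordinates. unfold sum3. nra.
Qed.

Lemma norm3_scal (rho : R) x : 0 <= rho -> on_sphere x -> norm3 (scal rho x) = rho.
Proof.
  intros Hr Hx. unfold norm3. replace (dot (scal rho x) (scal rho x)) with (rho * rho).
  now apply sqrt_square.
  unfold on_sphere in Hx. destruct x as [[a b] c].
  transitivity (rho * rho * dot (a, b, c) (a, b, c)). rewrite Hx; ring.
  unfold dot, scal; simpl. unfold scal; simpl. unfold mult; simpl. ring.
Qed.

(** Since dx^2 = dr^2 + r^2 sigma, the metric exceeds the Euclidean one by
    dr^2 / (r - 1). *)
Definition perturbation (i j : idx3) (x : space) : R :=
  coordinate i x * coordinate j x * (/ norm3 x * / norm3 x * / (norm3 x - 1)).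

Lemma cartesian_perturbation u g i j x :
  (forall t x, 1 < t -> on_sphere x -> u t x = lapse t) ->
  (forall t x v w, 1 <= t -> on_sphere x -> tangent x v -> tangent x w ->
    g t x v w = round x v w) ->
  1 < norm3 x -> cartesian u g i j x = kron i j + perturbation i j x.
Proof.
  intros Hu Hg Ht. unfold cartesian, perturbation.
  assert (N := norm3_square x). set (t := norm3 x) in *. clearbody t.
  set (om := scal (/ t) x).
  assert (Hom : on_sphere om).
  { unfold on_sphere, om. transitivity (/ t * / t * dot x x).
    - destruct x as [[a b] c]. unfold dot, scal; simpl. unfold scal; simpl.
      unfold mult; simpl. ring.
    - rewrite <- N. field. lra. }
  assert (T : forall v, tangent om (scal (/ t) (minus v (scal (dot om v) om)))).
  { intros v. unfold tangent. unfold on_sphere in Hom.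
    transitivity (/ t * (dot om v - dot om v * dot om om)).
    - destruct om as [[a b] c], v as [[p q] r]. unfold dot, scal, minus, plus, opp; simpl.
      unfold scal, plus, opp; simpl. unfold mult; simpl. ring.
    - rewrite Hom. ring. }
  change (u t om ^ 2 * (dot om (basis3 i) * dot om (basis3 j)) + t ^ 2 *
    g t om (scal (/ t) (minus (basis3 i) (scal (dot om (basis3 i)) om)))
           (scal (/ t) (minus (basis3 j) (scal (dot om (basis3 j)) om)))
    = kron i j + coordinate i x * coordinate j x * (/ t * / t * / (t - 1))).
  rewrite Hu, Hg by (auto; lra).
  assert (L2 : lapse t ^ 2 = t / (t - 1)).
  { unfold lapse. apply pow2_sqrt. left. now apply lapse_arg. }
  rewrite L2. unfold round.
  assert (B : dot (basis3 i) (basis3 j) = kron i j).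
  { rewrite dot_basis, coordinate_basis. destruct i, j; reflexivity. }
  assert (Cm : forall k, dot om (basis3 k) = / t * coordinate k x).
  { intros k. rewrite dot_basis. unfold om. destruct k, x as [[a b] c]; reflexivity. }
  clearbody om.
  transitivity (t / (t - 1) * (dot om (basis3 i) * dot om (basis3 j))
    + (dot (basis3 i) (basis3 j) - 2 * dot om (basis3 i) * dot om (basis3 j)
       + dot om (basis3 i) * dot om (basis3 j) * dot om om)).
  - f_equal.
    generalize (basis3 i) (basis3 j). intros [[a b] c] [[p q] r].
    clear -Ht. destruct om as [[x1 x2] x3].
    unfold dot, scal, minus, plus, opp; simpl.
    unfold scal, plus, opp; simpl. unfold mult; simpl. field. lra.
  - unfold on_sphere in Hom. rewrite Hom, B, !Cm. field. lra.
Qed.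

(** The region r > 2, where r - 1 is comparable to r. *)
Definition exterior (x : space) : Prop := 2 < norm3 x.

Lemma continuous_coordinate i x : continuous (coordinate i) x.
Proof.
  assert (C1 : forall p : space, continuous (fst : space -> R * R) p).
  { intros []. apply continuous_fst. }
  destruct i; simpl.
  - apply (continuous_comp (fst : space -> R * R) (fst : R * R -> R)); auto.
    apply continuous_fst'.
  - apply (continuous_comp (fst : space -> R * R) (snd : R * R -> R)); auto.
    apply continuous_snd'.
  - destruct x. apply continuous_snd.
Qed.

Lemma norm3_coordinates x : norm3 x =
  sqrt (coordinate j1 x * coordinate j1 x + coordinate j2 x * coordinate j2 x
        + coordinate j3 x * coordinate j3 x).
Proof. unfold norm3. now rewrite dot_coordinates. Qed.

Lemma open_exterior : open exterior.
Proof.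
  apply (open_comp (norm3 : space -> R) (fun r => 2 < r)); [|apply open_gt].
  intros x _.
  apply (continuous_ext (fun x => sqrt (coordinate j1 x * coordinate j1 x
     + coordinate j2 x * coordinate j2 x + coordinate j3 x * coordinate j3 x))).
  { intros z. symmetry. apply norm3_coordinates. }
  apply (continuous_comp (fun x => coordinate j1 x * coordinate j1 x
     + coordinate j2 x * coordinate j2 x + coordinate j3 x * coordinate j3 x) sqrt).
  2: apply continuous_sqrt.
  assert (Sq : forall i, continuous (fun x => coordinate i x * coordinate i x) x).
  { intros i. apply (@continuous_mult _ R_AbsRing (coordinate i) (coordinate i));
    apply continuous_coordinate. }
  apply (@continuous_plus _ R_AbsRing R_NormedModule (fun x => coordinate j1 x * coordinate j1 x
     + coordinate j2 x * coordinate j2 x)); auto.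
  apply (@continuous_plus _ R_AbsRing R_NormedModule (fun x => coordinate j1 x * coordinate j1 x));
   auto.
Qed.

Lemma Ck_coordinate k i : Ck k exterior (coordinate i).
Proof.
  apply Ck_linear. apply open_exterior. apply continuous_coordinate.
  intros x h v. destruct i; reflexivity.
Qed.

Lemma exterior_square_pos x : exterior x ->
  0 < coordinate j1 x * coordinate j1 x + coordinate j2 x * coordinate j2 x
        + coordinate j3 x * coordinate j3 x.
Proof.
  unfold exterior. rewrite norm3_coordinates. intros H.
  apply sqrt_lt_0_alt. rewrite sqrt_0. lra.
Qed.

Lemma Ck_norm3 k : Ck k exterior norm3.
Proof.
  assert (O := open_exterior).
  apply (Ck_ext k exterior (fun x => sqrt (coordinate j1 x * coordinate j1 x
     + coordinate j2 x * coordinate j2 x + coordinate j3 x * coordinate j3 x))); auto.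
  { intros z _. symmetry. apply norm3_coordinates. }
  assert (C := Ck_coordinate k).
  apply (Ck_sqrt (V := space3)); auto using exterior_square_pos. solve_Ck space3.
Qed.

Lemma Ck_perturbation k i j : Ck k exterior (perturbation i j).
Proof.
  assert (O := open_exterior). assert (N := Ck_norm3 k). assert (C := Ck_coordinate k).
  unfold perturbation. solve_Ck space3; unfold exterior; intros; lra.
Qed.

Lemma coordinate_is_dir i k x : is_dir (coordinate i) (basis3 k) x (kron i k).
Proof.
  rewrite <- coordinate_basis. apply is_dir_linear.
  intros y h v. destruct i; reflexivity.
Qed.

Lemma norm3_is_dir k x : exterior x ->
  is_dir norm3 (basis3 k) x (coordinate k x * / norm3 x).
Proof.
  intros Hx. assert (P := exterior_square_pos x Hx).
  apply (is_dir_ext exterior (fun x => sqrt (coordinate j1 x * coordinate j1 x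
     + coordinate j2 x * coordinate j2 x + coordinate j3 x * coordinate j3 x))); auto.
  apply open_exterior. { intros z _. symmetry. apply norm3_coordinates. }
  evar_last.
  { apply is_dir_sqrt; [|exact P].
    apply is_dir_plus; [apply is_dir_plus|]; apply is_dir_mult; apply coordinate_is_dir. }
  cbv beta. rewrite <- norm3_coordinates. unfold exterior in Hx.
  destruct k; simpl kron; field; lra.
Qed.

(** ** Orders of decay *)

Definition bounded (C : R) (p : Z) (f : space -> R) : Prop :=
  forall x, exterior x -> Rabs (f x) <= C * powerRZ (norm3 x) p.

Definition order (p : Z) (f : space -> R) : Prop := exists C, bounded C p f.

Lemma power_pos x p : exterior x -> 0 < powerRZ (norm3 x) p.
Proof. unfold exterior. intros H. apply powerRZ_lt. lra. Qed.

Lemma bounded_le C C' p f : C <= C' -> bounded C p f -> bounded C' p f.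
Proof.
  intros H B x Hx. specialize (B x Hx). assert (P := power_pos x p Hx). nra.
Qed.

Lemma order_ext p f g : (forall x, exterior x -> f x = g x) -> order p f -> order p g.
Proof. intros E [C B]. exists C. intros x Hx. rewrite <- E; auto. Qed.

Lemma order_mult p q f g : order p f -> order q g -> order (p + q) (fun x => f x * g x).
Proof.
  intros [A HA] [B HB]. exists (A * B). intros x Hx.
  rewrite powerRZ_add by (unfold exterior in Hx; lra). rewrite Rabs_mult.
  specialize (HA x Hx). specialize (HB x Hx).
  replace (A * B * (powerRZ (norm3 x) p * powerRZ (norm3 x) q))
    with ((A * powerRZ (norm3 x) p) * (B * powerRZ (norm3 x) q)) by ring.
  apply Rmult_le_compat; auto using Rabs_pos.
Qed.

Lemma order_plus p f g : order p f -> order p g -> order p (fun x => f x + g x).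
Proof.
  intros [A HA] [B HB]. exists (A + B). intros x Hx.
  specialize (HA x Hx). specialize (HB x Hx).
  generalize (Rabs_triang (f x) (g x)). lra.
Qed.

Lemma order_opp p f : order p f -> order p (fun x => - f x).
Proof. intros [A HA]. exists A. intros x Hx. rewrite Rabs_Ropp. auto. Qed.

Lemma order_const c : order 0 (fun _ => c).
Proof. exists (Rabs c). intros x _. simpl. lra. Qed.

Lemma order_weaken p q f : (p <= q)%Z -> order p f -> order q f.
Proof.
  intros H [A HA]. exists (Rabs A). intros x Hx. specialize (HA x Hx).
  assert (K : powerRZ (norm3 x) p <= powerRZ (norm3 x) q).
  { rewrite !powerRZ_Rpower by (unfold exterior in Hx; lra).
    apply Rle_Rpower. unfold exterior in Hx; lra. now apply IZR_le. }
  assert (P := power_pos x p Hx). assert (A1 := Rle_abs A). assert (A2 := Rabs_pos A).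
  apply (Rle_trans _ _ _ HA). apply Rle_trans with (Rabs A * powerRZ (norm3 x) p); nra.
Qed.

(** This class is closed under products and inverses, which reduces the decay of
    the metric to that of the coordinates and of r. *)
Record decays (n : Z) (f : space -> R) : Prop := {
  decays_Ck : Ck 2 exterior f;
  decays_0 : order n f;
  decays_1 : forall k, order (n - 1) (pd3 k f);
  decays_2 : forall k l, order (n - 2) (pd3 l (pd3 k f))
}.

Lemma Ck2_is f k x : Ck 2 exterior f -> exterior x ->
  is_dir f (basis3 k) x (pd3 k f x).
Proof. intros H Hx. apply ex_dir_is, (Ck_ex 1 exterior); auto. Qed.

Lemma Ck2_is2 f k l x : Ck 2 exterior f -> exterior x ->
  is_dir (pd3 k f) (basis3 l) x (pd3 l (pd3 k f) x).
Proof. intros H Hx. apply ex_dir_is, (Ck_ex 0 exterior); auto. now apply (Ck_dir 1). Qed.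

(** Second derivatives may be computed from any expression of the first ones. *)
Lemma decays_intro n f (f1 : idx3 -> space -> R) (f2 : idx3 -> idx3 -> space -> R) :
  Ck 2 exterior f -> order n f ->
  (forall k x, exterior x -> is_dir f (basis3 k) x (f1 k x)) ->
  (forall k l x, exterior x -> is_dir (f1 k) (basis3 l) x (f2 k l x)) ->
  (forall k, order (n - 1) (f1 k)) -> (forall k l, order (n - 2) (f2 k l)) ->
  decays n f.
Proof.
  intros H H0 D1 D2 O1 O2. split; auto.
  - intros k. apply (order_ext _ (f1 k)); auto.
    intros x Hx. symmetry. now apply is_dir_unique, D1.
  - intros k l. apply (order_ext _ (f2 k l)); auto.
    intros x Hx. symmetry. unfold pd3 at 1. rewrite (dir_ext exterior _ (f1 k)).
    now apply is_dir_unique, D2. apply open_exterior. auto.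
    intros z Hz. now apply is_dir_unique, D1.
Qed.

Lemma decays_mult n m f g : decays n f -> decays m g ->
  decays (n + m) (fun x => f x * g x).
Proof.
  intros [F F0 F1 F2] [G G0 G1 G2].
  apply (decays_intro _ _ (fun k x => pd3 k f x * g x + f x * pd3 k g x)
    (fun k l x => (pd3 l (pd3 k f) x * g x + pd3 k f x * pd3 l g x)
       + (pd3 l f x * pd3 k g x + f x * pd3 l (pd3 k g) x))).
  - apply (Ck_mult (V := space3)); auto. apply open_exterior.
  - now apply order_mult.
  - intros k x Hx. apply (is_dir_mult f g); now apply Ck2_is.
  - intros k l x Hx.
    apply (is_dir_plus (fun x => pd3 k f x * g x) (fun x => f x * pd3 k g x));
    [apply (is_dir_mult (pd3 k f) g) | apply (is_dir_mult f (pd3 k g))];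
    auto using Ck2_is, Ck2_is2.
  - intros k. apply order_plus.
    + replace (n + m - 1)%Z with (n - 1 + m)%Z by lia. now apply order_mult.
    + replace (n + m - 1)%Z with (n + (m - 1))%Z by lia. now apply order_mult.
  - intros k l. apply order_plus; apply order_plus.
    + replace (n + m - 2)%Z with (n - 2 + m)%Z by lia. now apply order_mult.
    + replace (n + m - 2)%Z with (n - 1 + (m - 1))%Z by lia. now apply order_mult.
    + replace (n + m - 2)%Z with (n - 1 + (m - 1))%Z by lia. now apply order_mult.
    + replace (n + m - 2)%Z with (n + (m - 2))%Z by lia. now apply order_mult.
Qed.

Lemma decays_inv n f : decays n f -> (forall x, exterior x -> f x <> 0) ->
  order (- n) (fun x => / f x) -> decays (- n) (fun x => / f x).
Proof.
  intros [F F0 F1 F2] N I.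
  apply (decays_intro _ _ (fun k x => - (pd3 k f x * (/ f x * / f x)))
    (fun k l x => - (pd3 l (pd3 k f) x * (/ f x * / f x))
       + (1 + 1) * (pd3 k f x * pd3 l f x * (/ f x * / f x * / f x)))).
  - apply (Ck_inv (V := space3)); auto. apply open_exterior.
  - exact I.
  - intros k x Hx. evar_last. apply is_dir_inv. now apply Ck2_is. auto. field. auto.
  - intros k l x Hx. evar_last.
    { apply is_dir_opp. apply (is_dir_mult (pd3 k f)). now apply Ck2_is2.
      apply is_dir_mult; apply is_dir_inv; auto using Ck2_is. }
    cbv beta. field. auto.
  - intros k. apply order_opp.
    replace (- n - 1)%Z with (n - 1 + (- n + - n))%Z by lia.
    apply order_mult; auto. now apply order_mult.
  - intros k l. apply order_plus.
    + apply order_opp. replace (- n - 2)%Z with (n - 2 + (- n + - n))%Z by lia.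
      apply order_mult; auto. now apply order_mult.
    + replace (- n - 2)%Z with (0 + (n - 1 + (n - 1) + (- n + - n + - n)))%Z by lia.
      apply order_mult. apply order_const. apply order_mult. now apply order_mult.
      apply order_mult; auto. now apply order_mult.
Qed.

Lemma coordinate_order i : order 1 (coordinate i).
Proof.
  exists 1. intros x Hx. simpl. rewrite Rmult_1_r, Rmult_1_l.
  rewrite norm3_coordinates, <- sqrt_Rsqr_abs. apply sqrt_le_1_alt. unfold Rsqr.
  destruct i; nra.
Qed.

Lemma norm3_inv_order : order (-1) (fun x => / norm3 x).
Proof.
  exists 1. intros x Hx. unfold exterior in Hx. simpl. rewrite Rmult_1_r.
  rewrite Rabs_right. lra. apply Rle_ge. left. apply Rinv_0_lt_compat. lra.
Qed.

Lemma coordinate_decays i : decays 1 (coordinate i).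
Proof.
  apply (decays_intro _ _ (fun k _ => kron i k) (fun _ _ _ => 0)).
  - apply Ck_coordinate.
  - apply coordinate_order.
  - intros. apply coordinate_is_dir.
  - intros. apply is_dir_const.
  - intros. apply order_const.
  - intros k l. exists 0. intros x _. rewrite Rabs_R0. lra.
Qed.

Lemma norm3_shift_decays c : decays 1 (fun x => norm3 x - c).
Proof.
  apply (decays_intro _ _ (fun k x => coordinate k x * / norm3 x)
    (fun k l x => kron k l * / norm3 x
       + coordinate k x * - (coordinate l x * / norm3 x * (/ norm3 x * / norm3 x)))).
  - apply (Ck_minus (V := space3)). apply open_exterior. apply Ck_norm3. apply Ck_const.
  - apply (order_plus 1 norm3 (fun _ => - c)).
    + exists 1. intros x _. simpl. rewrite Rabs_right. lra.
      apply Rle_ge, sqrt_pos.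
    + apply (order_weaken 0); [lia | apply order_const].
  - intros k x Hx. replace (coordinate k x * / norm3 x)
      with (coordinate k x * / norm3 x - 0) by ring.
    apply (is_dir_minus norm3 (fun _ => c)). now apply norm3_is_dir. apply is_dir_const.
  - intros k l x Hx. assert (N : norm3 x <> 0) by (unfold exterior in Hx; lra).
    evar_last.
    { apply (is_dir_mult (coordinate k)). apply coordinate_is_dir.
      apply is_dir_inv. now apply norm3_is_dir. exact N. }
    cbv beta. field. exact N.
  - intros k. apply (order_mult 1 (-1)). apply coordinate_order. apply norm3_inv_order.
  - intros k l. apply order_plus.
    + apply (order_mult 0 (-1)). apply order_const. apply norm3_inv_order.
    + apply (order_mult 1 (-2)). apply coordinate_order. apply order_opp.
      apply (order_mult 0 (-2)).
      * apply (order_mult 1 (-1)). apply coordinate_order. apply norm3_inv_order.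
      * apply (order_mult (-1) (-1)); apply norm3_inv_order.
Qed.

Lemma perturbation_decays i j : decays (-1) (perturbation i j).
Proof.
  assert (I : decays (-1) (fun x => / norm3 x)).
  { apply (decays_inv 1 norm3).
    - replace norm3 with (fun x => norm3 x - 0) by
        (apply functional_extensionality; intros; ring).
      apply norm3_shift_decays.
    - unfold exterior. intros. lra.
    - apply norm3_inv_order. }
  apply (decays_mult 2 (-3)).
  - apply (decays_mult 1 1); apply coordinate_decays.
  - apply (decays_mult (-2) (-1)).
    + now apply (decays_mult (-1) (-1)).
    + apply (decays_inv 1 (fun x => norm3 x - 1)).
      * apply norm3_shift_decays.
      * unfold exterior. intros. lra.
      * (* outside the ball of radius 2, r - 1 is at least r / 2 *)
        exists 2. intros x Hx. unfold exterior in Hx. simpl. rewrite Rmult_1_r.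
        rewrite Rabs_right.
        -- replace 2 with (/ / 2) by field. rewrite <- Rinv_mult.
           apply Rinv_le_contravar; lra.
        -- apply Rle_ge. left. apply Rinv_0_lt_compat. lra.
Qed.

Lemma uniform_bound (P : idx3 -> R -> Prop) :
  (forall i C C', C <= C' -> P i C -> P i C') ->
  (forall i, exists C, P i C) -> exists C, forall i, P i C.
Proof.
  intros M H. destruct (H j1) as [A HA], (H j2) as [B HB], (H j3) as [C HC].
  exists (Rmax A (Rmax B C)). intros [| |].
  - apply (M j1 A); auto. apply Rmax_l.
  - apply (M j2 B); auto. apply Rle_trans with (2 := Rmax_r _ _). apply Rmax_l.
  - apply (M j3 C); auto. apply Rle_trans with (2 := Rmax_r _ _). apply Rmax_r.
Qed.

Section Mass.
Context (gb : idx3 -> idx3 -> space -> R)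
  (Hgb : forall i j x, 1 < norm3 x -> gb i j x = kron i j + perturbation i j x).

Lemma gb_exterior i j x : exterior x -> gb i j x = kron i j + perturbation i j x.
Proof. unfold exterior. intros Hx. apply Hgb. lra. Qed.

Lemma pd3_gb k i j x : exterior x -> pd3 k (gb i j) x = pd3 k (perturbation i j) x.
Proof.
  intros Hx. apply is_dir_unique.
  apply (is_dir_ext exterior (fun x => kron i j + perturbation i j x)); auto.
  apply open_exterior. { intros z Hz. symmetry. now apply gb_exterior. }
  replace (pd3 k (perturbation i j) x) with (0 + pd3 k (perturbation i j) x) by ring.
  apply (is_dir_plus (fun _ => kron i j)). apply is_dir_const.
  apply Ck2_is; auto. apply Ck_perturbation.
Qed.

Lemma pd3_pd3_gb k l i j x : exterior x ->
  pd3 l (pd3 k (gb i j)) x = pd3 l (pd3 k (perturbation i j)) x.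
Proof.
  intros Hx. apply (dir_ext exterior); auto. apply open_exterior.
  intros z Hz. now apply pd3_gb.
Qed.

Lemma perturbation_flat : asymptotically_flat gb.
Proof.
  set (Q := fun C i j k l => bounded C (-1) (perturbation i j) /\
    bounded C (-2) (pd3 k (perturbation i j)) /\
    bounded C (-3) (pd3 l (pd3 k (perturbation i j)))).
  assert (M : forall i j k l C C', C <= C' -> Q C i j k l -> Q C' i j k l).
  { intros i j k l C C' H [Q1 [Q2 Q3]].
    refine (conj _ (conj _ _)); apply (bounded_le C); auto. }
  assert (U : exists C, forall i j k l, Q C i j k l).
  { apply (uniform_bound (fun i C => forall j k l, Q C i j k l)).
    { intros i C C' H HQ j k l. apply (M i j k l C); auto. }
    intros i. apply (uniform_bound (fun j C => forall k l, Q C i j k l)).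
    { intros j C C' H HQ k l. apply (M i j k l C); auto. }
    intros j. apply (uniform_bound (fun k C => forall l, Q C i j k l)).
    { intros k C C' H HQ l. apply (M i j k l C); auto. }
    intros k. apply (uniform_bound (fun l C => Q C i j k l)).
    { intros l C C' H HQ. apply (M i j k l C); auto. }
    intros l. destruct (perturbation_decays i j) as [_ [A HA] D1 D2].
    destruct (D1 k) as [B HB], (D2 k l) as [C HC].
    exists (Rmax A (Rmax B C)). refine (conj _ (conj _ _)).
    - apply (bounded_le A); auto. apply Rmax_l.
    - apply (bounded_le B); auto. apply Rle_trans with (2 := Rmax_r _ _). apply Rmax_l.
    - apply (bounded_le C); auto. apply Rle_trans with (2 := Rmax_r _ _). apply Rmax_r. }
  destruct U as [C U]. exists 2, C, 1. split; [lra|]. split; [lra|].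
  intros i j. split.
  - apply (Ck_ext 2 exterior (fun x => kron i j + perturbation i j x)).
    + apply open_exterior.
    + intros z Hz. symmetry. now apply gb_exterior.
    + apply (Ck_plus (V := space3)). apply open_exterior. apply Ck_const.
      apply Ck_perturbation.
  - intros x Hx. assert (Hx' : exterior x) by exact Hx.
    assert (P : 0 < norm3 x) by lra.
    replace (- (1)) with (IZR (-1)) by reflexivity.
    replace (IZR (-1) - 1) with (IZR (-2)) by (simpl; lra).
    replace (IZR (-1) - 2) with (IZR (-3)) by (simpl; lra).
    rewrite <- !powerRZ_Rpower by auto.
    refine (conj _ (conj _ _)).
    + rewrite gb_exterior by auto. replace (_ - _) with (perturbation i j x) by ring.
      now apply (U i j j1 j1).
    + intros k. rewrite pd3_gb by auto. now apply (U i j k j1).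
    + intros k l. rewrite pd3_pd3_gb by auto. now apply (U i j k l).
Qed.

(** The radial factor of the perturbation; [profile'] is its derivative divided
    by r, which is what the chain rule produces. *)
Definition profile (r : R) : R := / r * / r * / (r - 1).
Definition profile' (r : R) : R := - (3 * r - 2) / (r ^ 4 * (r - 1) ^ 2).

Lemma pd3_perturbation k i j x : exterior x -> pd3 k (perturbation i j) x =
  (kron i k * coordinate j x + coordinate i x * kron j k) * profile (norm3 x)
  + coordinate i x * coordinate j x * (coordinate k x * profile' (norm3 x)).
Proof.
  intros Hx. assert (N := Hx). unfold exterior in N.
  apply is_dir_unique. unfold perturbation.
  apply (is_dir_mult (fun x => coordinate i x * coordinate j x)
    (fun x => profile (norm3 x))).
  - apply is_dir_mult; apply coordinate_is_dir.
  - evar_last.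
    { apply is_dir_comp. 2: now apply norm3_is_dir.
      unfold profile. auto_derive. repeat split; lra. reflexivity. }
    unfold profile'. field. lra.
Qed.

(** The derivatives of the profile cancel by symmetry, leaving 2 r times the profile. *)
Lemma mass_integrand rho om : 2 < rho -> on_sphere om ->
  sum3 (fun i => sum3 (fun j =>
        (pd3 j (gb i j) (scal rho om) - pd3 i (gb j j) (scal rho om))
        * dot om (basis3 i))) * rho ^ 2 = 2 * (rho / (rho - 1)).
Proof.
  intros Hr Hom.
  assert (Nr : norm3 (scal rho om) = rho) by (apply norm3_scal; auto; lra).
  assert (Hx : exterior (scal rho om)) by (unfold exterior; lra).
  assert (Cx : forall i, coordinate i (scal rho om) = rho * coordinate i om).
  { intros []; reflexivity. }
  unfold on_sphere in Hom. rewrite dot_coordinates in Hom. unfold sum3 in *.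
  rewrite !pd3_gb, !pd3_perturbation, !Nr, !Cx, !dot_basis by auto.
  unfold kron. generalize (profile' rho). intros P'.
  transitivity (2 * profile rho * rho ^ 3 *
    (coordinate j1 om * coordinate j1 om + coordinate j2 om * coordinate j2 om
      + coordinate j3 om * coordinate j3 om)). ring.
  rewrite Hom. unfold profile. field. lra.
Qed.

Lemma sphere_integral_const (f : space -> R) (c : R) :
  (forall x, on_sphere x -> f x = c) -> sphere_integral round f = 4 * PI * c.
Proof.
  intros Hf. unfold sphere_integral.
  rewrite (RInt_ext _ (fun th => 2 * PI * c * sin th)).
  - apply is_RInt_unique.
    replace (4 * PI * c) with (minus (- (2 * PI * c) * cos PI) (- (2 * PI * c) * cos 0)).
    2: { rewrite cos_PI, cos_0. unfold minus, plus, opp; simpl. ring. }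
    apply (is_RInt_derive (fun th => - (2 * PI * c) * cos th)).
    + intros x _. auto_derive; [trivial|ring].
    + intros x _. apply (@ex_derive_continuous R_AbsRing R_NormedModule
        (fun th => 2 * PI * c * sin th)). now auto_derive.
  - intros th Hth. rewrite Rmin_left, Rmax_right in Hth by (generalize PI_RGT_0; lra).
    rewrite (RInt_ext _ (fun _ => c * sin th)).
    + rewrite RInt_const. unfold scal; simpl. unfold mult; simpl. ring.
    + intros ph _.
      assert (S1 := sin2_cos2 th). assert (S2 := sin2_cos2 ph). unfold Rsqr in *.
      rewrite Hf.
      2: { unfold on_sphere, dot. transitivity (sin th * sin th *
             (sin ph * sin ph + cos ph * cos ph) + cos th * cos th). ring.
           rewrite S2. lra. }
      f_equal. replace (_ - _) with (sin th * sin th).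
      * apply sqrt_square. apply sin_ge_0; lra.
      * unfold round, dot. 
        transitivity ((cos th * cos th * (sin ph * sin ph + cos ph * cos ph) + sin th * sin th)
          * (sin th * sin th * (sin ph * sin ph + cos ph * cos ph))).
        rewrite S2. rewrite Rmult_1_r. rewrite (Rplus_comm (cos th * cos th)), S1. ring.
        ring.
Qed.

Lemma perturbation_mass : ADM_mass_is gb (1 / 2).
Proof.
  split. { apply perturbation_flat. }
  apply (is_lim_ext_loc (fun rho => / 2 * (1 + / (rho - 1)))).
  - exists 2. intros rho Hr.
    rewrite (sphere_integral_const _ (2 * (rho / (rho - 1)))).
    + field. split; [lra|]. apply PI_neq0.
    + intros om Hom. now apply mass_integrand.
  - replace (Finite (1 / 2)) with (Rbar_mult (/ 2) (Rbar_plus 1 (Rbar_inv p_infty))).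
    2: { simpl. f_equal. field. }
    apply is_lim_scal_l. apply (is_lim_plus' (fun _ => 1)).
    apply is_lim_const.
    change (is_lim (fun rho => / (rho - 1)) p_infty (Rbar_inv p_infty)).
    apply is_lim_inv; [|discriminate].
    apply (is_lim_minus _ _ _ p_infty 1). apply is_lim_id. apply is_lim_const.
    reflexivity.
Qed.
End Mass.

Theorem corollary14 (alpha : R) (g : R -> metric) (u : R -> space -> R)
  (halpha : 0 < alpha < 1)
  (hu : obtained_by_construction alpha round (fun _ _ => 0) g u) :
  (forall (t : R) (x v w : space) (a b : R),
     1 < t -> on_sphere x -> tangent x v -> tangent x w ->
     bar_metric u g t x (a, v) (b, w)
     = / (1 - / t) * (a * b) + t ^ 2 * round x v w) /\
  totally_geodesic_boundary u g /\
  ADM_mass_is (cartesian u g) (1 / 2).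
Proof.
  destruct hu as [F [HF [_ [phi [w [e [ut D]]]]]]].
  assert (Hu := data_lapse alpha g F phi w e ut u HF D).
  assert (Hg := flow_round g F HF).
  refine (conj _ (conj _ _)).
  - intros t x v z a b Ht Hx Hv Hz. unfold bar_metric. simpl fst. simpl snd.
    rewrite Hu, Hg by (auto; lra). unfold lapse.
    rewrite pow2_sqrt by (left; now apply lapse_arg). f_equal. field. lra.
  - now apply boundary_geodesic.
  - apply perturbation_mass. intros i j x Hx. now apply cartesian_perturbation.
Qed.
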